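(* Let $q=2$. For each $\kappa\in\Sigma$ let $\{a_k(\kappa)\}_{k\in\mathbb N}$ and $\{\sigma_k(\kappa)\}_{k\in\mathbb N}$ be increasing sequences such that, for some constants $0<b_0<B_0$, some $c_0>1$ and some increasing sequence $\tau_k>1$, $\tau_k\to\infty$, one has for all $\kappa\in\Sigma$ and $k\in\mathbb N$ $$b_0\le a_1(\kappa)\le B_0,\quad b_0\le\sigma_1(\kappa)\le B_0,\quad \sigma_{k+1}(\kappa)/\sigma_k(\kappa)\ge\tau_k,\quad a_{k+1}(\kappa)/a_k(\kappa)\ge c_0.$$ All limits are as $\varepsilon\to0$ unless indicated otherwise. (a) (Lower bounds.) Assume that there are $b>0$ and $C\ge1$ such that $$\liminf_{A\to\infty}\frac{\log M(A,\Sigma)}{\log\log A}=b,\qquad \sup_{\kappa\in\Sigma}u^{\mathrm{lin}}_\varepsilon(\kappa,r_\varepsilon(\kappa))\le C\,u^{\mathrm{lin}}_\varepsilon(\Sigma).$$ Then there exists a constant $d>0$ such that if $\limsup u^{\mathrm{lin}}_\varepsilon(\Sigma)/\log\log(\varepsilon^{-1})\le d$, then $\gamma_\varepsilon(\Theta_\varepsilon(\Sigma))\to1$. (b) (Upper bounds.) Assume that $\limsup_{A\to\infty}L(A,\Sigma)/\log\log A\le1$. Let $T_\varepsilon\to\infty$ with $T_\varepsilon=o\big(\sqrt{\log\log(\varepsilon^{-1})}\big)$, and let $$T_{\varepsilon,k}=\max\Big(T_\varepsilon,\sqrt{2(\log k+\log\log k)}\Big),\qquad \psi_\varepsilon=\mathbf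 1\{\exists\,k\in\mathbb N:\ |y_k|>\varepsilon T_{\varepsilon,k}\}.$$ Then there exists a constant $D>0$ such that if $u^{\mathrm{lin}}_\varepsilon(\Sigma)>D\log\log(\varepsilon^{-1})$, then $\gamma_\varepsilon(\Theta_\varepsilon(\Sigma),\psi_\varepsilon)=o(1)$. (c) (Adaptive separation rates.) Under the assumptions of (a) and (b), the adaptive separation rates $r^{\mathrm{ad}}_\varepsilon(\kappa)$, $\kappa\in\Sigma$, are determined by the relation $u^{\mathrm{lin}}_{\varepsilon,\mathrm{ad}}\asymp u^{\mathrm{lin}}_\varepsilon(\kappa,r^{\mathrm{ad}}_\varepsilon(\kappa))$, where $u^{\mathrm{lin}}_{\varepsilon,\mathrm{ad}}=\log\log(\varepsilon^{-1})$.
   Context: Model: one observes $y=\{y_k\}_{k\in\mathbb N}$, $y_k=\eta_k+\varepsilon\xi_k$, with $\xi_k$ i.i.d. $N(0,1)$, $\varepsilon>0$ small, $\eta\in\ell^2$ unknown; $E_{\varepsilon,\eta}$ is the corresponding expectation. A test $\psi$ is a measurable function of $y$ with values in $[0,1]$; $\gamma_\varepsilon(\Theta,\psi)=E_{\varepsilon,0}\psi+\sup_{\eta\in\Theta}E_{\varepsilon,\eta}(1-\psi)$, $\gamma_\varepsilon(\Theta)=\inf_\psi\gamma_\varepsilon(\Theta,\psi)$. Adaptive setting: a parameter set $\Sigma$ and a family of radii $r_\varepsilon(\kappa)>0$, $\kappa\in\Sigma$, with $r_\varepsilon(\kappa)\to0$ as $\varepsilon\to0$ (and $r_\varepsilon(\kappa)<1/a_1(\kappa)$)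 are given. For $\kappa\in\Sigma$, $r>0$, $$\Theta_\varepsilon(\kappa,r)=\Big\{\eta\in\ell^2:\sum_k|a_k(\kappa)\sigma_k(\kappa)\eta_k|^2\le1,\ \sum_k\sigma_k(\kappa)^2\eta_k^2\ge r^2\Big\},$$ $\Theta_\varepsilon(\Sigma)=\bigcup_{\kappa\in\Sigma}\Theta_\varepsilon(\kappa,r_\varepsilon(\kappa))$. One tests $H_0:\eta=0$ against $H_1:\eta\in\Theta_\varepsilon(\Sigma)$. For $0<r<1/a_1(\kappa)$ choose an integer $n=n(\kappa,r)\ge2$ with $r\in[1/a_n(\kappa),1/a_{n-1}(\kappa)]$ and set, with $a_k=a_k(\kappa)$, $\sigma_k=\sigma_k(\kappa)$, $$u^{\mathrm{lin}}_\varepsilon(\kappa,r)=\frac{1}{\varepsilon^2(a_n^2-a_{n-1}^2)}\left(\frac{a_n^2r^2-1}{\sigma_{n-1}^2}+\frac{1-a_{n-1}^2r^2}{\sigma_n^2}\right),\qquad u^{\mathrm{lin}}_\varepsilon(\Sigma)=\inf_{\kappa\in\Sigma}u^{\mathrm{lin}}_\varepsilon(\kappa,r_\varepsilon(\kappa)).$$ For $A>0$ large enough, the integer $m=m(A,\kappa)$ is defined by $a_{m-1}(\kappa)\sigma_{m-1}(\kappa)\le A<a_m(\kappa)\sigma_m(\kappa)$. $M(A,\Sigma)$ is the cardinality of $\{m(A,\kappa):\kappa\in\Sigma\}\subset\mathbb N$, and $L(A,\Sigma)=\sup_{\kappa\in\Sigma}\log m(A,\kappa)$. A family $u^{\mathrm{lin}}_{\varepsilon,\mathrm{ad}}\to\infty$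 characterizes adaptive distinguishability if there are constants $0<d\le D<\infty$ such that $\gamma_\varepsilon(\Theta_\varepsilon(\Sigma))\to1$ when $\limsup_{\varepsilon\to0}\sup_{\kappa}u^{\mathrm{lin}}_\varepsilon(\kappa,r_\varepsilon(\kappa))/u^{\mathrm{lin}}_{\varepsilon,\mathrm{ad}}<d$ and $\gamma_\varepsilon(\Theta_\varepsilon(\Sigma))\to0$ when $\liminf_{\varepsilon\to0}\inf_\kappa u^{\mathrm{lin}}_\varepsilon(\kappa,r_\varepsilon(\kappa))/u^{\mathrm{lin}}_{\varepsilon,\mathrm{ad}}>D$ (with radii ranging, in the first relation, over families satisfying the second condition in (a)); the adaptive separation rates are the radii $r^{\mathrm{ad}}_\varepsilon(\kappa)$ at which $u^{\mathrm{lin}}_\varepsilon(\kappa,r^{\mathrm{ad}}_\varepsilon(\kappa))\asymp u^{\mathrm{lin}}_{\varepsilon,\mathrm{ad}}$. ($\asymp$: ratio bounded above and away from $0$ for small $\varepsilon$.) Convention: $T_{\varepsilon,1}=T_\varepsilon$. *)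

(* Defs.v *)
From HB Require Import structures.
From mathcomp Require Import all_boot all_order all_algebra.
From mathcomp Require Import finmap.
From mathcomp Require Import all_classical all_reals all_analysis.

Set Implicit Arguments.
Unset Strict Implicit.
Unset Printing Implicit Defensive.

Import Order.TTheory GRing.Theory Num.Theory.
Import numFieldNormedType.Exports.

Local Open Scope classical_set_scope.
Local Open Scope ring_scope.

(* Sequences indexed by {1, 2, 3, ...} are functions on nat whose value at 0
   is never used: sums start at 1, hypotheses and sigma-algebras only involve
   the coordinates k >= 1. *)

Definition increasing1 {R : realType} (u : nat -> R) : Prop :=
  forall k l : nat, (1 <= k <= l)%N -> u k <= u l.

Section Model.
Context {R : realType} {d : measure_display} {T : measurableType d}.
Variables (P : probability T R) (xi : nat -> {RV P >-> R}).

Definition iid_std_normal : Prop :=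
  (forall (k : nat) (B : set R), (1 <= k)%N -> measurable B ->
     distribution P (xi k) B = normal_prob 0 1 B) /\
  (forall (J : {fset nat}) (B : nat -> set R),
     (forall k, k \in J -> (1 <= k)%N) -> (forall k, measurable (B k)) ->
     P [set w | forall k, k \in J -> B k (xi k w)] =
     (\prod_(k <- J) P (xi k @^-1` B k))%E).

Definition observation (eps : R) (eta : nat -> R) (w : T) : nat -> R :=
  fun k => eta k + eps * xi k w.

(* The product sigma-algebra of the observation space is generated by the
   coordinates k >= 1, so a test does not depend on the coordinate 0. *)
Definition coordinate_events : set (set (nat -> R)) :=
  [set A | exists k : nat, exists B : set R,
    [/\ (1 <= k)%N, measurable B & A = [set y | B (y k)]]].

Definition is_test (psi : (nat -> R) -> R) : Prop :=
  (forall y, 0 <= psi y <= 1) /\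
  (forall B : set R, measurable B -> <<s coordinate_events >> (psi @^-1` B)).

Definition expect (eps : R) (eta : nat -> R) (psi : (nat -> R) -> R) : \bar R :=
  ('E_P[fun w => psi (observation eps eta w)])%E.

Definition gamma_test (eps : R) (Theta : set (nat -> R))
    (psi : (nat -> R) -> R) : \bar R :=
  (expect eps (fun=> 0%R) psi +
   ereal_sup [set expect eps eta (fun y => 1 - psi y)%R | eta in Theta])%E.

Definition gamma (eps : R) (Theta : set (nat -> R)) : \bar R :=
  ereal_inf [set gamma_test eps Theta psi | psi in [set psi | is_test psi]].

End Model.

Definition loglog {R : realType} (x : R) : R := ln (ln x).

Section Adaptive.
Context {R : realType} {Sigma : Type}.
Variables a sigma : Sigma -> nat -> R.

Definition Theta_ball (kappa : Sigma) (r : R) : set (nat -> R) :=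
  [set eta |
    [/\ (\sum_(1 <= k <oo) ((eta k ^+ 2)%:E) < +oo)%E,
        (\sum_(1 <= k <oo)
           ((`|a kappa k * sigma kappa k * eta k| ^+ 2)%:E) <= 1)%E &
        ((r ^+ 2)%:E <=
           \sum_(1 <= k <oo) ((sigma kappa k ^+ 2 * eta k ^+ 2)%:E))%E]].

Definition Theta_union (r : Sigma -> R) : set (nat -> R) :=
  \bigcup_kappa Theta_ball kappa (r kappa).

Definition bracketing (n : Sigma -> R -> nat) : Prop :=
  forall (kappa : Sigma) (r : R), 0 < r < (a kappa 1%N)^-1 ->
    (2 <= n kappa r)%N /\
    (a kappa (n kappa r))^-1 <= r <= (a kappa (n kappa r).-1)^-1.

Definition u_lin (n : Sigma -> R -> nat) (eps : R) (kappa : Sigma) (r : R) : R :=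
  let an := a kappa (n kappa r) in
  let an1 := a kappa (n kappa r).-1 in
  let sn := sigma kappa (n kappa r) in
  let sn1 := sigma kappa (n kappa r).-1 in
  (eps ^+ 2 * (an ^+ 2 - an1 ^+ 2))^-1 *
  ((an ^+ 2 * r ^+ 2 - 1) / sn1 ^+ 2 + (1 - an1 ^+ 2 * r ^+ 2) / sn ^+ 2).

Definition u_inf (n : Sigma -> R -> nat) (eps : R) (r : Sigma -> R) : \bar R :=
  ereal_inf (range (fun kappa => (u_lin n eps kappa (r kappa))%:E)).

Definition u_sup (n : Sigma -> R -> nat) (eps : R) (r : Sigma -> R) : \bar R :=
  ereal_sup (range (fun kappa => (u_lin n eps kappa (r kappa))%:E)).

(* When a kappa * sigma kappa increases strictly to infinity and
   A >= a kappa 1 * sigma kappa 1, exactly one m satisfies the condition. *)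
Definition m_index (A : R) (kappa : Sigma) : nat :=
  xget 0%N [set m : nat | (2 <= m)%N /\
    a kappa m.-1 * sigma kappa m.-1 <= A < a kappa m * sigma kappa m].

(* [fset_set] sends infinite sets to the empty set, but the indices m_index A
   are bounded as soon as the products a kappa k * sigma kappa k tend to
   infinity uniformly in kappa. *)
Definition M_card (A : R) : nat := #|` fset_set (range (m_index A))|%fset.

Definition L_sup (A : R) : \bar R :=
  ereal_sup (range (fun kappa => (ln ((m_index A kappa)%:R : R))%:E)).

Definition radii (r : R -> Sigma -> R) : Prop :=
  (\forall eps \near (0 : R)^'+, forall kappa,
     0 < r eps kappa < (a kappa 1%N)^-1) /\
  (forall kappa, r eps kappa @[eps --> (0 : R)^'+] --> (0 : R)).

Definition comparable_radii (n : Sigma -> R -> nat) (C : R)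
    (r : R -> Sigma -> R) : Prop :=
  \forall eps \near (0 : R)^'+,
    (u_sup n eps (r eps) <= C%:E * u_inf n eps (r eps))%E.

Definition M_growth (b : R) : Prop :=
  limf_einf (fun A : R => (ln ((M_card A)%:R : R) / loglog A)%:E) +oo%R = b%:E.

Definition L_growth : Prop :=
  (limf_esup (fun A : R => L_sup A * ((loglog A)^-1)%:E) +oo%R <= 1)%E.

Definition characterizes {d : measure_display} {T : measurableType d}
    (P : probability T R) (xi : nat -> {RV P >-> R})
    (n : Sigma -> R -> nat) (uad : R -> R) : Prop :=
  (uad eps @[eps --> (0 : R)^'+] --> +oo%R) /\
  exists dl Du : R, [/\ 0 < dl, dl <= Du,
    forall r : R -> Sigma -> R, radii r ->
      (exists2 C : R, 1 <= C & comparable_radii n C r) ->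
      (limf_esup (fun eps => ereal_sup (range (fun kappa =>
         (u_lin n eps kappa (r eps kappa) / uad eps)%:E))) (0 : R)^'+
         < dl%:E)%E ->
      gamma xi eps (Theta_union (r eps)) @[eps --> (0 : R)^'+] --> 1%E &
    forall r : R -> Sigma -> R, radii r ->
      (Du%:E < limf_einf (fun eps => ereal_inf (range (fun kappa =>
         (u_lin n eps kappa (r eps kappa) / uad eps)%:E))) (0 : R)^'+)%E ->
      gamma xi eps (Theta_union (r eps)) @[eps --> (0 : R)^'+] --> 0%E].

Definition u_asymp (n : Sigma -> R -> nat) (r : R -> Sigma -> R)
    (uad : R -> R) : Prop :=
  exists c1 c2 : R, 0 < c1 /\
    \forall eps \near (0 : R)^'+, forall kappa,
      c1 <= u_lin n eps kappa (r eps kappa) / uad eps <= c2.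

Definition adaptive_separation_rates {d : measure_display}
    {T : measurableType d} (P : probability T R) (xi : nat -> {RV P >-> R})
    (n : Sigma -> R -> nat) (r : R -> Sigma -> R) : Prop :=
  exists2 uad : R -> R, characterizes xi n uad & u_asymp n r uad.

End Adaptive.

Definition threshold {R : realType} (Teps : R -> R) (eps : R) (k : nat) : R :=
  if (k <= 1)%N then Teps eps
  else Num.max (Teps eps) (Num.sqrt (2 * (ln (k%:R : R) + loglog (k%:R : R)))).

Definition psi_threshold {R : realType} (Teps : R -> R) (eps : R) :
    (nat -> R) -> R :=
  \1_[set y : nat -> R | exists k : nat,
        (1 <= k)%N /\ eps * threshold Teps eps k < `|y k|].

(* Main.v *)
(* Everything reduces to a linear program.  For fixed kappa, u_lin is
   |eta|^2 / eps^2 for a vector eta of Theta(kappa, r) supported on the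
   coordinates n-1 and n (the minimiser, up to constants), and
   1 / (eps a_n sigma_n)^2 <= u_lin <= 1 / (eps a_{n-1} sigma_{n-1})^2.

   Lower bound: when the values u_lin are comparable over kappa, the index n is
   m(A, kappa) or m(A, kappa) - 1 for the common level A with
   A^-2 = eps^2 inf u_lin, so M(A, Sigma) is, up to constants, the number of
   extremal vectors with almost disjoint supports.  Under the uniform mixture of
   these vectors the likelihood ratio has second moment 1 + O(e^u / M), where
   log M is at least of order log log (1 / eps); hence the total error tends to 1
   when u is a small multiple of log log (1 / eps).

   Upper bound: if all coordinates up to n were at most 2 eps T_n, the energy
   sum sigma_k^2 eta_k^2 up to n would be negligible because sigma_k grows at
   least geometrically, and the remaining coordinates would violate the
   ellipsoid constraint because a_k grows geometrically.  So one coordinate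
   passes its threshold by a factor 2, and log n <= L(1 / eps, Sigma).

   Adaptive rates: radii with a prescribed common value v(eps) of u_lin exist for
   every admissible v, so two rates characterising distinguishability are tested
   against each other on such radii and must be comparable. *)
Require Import Defs.
From HB Require Import structures.
From mathcomp Require Import all_boot all_order all_algebra.
From mathcomp Require Import finmap.
From mathcomp Require Import all_classical all_reals all_analysis.
From mathcomp Require Import measurable_realfun simple_functions measurable_fun_approximation.
From mathcomp Require Import ring lra zify.

Set Implicit Arguments.
Unset Strict Implicit.
Unset Printing Implicit Defensive.

Import Order.TTheory GRing.Theory Num.Theory.
Import numFieldNormedType.Exports.

Local Open Scope classical_set_scope.
Local Open Scope ring_scope.

(** * Densities and shifted normal laws *)

(** The hypothesis on the noise speaks of finitely many coordinates at a time. So the Gaussian shift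
    is built coordinate by coordinate: two laws on sequence space are compared on finite-dimensional
    rectangles, and the extremal vectors, with at most two nonzero coordinates, need only finitely
    many such shifts. Why [n] is almost determined by [A]: with [p k = a k * s k], the number
    [eps ^+ 2 * u] is a convex combination of [p n.-1 ^- 2] and [p n ^- 2], and comparability up to
    [C] blurs the level [A] by a factor sqrt C. Since [tau] tends to infinity, consecutive products
    are eventually further apart than that, so only two indices survive; the finitely many small
    indices, where this may fail, are discarded from the mixture at no cost because [M] tends to
    infinity. *)

Section Density.
Local Open Scope ereal_scope.
Context {d} {T : measurableType d} {R : realType}.
Variables (mu nu : {measure set T -> \bar R}) (g : T -> R).
Hypothesis (mg : measurable_fun setT g) (g0 : forall x, (0 <= g x)%R).
Hypothesis nuE :
  forall A, measurable A -> nu A = \int[mu]_(x in A) (g x)%:E.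

Import HBNNSimple.

(** Both integrals are monotone limits along the simple approximations of [f]; for a simple function
    the identity is the hypothesis on each level set. *)
Lemma ge0_integral_density (f : T -> \bar R) :
  measurable_fun setT f -> (forall x, 0 <= f x) ->
  \int[nu]_x f x = \int[mu]_x (f x * (g x)%:E).
Proof.
move=> mf f0.
have mgE : measurable_fun setT (EFin \o g) by exact/measurable_EFinP.
pose f_ := nnsfun_approx measurableT mf.
have cf x : (f_ n x)%:E @[n --> \oo] --> f x by exact: cvg_nnsfun_approx.
have ndf x : {homo (fun n => f_ n x) : m n / (m <= n)%N >-> (m <= n)%R}.
  by move=> m n mn; exact/lefP/nd_nnsfun_approx.
transitivity (limn (fun n => \int[nu]_x (f_ n x)%:E)).
  rewrite -monotone_convergence//.
  - by apply: eq_integral => x _; apply/esym/cvg_lim.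
  - by move=> n; exact/measurable_EFinP/measurable_funP.
  - by move=> n x _; rewrite lee_fin.
  - by move=> x _ m n mn; rewrite lee_fin ndf.
transitivity (limn (fun n => \int[mu]_x ((f_ n x)%:E * (g x)%:E))); last first.
  rewrite -monotone_convergence//.
  - apply: eq_integral => x _; apply/cvg_lim => //.
    by apply: cvgeZr => //; exact: cf.
  - move=> n; apply: emeasurable_funM => //.
    exact/measurable_EFinP/measurable_funP.
  - by move=> n x _; rewrite mule_ge0 // lee_fin.
  - by move=> x _ m n mn; rewrite lee_wpmul2r ?lee_fin ?ndf.
congr (limn _); apply/funext => n.
under eq_integral do rewrite fimfunE -fsumEFin//.
rewrite ge0_integral_fsum//; last 2 first.
  - by move=> r; exact/measurable_EFinP/measurableT_comp.
  - by move=> r x _; rewrite EFinM nnfun_muleindic_ge0.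
under [RHS]eq_integral.
  move=> x _; rewrite fimfunE -fsumEFin// ge0_mule_fsuml; last first.
    by move=> r; rewrite EFinM nnfun_muleindic_ge0.
  over.
rewrite [RHS]ge0_integral_fsum//; last 2 first.
  - move=> r; apply: emeasurable_funM => //.
    exact/measurable_EFinP/measurableT_comp.
  - by move=> r x _; apply: mule_ge0; [rewrite EFinM nnfun_muleindic_ge0|rewrite lee_fin].
apply: eq_fsbigr => r _; rewrite integralZl_indic_nnsfun//.
under [RHS]eq_integral do rewrite EFinM -muleA.
(* A negative value has an empty level set, so both terms are 0. *)
have [r0|r0] := ltP r 0%R.
  rewrite preimage_nnfun0// integral_indic// set0I measure0 mule0.
  by rewrite integral0_eq// => x _; rewrite indic0 mul0e mule0.
rewrite ge0_integralZl//; last 2 first.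
- apply: emeasurable_funM => //.
  exact/measurable_EFinP/measurable_indic.
- by move=> x _; rewrite mule_ge0 ?lee_fin.
congr (_ * _).
rewrite integral_indic// setIT nuE//.
rewrite integral_mkcond.
by apply: eq_integral => x _; rewrite epatch_indic/= muleC.
Qed.

End Density.

(** The tilted law has to be a genuine measure before uniqueness on rectangles can identify it with
    the shifted law. *)
Lemma density_measure_exists {d} {T : measurableType d} {R : realType}
    (mu : {measure set T -> \bar R}) (g : T -> R) :
  measurable_fun setT g -> (forall x, 0 <= g x) ->
  exists nu : {measure set T -> \bar R},
    forall A, nu A = (\int[mu]_(x in A) (g x)%:E)%E.
Proof.
move=> mg g0.
pose D (A : set T) := (\int[mu]_(x in A) (g x)%:E)%E.
have D0 : D set0 = 0%E by rewrite /D integral_set0.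
have Dge0 A : (0 <= D A)%E by apply: integral_ge0 => x _; rewrite lee_fin.
have Dsa : semi_sigma_additive D.
  move=> F mF tF mUF; rewrite /D ge0_integral_bigcup//.
  - by apply: is_cvg_ereal_nneg_natsum_cond => n _ _; exact: Dge0.
  - exact/measurable_funTS/measurable_EFinP.
  - by move=> x _; rewrite lee_fin.
by exists (HB.pack_for {measure set T -> \bar R} D
  (isMeasure.Build _ _ _ D D0 Dge0 Dsa)).
Qed.

Section NormalShift.
Context {R : realType}.
Local Notation mu := (@lebesgue_measure R).
Local Notation N01 := (@normal_prob R 0 1).

Lemma measurable_shift (t : R) : measurable_fun setT (+%R^~ t : R -> R).
Proof. by apply: measurable_funD. Qed.

Lemma lebesgue_measure_shift (t : R) (A : set R) : measurable A ->
  mu [set x | A (x + t)] = mu A.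
Proof.
move=> mA; rewrite -[LHS]/(pushforward mu (+%R^~ t : _ -> measurableTypeR R) A).
apply/esym/lebesgue_measure_unique => //=; first exact: measurable_shift.
move=> _ _ [[a b] _ <-].
rewrite /pushforward (_ : _ @^-1` _ = `]a - t, b - t]%classic); last first.
  by apply/seteqP; split => x /=; rewrite !in_itv/= ltrBlDr lerBrDr.
by rewrite !lebesgue_measure_itv/= !lte_fin ltrD2r -EFinD -EFinD opprB addrA subrK.
Qed.

Lemma integral_lebesgue_shift (t : R) (f : R -> \bar R) :
  measurable_fun setT f -> (forall x, (0 <= f x)%E) ->
  (\int[mu]_x f (x + t)%R = \int[mu]_x f x)%E.
Proof.
move=> mf f0.
transitivity
  (\int[pushforward mu (+%R^~ t : _ -> measurableTypeR R)]_(x in setT) f x)%E.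
  by rewrite ge0_integral_pushforward//; exact: measurable_shift.
apply: eq_measure_integral => /=; first exact: measurable_shift.
by move=> _ A mA _; exact: lebesgue_measure_shift.
Qed.

(** One-dimensional Cameron-Martin formula: the density centred at [t] is the standard one times
    [expR (t * x - t ^+ 2 / 2)]. *)
Lemma normal_prob_shift (t : R) (B : set R) : measurable B ->
  N01 [set x | B (x + t)] =
  (\int[N01]_(x in B) (expR (t * x - t ^+ 2 / 2))%:E)%E.
Proof.
move=> mB.
pose h x := normal_pdf 0 1 (x - t) : R.
have mh : measurable_fun setT h.
  exact: (measurableT_comp (measurable_normal_pdf 0 1) (measurable_shift (- t))).
have me : measurable_fun setT (fun x : R => expR (t * x - t ^+ 2 / 2)).
  by apply: measurableT_comp => //; apply: measurable_funB.
transitivity (\int[mu]_x (((EFin \o h) \_ B) x))%E.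
  rewrite /normal_prob integral_mkcond.
  rewrite -[RHS](@integral_lebesgue_shift t); last first.
  - by apply: erestrict_ge0 => x _; rewrite lee_fin normal_pdf_ge0.
  - apply/(measurable_restrictT _ mB)/measurable_funTS.
    exact/measurable_EFinP.
  apply: eq_integral => x _; rewrite !patchE /h/= addrK.
  by rewrite (_ : (x \in _) = (x + t \in B))// !(in_setE, inE).
rewrite [RHS]integral_mkcond (@ge0_integral_density _ _ _ mu _ (normal_pdf 0 1)).
- apply: eq_integral => x _; rewrite !patchE; case: ifPn => // _; last first.
    by rewrite mul0e.
  rewrite /h/= -EFinM !normal_pdfE ?oner_eq0//; congr EFin.
  rewrite /normal_fun mulrCA -expRD; congr (_ * expR _).
  by rewrite expr1n mulr2n; field.
- exact: measurable_normal_pdf.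
- by move=> x; exact: normal_pdf_ge0.
- by move=> A mA.
- apply/(measurable_restrictT _ mB)/measurable_funTS.
  exact/measurable_EFinP.
- by apply: erestrict_ge0 => x _; rewrite lee_fin expR_ge0.
Qed.

End NormalShift.

(** * The observation space and the Gaussian change of measure *)

Section SequenceSpace.
Context {R : realType}.
Local Notation seqT := (g_sigma_algebraType (@coordinate_events R)).

Lemma measurable_coordinate (k : nat) : (1 <= k)%N ->
  measurable_fun setT (fun y : seqT => y k).
Proof.
move=> k1 _ B mB; rewrite setTI; apply: sub_sigma_algebra.
by exists k, B.
Qed.

Lemma measurable_fun_sequence d (T : measurableType d) (f : T -> nat -> R) :
  (forall k, (1 <= k)%N -> measurable_fun setT (fun w => f w k)) ->
  measurable_fun setT (f : T -> seqT).
Proof.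
move=> mf; apply: (@measurability _ _ _ seqT setT f (@coordinate_events R)) => //.
move=> _ [_ [k [B [k1 mB ->]]] <-].
exact: (mf k k1 measurableT B mB).
Qed.

Lemma measurable_detection (t : nat -> R) :
  (<<s coordinate_events >>)
    [set y : nat -> R | exists k, (1 <= k)%N /\ t k < `|y k|].
Proof.
(* Coordinate 0 is not measurable for this sigma-algebra, so the union gives index 0 the empty
   set. *)
rewrite (_ : [set y | _] = \bigcup_k (if k is 0 then set0 else
    [set y : g_sigma_algebraType (@coordinate_events R) | t k < `|y k|]));
    last first.
  apply/seteqP; split => w.
    by move=> [[|k] [k1 tk]] //; exists k.+1.
  by move=> [[|k] k1 tk] //; exists k.+1.
apply: (@bigcupT_measurable _ (g_sigma_algebraType (@coordinate_events R))).
move=> [|k]; first exact: measurable0.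
have mk : measurable_fun setT
    (fun y : g_sigma_algebraType (@coordinate_events R) => `|y k.+1|).
  by apply: measurableT_comp => //; exact: measurable_coordinate.
rewrite (_ : [set y | _] =
  ([set: g_sigma_algebraType (@coordinate_events R)] `&`
   (fun y => `|y k.+1|) @^-1` `]t k.+1, +oo[%classic)); first exact: mk.
by apply/seteqP; split => x /=; rewrite in_itv/= andbT// => -[].
Qed.

(** The pi-system on which laws are compared; its shape is that of the events in the independence
    hypothesis. *)
Definition rectangles : set (set (nat -> R)) :=
  [set A | exists (J : {fset nat}) (B : nat -> set R),
    [/\ (forall k, k \in J -> (1 <= k)%N), (forall k, measurable (B k)) &
        A = [set y | forall k, k \in J -> B k (y k)]]].

Lemma rectangles_setI : setI_closed rectangles.
Proof.
move=> _ _ [J1 [B1 [J11 mB1 ->]]] [J2 [B2 [J21 mB2 ->]]].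
exists (J1 `|` J2)%fset, (fun k => (if k \in J1 then B1 k else setT) `&`
  (if k \in J2 then B2 k else setT)); split.
- by move=> k; rewrite in_fsetU => /orP[/J11|/J21].
- by move=> k; apply: measurableI; case: ifP.
- apply/seteqP; split => y /=.
    by move=> [h1 h2] k _; split; case: ifPn => // /[dup] ?; [move/h1|move/h2].
  by move=> h; split => k kJ; have := h k; rewrite in_fsetU kJ ?orbT => /(_ isT)[].
Qed.

Lemma measurable_rectangles : @measurable _ seqT = <<s rectangles >>.
Proof.
apply/seteqP; split => A.
  apply: smallest_sub; first exact: smallest_sigma_algebra.
  move=> _ [k [B [k1 mB ->]]]; apply: sub_sigma_algebra.
  exists [fset k]%fset, (fun=> B); split => //.
    by move=> j; rewrite in_fset1 => /eqP ->.
  by apply/seteqP; split => y /= h; [move=> j; rewrite in_fset1 => /eqP ->|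
     apply: h; rewrite in_fset1].
apply: smallest_sub; first exact: smallest_sigma_algebra.
move=> _ [J [B [J1 mB ->]]].
rewrite (_ : [set y | _] =
  \bigcap_(k in [set` J]) [set y : seqT | B k (y k)]); last first.
  by apply/seteqP; split => y h k /= /h.
apply: (@fin_bigcap_measurable _ seqT) => // k /= kJ.
rewrite -[X in measurable X]setTI.
exact: (measurable_coordinate (J1 k kJ) measurableT (mB k)).
Qed.

End SequenceSpace.

Section Girsanov.
Context {R : realType} {d : measure_display} {T : measurableType d}.
Variables (P : probability T R) (xi : nat -> {RV P >-> R}).
Hypothesis Hxi : iid_std_normal xi.
Local Notation seqT := (g_sigma_algebraType (@coordinate_events R)).
Local Notation N01 := (@normal_prob R 0 1).

Definition noise (w : T) : seqT := fun k => xi k w.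

Lemma measurable_noise : measurable_fun setT noise.
Proof. by apply: measurable_fun_sequence => k _; exact: measurable_funP. Qed.

Lemma noise_normal (k : nat) (B : set R) : (1 <= k)%N -> measurable B ->
  P (xi k @^-1` B) = N01 B.
Proof. by move=> k1 mB; rewrite -(proj1 Hxi k B k1 mB). Qed.

Lemma noise_indep (J : {fset nat}) (B : nat -> set R) (j : nat) (D : set R) :
  (forall k, k \in J -> (1 <= k)%N) -> (forall k, measurable (B k)) ->
  (1 <= j)%N -> j \notin J -> measurable D ->
  P ([set w | forall k, k \in J -> B k (xi k w)] `&` xi j @^-1` D) =
  (P [set w | forall k, k \in J -> B k (xi k w)] * N01 D)%E.
Proof.
move=> J1 mB j1 jJ mD.
pose B' k := if k == j then D else B k.
have mB' k : measurable (B' k) by rewrite /B'; case: ifP.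
have := proj2 Hxi (j |` J)%fset B' _ mB'.
rewrite (proj2 Hxi J B J1 mB) big_fsetU1//= {2}/B' eqxx (noise_normal j1 mD).
rewrite muleC => E.
rewrite [X in (X * _)%E](_ : _ = (\prod_(k <- J) P (xi k @^-1` B' k))%E); last first.
  rewrite big_seq [in RHS]big_seq; apply: eq_bigr => k kJ; rewrite /B'.
  by case: eqP => // kj; rewrite -kj kJ in jJ.
rewrite -E; last by move=> k; rewrite in_fset1U => /orP[/eqP ->|/J1].
congr (P _); apply/seteqP; split => w /=.
  move=> [h1 h2] k; rewrite in_fset1U /B'; case: eqP => [->//|_ /= /h1//].
move=> h; split; last first.
  by have := h j; rewrite in_fset1U eqxx /B' eqxx => /(_ isT).
move=> k kJ; have := h k; rewrite in_fset1U kJ orbT /B' => /(_ isT).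
by case: eqP => // kj; rewrite -kj kJ in jJ.
Qed.

(** Restricting [P] to [E] and pushing forward by [xi j] gives the normal law scaled by [P E]; the
    factorisation is then a change of variables. *)
Lemma integral_indep (j : nat) (E : set T) (g : R -> \bar R) :
  (1 <= j)%N -> measurable E ->
  (forall D, measurable D -> P (E `&` xi j @^-1` D) = (P E * N01 D)%E) ->
  measurable_fun setT g -> (forall x, 0 <= g x)%E ->
  (\int[P]_(w in E) g (xi j w) = P E * \int[N01]_x g x)%E.
Proof.
move=> j1 mE indep mg g0.
have fE : P E \is a fin_num by exact: fin_num_measure.
pose p : {nonneg R} := NngNum (fine_ge0 (measure_ge0 P E)).
have pE : p%:num%:E = P E by rewrite fineK.
have mxi : measurable_fun setT (xi j) by exact: measurable_funP.
have mgxi : measurable_fun setT (g \o xi j) by exact: measurableT_comp.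
transitivity (\int[mrestr P mE]_w g (xi j w))%E.
  rewrite (@ge0_integral_density _ _ _ P (mrestr P mE) (\1_E))//.
  - rewrite [LHS]integral_mkcond; apply: eq_integral => w _.
    by rewrite epatch_indic.
  - by move=> A mA; rewrite /mrestr integral_indic// setIC.
transitivity (\int[pushforward (mrestr P mE) (xi j : T -> measurableTypeR R)]_x g x)%E.
  by rewrite ge0_integral_pushforward.
transitivity (\int[mscale p N01]_x g x)%E; last first.
  by rewrite ge0_integral_mscale// pE.
apply: eq_measure_integral => /=. move=> D mD _.
by rewrite /pushforward /mrestr /mscale setIC indep// -pE.
Qed.

Definition add_at (j : nat) (t : R) (y : nat -> R) : seqT :=
  fun k => if k == j then y k + t else y k.

Lemma measurable_add_at j t : measurable_fun setT (add_at j t : seqT -> seqT).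
Proof.
apply: measurable_fun_sequence => k k1; rewrite /add_at.
case: eqP => _; last exact: measurable_coordinate.
exact: (measurable_funD (measurable_coordinate k1) (measurable_cst _)).
Qed.

(** On a rectangle the shift affects only the factor at coordinate [j]; independence isolates it and
    the one-dimensional formula applies. Agreement on rectangles identifies the shifted law with the
    tilted one. *)
Lemma noise_shift1 (j : nat) (t : R) (F : seqT -> \bar R) : (1 <= j)%N ->
  measurable_fun setT F -> (forall y, 0 <= F y)%E ->
  (\int[P]_w F (add_at j t (noise w)) =
   \int[P]_w (F (noise w) * (expR (t * xi j w - t ^+ 2 / 2))%:E))%E.
Proof.
move=> j1 mF F0.
have mn := measurable_noise.
have ma := measurable_add_at j t.
have mat : measurable_fun setT (add_at j t \o noise).
  exact: measurableT_comp.
pose X : {RV P >-> seqT} := HB.pack noise (isMeasurableFun.Build _ _ _ _ _ mn).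
pose Xt : {RV P >-> seqT} :=
  HB.pack (add_at j t \o noise) (isMeasurableFun.Build _ _ _ _ _ mat).
pose Q := distribution P X.
pose Qt := distribution P Xt.
pose g (x : R) := expR (t * x - t ^+ 2 / 2).
have mg : measurable_fun setT g.
  by apply: measurableT_comp => //; apply: measurable_funB.
have mgj : measurable_fun setT (fun y : seqT => g (y j)).
  exact: (measurableT_comp mg (measurable_coordinate j1)).
have QtE (A : set seqT) : measurable A ->
    Qt A = (\int[Q]_(y in A) (g (y j))%:E)%E.
  have [nu nuE] := density_measure_exists Q mgj (fun y => expR_ge0 _).
  move=> mA; rewrite -nuE.
  apply: (@measure_unique _ R seqT rectangles (fun=> setT)) => //.
  - exact: measurable_rectangles.
  - exact: rectangles_setI.
  - move=> _; exists fset0, (fun=> setT); split => //.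
    by apply/seteqP; split => y //= _ k; rewrite inE.
  - by rewrite bigcup_const.
  - move=> _ [J [B [J1 mB ->]]]; rewrite nuE.
    have mAJ : @measurable _ seqT [set y | forall k, k \in J -> B k (y k)].
      by rewrite measurable_rectangles; apply: sub_sigma_algebra; exists J, B.
    pose J0 := (J `\ j)%fset.
    (* A rectangle that ignores [j] carries the full line there, so both cases are treated at
       once. *)
    pose Bj := if j \in J then B j else setT.
    have mBj : measurable Bj by rewrite /Bj; case: ifP.
    have J01 k : k \in J0 -> (1 <= k)%N by rewrite in_fsetD1 => /andP[_ /J1].
    have jJ0 : j \notin J0 by rewrite in_fsetD1 eqxx.
    pose E := [set w | forall k, k \in J0 -> B k (xi k w)].
    have mE : measurable E.
      rewrite (_ : E = \bigcap_(k in [set` J0]) (xi k @^-1` B k)); last first.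
        by apply/seteqP; split => w h k /= /h.
      apply: fin_bigcap_measurable => // k _.
      by rewrite -[X in measurable X]setTI; exact: measurable_funP.
    have indep D : measurable D -> P (E `&` xi j @^-1` D) = (P E * N01 D)%E.
      exact: noise_indep.
    have AE y : (forall k, k \in J -> B k (y k)) <->
        (forall k, k \in J0 -> B k (y k)) /\ Bj (y j).
      split=> [h|[h1 h2] k kJ].
        split=> [k|]; first by rewrite in_fsetD1 => /andP[_ /h].
        by rewrite /Bj; case: ifP => // /h.
      have [kj|kj] := eqVneq k j; first by move: h2; rewrite /Bj -kj kJ.
      by apply: h1; rewrite in_fsetD1 kj.
    transitivity (P E * N01 [set x | Bj (x + t)%R])%E.
      rewrite -indep; last first.
        rewrite -[X in measurable X]setTI.
        exact: (measurable_shift t measurableT mBj).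
      rewrite /Qt /distribution /pushforward; congr (P _).
      apply/seteqP; split => w /=; rewrite AE /add_at eqxx => -[h1 h2]; split => // k kJ.
        by have := h1 k kJ; case: eqP => // kj; rewrite -kj kJ in jJ0.
      by case: eqP => [kj|_]; [rewrite -kj kJ in jJ0|exact: h1].
    rewrite normal_prob_shift// -/g.
    rewrite [in LHS]integral_mkcond [in RHS]integral_mkcond.
    rewrite -(integral_indep j1 mE indep); last 2 first.
    - apply/(measurable_restrictT _ mBj)/measurable_funTS.
      exact/measurable_EFinP.
    - by apply: erestrict_ge0 => x _; rewrite lee_fin expR_ge0.
    rewrite ge0_integral_distribution; last 2 first.
    - apply/(measurable_restrictT _ mAJ)/measurable_funTS.
      exact/measurable_EFinP.
    - by apply: erestrict_ge0 => x _; rewrite lee_fin expR_ge0.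
    rewrite integral_mkcond; apply: eq_integral => w _.
    rewrite !patchE /= !patchE.
    have -> : (noise w \in [set y | forall k : nat, k \in J -> B k (y k)]) =
        (w \in E) && (xi j w \in Bj).
      by apply/idP/andP; rewrite !inE/= AE.
    by case: (w \in E).
  - move=> _; rewrite /= /distribution /pushforward preimage_setT.
    by rewrite probability_setT ltry.
transitivity (\int[Qt]_y F y)%E; first by rewrite ge0_integral_distribution.
rewrite (@ge0_integral_density _ _ _ Q Qt (fun y => g (y j)))//.
- rewrite ge0_integral_distribution//.
    apply: emeasurable_funM => //.
    exact/measurable_EFinP.
  by move=> y; rewrite mule_ge0// lee_fin expR_ge0.
- by move=> y; exact: expR_ge0.
Qed.

End Girsanov.

(** * Likelihood ratios of finitely supported shifts *)

Section LikelihoodRatio.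
Context {R : realType} {d : measure_display} {T : measurableType d}.
Variables (P : probability T R) (xi : nat -> {RV P >-> R}).
Hypothesis Hxi : iid_std_normal xi.
Local Notation seqT := (g_sigma_algebraType (@coordinate_events R)).
Local Notation noise := (noise xi).

Definition shift_upto (N : nat) (t : nat -> R) (y : nat -> R) : seqT :=
  fun k => if (1 <= k < N)%N then y k + t k else y k.

(** Density of the law of the noise shifted by [t] below [N], relative to the unshifted noise; [t]
    is the signal in units of the noise level. *)
Definition likelihood (N : nat) (t : nat -> R) (y : nat -> R) : R :=
  expR (\sum_(1 <= k < N) (t k * y k - t k ^+ 2 / 2)).

Lemma measurable_likelihood N t : measurable_fun setT (likelihood N t : seqT -> R).
Proof.
apply: measurableT_comp => //; rewrite /=.
(* Measurability is asked of the summand at every index, including the unmeasurable coordinate 0,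
   which is therefore replaced by 0. *)
rewrite (_ : (fun _ => _) = (fun y => \sum_(1 <= k < N)
    if (1 <= k < N)%N then t k * y k - t k ^+ 2 / 2 else 0)); last first.
  by apply/funext => y; rewrite big_nat big_mkcond.
apply: measurable_sum => k.
case: (boolP (1 <= k < N)%N) => [/andP[k1 _]|_]; last exact: measurable_cst.
apply: measurable_funB => //; apply: measurable_funM => //.
exact: measurable_coordinate.
Qed.

Lemma likelihood_gt0 N t y : 0 < likelihood N t y.
Proof. exact: expR_gt0. Qed.

(** Induction on [N], peeling off coordinate [N]: [likelihood N t] does not see that coordinate, so
    it is unchanged by the last shift, which contributes the new factor. *)
Lemma girsanov N t (F : seqT -> \bar R) :
  measurable_fun setT F -> (forall y, 0 <= F y)%E ->
  (\int[P]_w F (shift_upto N t (noise w)) =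
   \int[P]_w (F (noise w) * (likelihood N t (noise w))%:E))%E.
Proof.
elim: N F => [|N IH] F mF F0.
  apply: eq_integral => w _; rewrite /likelihood big_geq// expR0 mule1.
  by congr F; apply/funext => k; rewrite /shift_upto andbF.
have [->|N0] := posnP N.
  apply: eq_integral => w _; rewrite /likelihood big_geq// expR0 mule1.
  by congr F; apply/funext => k; rewrite /shift_upto; case: k => [|[|]].
pose G (y : seqT) := F (add_at N (t N) y).
have mG : measurable_fun setT G.
  exact: (measurableT_comp mF (measurable_add_at _ _)).
transitivity (\int[P]_w G (shift_upto N t (noise w)))%E.
  apply: eq_integral => w _; congr F; apply/funext => k.
  rewrite /shift_upto /add_at; have [->|kN] := eqVneq k N.
    by rewrite N0 ltnn leqnn.
  by rewrite ltnS (leq_eqVlt k N) (negbTE kN).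
rewrite (IH G mG (fun y => F0 _)).
pose H (y : seqT) := (F y * (likelihood N t y)%:E)%E.
have mH : measurable_fun setT H.
  apply: emeasurable_funM => //; apply/measurable_EFinP.
  exact: measurable_likelihood.
transitivity (\int[P]_w H (add_at N (t N) (noise w)))%E.
  apply: eq_integral => w _; congr (_ * (expR _)%:E)%E.
  apply: eq_big_nat => k /andP[_ kN].
  by rewrite /add_at ltn_eqF.
have H0 y : (0 <= H y)%E.
  by apply: mule_ge0; [exact: F0|rewrite lee_fin; exact/ltW/likelihood_gt0].
rewrite (noise_shift1 Hxi (t N) N0 mH H0).
apply: eq_integral => w _; rewrite /H -muleA -EFinM; congr (_ * _%:E)%E.
by rewrite -expRD /likelihood big_nat_recr.
Qed.

Lemma integral_likelihood N t :
  (\int[P]_w (likelihood N t (noise w))%:E = 1)%E.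
Proof.
rewrite (eq_integral (fun w => 1 * (likelihood N t (noise w))%:E)%E); last first.
  by move=> w _; rewrite mul1e.
rewrite -(@girsanov N t (cst 1%E))//= integral_cst// mul1e.
exact: probability_setT.
Qed.

(** Reading [likelihood N t] as the density of a shift leaves the expectation of the shifted
    [likelihood N s], which is a constant times [likelihood N s], of integral 1. *)
Lemma integral_likelihoodM N s t :
  (\int[P]_w (likelihood N s (noise w) * likelihood N t (noise w))%:E =
   (expR (\sum_(1 <= k < N) s k * t k))%:E)%E.
Proof.
under eq_integral do rewrite EFinM.
rewrite -(@girsanov N t (fun y => (likelihood N s y)%:E)); last 2 first.
- by apply/measurable_EFinP; exact: measurable_likelihood.
- by move=> y; rewrite lee_fin ltW// likelihood_gt0.
under eq_integral.
  move=> w _.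
  rewrite (_ : likelihood N s _ = expR (\sum_(1 <= k < N) s k * t k) *
    likelihood N s (noise w)); last first.
    rewrite /likelihood -expRD -big_split/=; congr expR.
    apply: eq_big_nat => k kN; rewrite /shift_upto kN; ring.
  rewrite EFinM; over.
rewrite ge0_integralZl//; last 2 first.
- apply/measurable_EFinP/(measurableT_comp (measurable_likelihood N s)).
  exact: measurable_noise.
- by move=> w _; rewrite lee_fin ltW// likelihood_gt0.
by rewrite integral_likelihood mule1.
Qed.

(** * Total error against an average of alternatives *)

Section SecondMoment.
Variables (eps : R) (psi : (nat -> R) -> R) (N : nat) (I : eqType) (S : seq I).
Variables (eta : I -> nat -> R) (Theta : set (nat -> R)) (K delta : R).
Hypothesis eps0 : 0 < eps.
Hypothesis tpsi : is_test psi.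
Hypothesis etaN : forall i k, i \in S -> ~~ (1 <= k < N)%N -> eta i k = 0.
Hypothesis eta_sup :
  forall i, i \in S -> (expect xi eps (eta i) (fun y => 1 - psi y)%R <=
    ereal_sup [set expect xi eps eta (fun y => 1 - psi y)%R | eta in Theta])%E.

(** The test read on rescaled data: under the signal [eta] its argument is the noise shifted by
    [eta / eps]. *)
Let psi' (y : seqT) : R := psi (fun k => eps * y k).

Let mpsi : measurable_fun setT psi'.
Proof.
apply: (@measurableT_comp _ _ _ seqT seqT R psi).
  by move=> _ B mB; rewrite setTI; exact: (proj2 tpsi).
apply: measurable_fun_sequence => k k1.
by apply: measurable_funM => //; exact: measurable_coordinate.
Qed.

Let psi01 y : 0 <= psi' y <= 1. Proof. exact: (proj1 tpsi). Qed.

Let lik i := likelihood N (fun k => eta i k / eps).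

Let expect_shift i : i \in S -> expect xi eps (eta i) (fun y => 1 - psi y) =
  (\int[P]_w ((1 - psi' (noise w)) * lik i (noise w))%:E)%E.
Proof.
move=> iS; rewrite /expect unlock; under [RHS]eq_integral do rewrite EFinM.
rewrite -(@girsanov N _ (fun y => (1 - psi' y)%:E)); last 2 first.
- exact/measurable_EFinP/measurable_funB.
- by move=> y; rewrite lee_fin subr_ge0; case/andP: (psi01 y).
apply: eq_integral => w _; congr (_ - psi _)%:E; apply/funext => k.
rewrite /observation /shift_upto; case: ifPn => kN; last by rewrite etaN// add0r.
by rewrite mulrDr mulrCA divff ?gt_eqF// mulr1 addrC.
Qed.

Let mn : measurable_fun setT noise := measurable_noise xi.

Let mlik i : measurable_fun setT (fun w => lik i (noise w)).
Proof. exact: (measurableT_comp (measurable_likelihood _ _) mn). Qed.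

Let mpsin : measurable_fun setT (fun w => psi' (noise w)).
Proof. exact: (measurableT_comp mpsi mn). Qed.

(* Instead of Cauchy-Schwarz, [|L - 1| <= delta + (L - 1)^2 / (4 delta)] is used
   under the integral for the averaged likelihood ratio [L]. *)
Lemma second_moment_bound : (0 < size S)%N -> 0 < delta ->
  \sum_(i <- S) \sum_(j <- S)
     expR (\sum_(1 <= k < N) (eta i k / eps) * (eta j k / eps)) <=
     (size S)%:R ^+ 2 + K ->
  ((1 - delta - K / (4 * delta * (size S)%:R ^+ 2))%:E <=
   gamma_test xi eps Theta psi)%E.
Proof.
move=> S0 delta0 HK.
pose M : R := (size S)%:R.
have M0 : 0 < M by rewrite ltr0n.
pose Lbar y := M^-1 * \sum_(i <- S) lik i y.
have lik0 i y : 0 <= lik i y by rewrite ltW// likelihood_gt0.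
have Lbar0 y : 0 <= Lbar y by apply: mulr_ge0; [rewrite invr_ge0 ltW|rewrite sumr_ge0].
have mLbar : measurable_fun setT (fun w => Lbar (noise w)).
  by apply: measurable_funM => //; exact: measurable_sum.
have psi0 y : 0 <= psi' y by case/andP: (psi01 y).
have psi1 y : 0 <= 1 - psi' y by rewrite subr_ge0; case/andP: (psi01 y).
have E1 : (\int[P]_w (Lbar (noise w))%:E = 1)%E.
  under eq_integral do rewrite EFinM -sumEFin.
  rewrite ge0_integralZl//; last 3 first.
  - by apply: emeasurable_sum => i; exact/measurable_EFinP.
  - by move=> w _; rewrite sume_ge0// => i _; rewrite lee_fin.
  - by rewrite lee_fin invr_ge0 ltW.
  rewrite ge0_integral_sum//; last 2 first.
  - by move=> i; exact/measurable_EFinP.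
  - by move=> i w _; rewrite lee_fin.
  under eq_bigr do rewrite integral_likelihood.
  rewrite sumEFin -EFinM big_const_seq count_predT iter_addr_0.
  by rewrite -/M mulVf// gt_eqF.
have E2 : (\int[P]_w ((1 - psi' (noise w)) * Lbar (noise w))%:E =
    M^-1%:E * \sum_(i <- S) expect xi eps (eta i) (fun y => 1 - psi y)%R)%E.
  under eq_integral do rewrite mulrCA mulr_sumr EFinM -sumEFin.
  rewrite ge0_integralZl//; last 3 first.
  - apply: emeasurable_sum => i; apply/measurable_EFinP/measurable_funM => //.
    exact: measurable_funB.
  - by move=> w _; rewrite sume_ge0// => i _; rewrite lee_fin mulr_ge0.
  - by rewrite lee_fin invr_ge0 ltW.
  rewrite ge0_integral_sum//; last 2 first.
  - move=> i; apply/measurable_EFinP/measurable_funM => //.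
    exact: measurable_funB.
  - by move=> i w _; rewrite lee_fin mulr_ge0.
  by congr (_ * _)%E; apply: eq_big_seq => i iS; rewrite expect_shift.
have E3 : (\int[P]_w (Lbar (noise w) ^+ 2)%:E <= (1 + K / M ^+ 2)%:E)%E.
  have -> : (fun w => (Lbar (noise w) ^+ 2)%:E) = (fun w => (M ^- 2)%:E *
      \sum_(i <- S) \sum_(j <- S) (lik i (noise w) * lik j (noise w))%:E)%E.
    apply/funext => w; rewrite exprMn exprVn EFinM.
    congr (_ * _)%E; rewrite expr2 mulr_suml -sumEFin; apply: eq_bigr => i _; rewrite mulr_sumr -sumEFin.
    by [].
  have mll i j : measurable_fun setT
      (fun w => (lik i (noise w) * lik j (noise w))%:E).
    by apply/measurable_EFinP; exact: measurable_funM.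
  have ll0 i j w : (0 <= (lik i (noise w) * lik j (noise w))%:E)%E.
    by rewrite lee_fin mulr_ge0.
  rewrite ge0_integralZl//; last 3 first.
  - by apply: emeasurable_sum => i; apply: emeasurable_sum => j.
  - by move=> w _; rewrite sume_ge0// => i _; rewrite sume_ge0.
  - by rewrite lee_fin invr_ge0 exprn_ge0// ltW.
  rewrite ge0_integral_sum//; last 2 first.
  - by move=> i; apply: emeasurable_sum => j.
  - by move=> i w _; rewrite sume_ge0.
  under eq_bigr.
    move=> i _; rewrite ge0_integral_sum//.
    under eq_bigr do rewrite integral_likelihoodM.
    rewrite sumEFin; over.
  rewrite sumEFin -EFinM lee_fin mulrC ler_pdivrMr ?exprn_gt0//.
  by rewrite mulrDl mul1r divfK ?expf_neq0 ?gt_eqF.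
have E0 : expect xi eps (fun=> 0) psi = (\int[P]_w (psi' (noise w))%:E)%E.
  rewrite /expect unlock; apply: eq_integral => w _; congr (psi _)%:E.
  by apply/funext => k; rewrite /observation add0r.
pose s := ereal_sup [set expect xi eps eta (fun y => 1 - psi y)%R | eta in Theta].
have eta_s : forall i, i \in S ->
  (expect xi eps (eta i) (fun y => 1 - psi y)%R <= s)%E := eta_sup.
have [soo|soo] := eqVneq s +oo%E.
  rewrite /gamma_test -/s soo addey ?leey// E0 gt_eqF// (@lt_le_trans _ _ 0%E)//.
  by apply: integral_ge0 => w _; rewrite lee_fin.
have avg : (M^-1%:E * \sum_(i <- S) expect xi eps (eta i) (fun y => 1 - psi y)%R
    <= s)%E.
  have e0 i : i \in S -> (0 <= expect xi eps (eta i) (fun y => 1 - psi y)%R)%E.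
    by move=> iS; rewrite expect_shift//; apply: integral_ge0 => w _; rewrite lee_fin mulr_ge0.
  case: s eta_s soo => [r hs _|//|hs _]; last first.
    case: S S0 hs e0 => [//|i0 S' _ hs e0].
    have i0S : i0 \in i0 :: S' by rewrite mem_head.
    by have := le_trans (e0 i0 i0S) (hs i0 i0S); rewrite leeNy_eq.
  have ef i : i \in S ->
      expect xi eps (eta i) (fun y => 1 - psi y)%R \is a fin_num.
    by move=> iS; rewrite ge0_fin_numE ?e0// (le_lt_trans (hs i iS))// ltry.
  rewrite (eq_big_seq (fun i =>
    (fine (expect xi eps (eta i) (fun y => 1 - psi y)%R))%:E)); last first.
    by move=> i iS; rewrite fineK// ef.
  rewrite sumEFin -EFinM lee_fin mulrC ler_pdivrMr//.
  rewrite (_ : r * M = \sum_(i <- S) r); last first.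
    by rewrite big_const_seq count_predT iter_addr_0 mulr_natr.
  rewrite big_seq [leRHS]big_seq.
  by apply: ler_sum => i iS; rewrite -lee_fin fineK ?ef// hs.
(* The cross term of [(Lbar - 1) ^+ 2 / (4 * delta)] is moved to the left, so that both integrands
   are nonnegative. *)
have main : (\int[P]_w (Lbar (noise w) * (1 + (2 * delta)^-1))%:E <=
  \int[P]_w (psi' (noise w) + (1 - psi' (noise w)) * Lbar (noise w) +
    (Lbar (noise w) ^+ 2 * (4 * delta)^-1) + ((4 * delta)^-1 + delta))%:E)%E.
  apply: ge0_le_integral => //.
  - by move=> w _; rewrite lee_fin mulr_ge0// addr_ge0// invr_ge0 mulr_ge0// ltW.
  - by apply/measurable_EFinP/measurable_funM.
  - apply/measurable_EFinP/measurable_funD => //; apply: measurable_funD.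
      apply: measurable_funD => //; apply: measurable_funM => //.
      exact: measurable_funB.
    by apply: measurable_funM => //; exact: measurable_funX.
  - move=> w _; rewrite lee_fin.
    have := sqr_ge0 (Lbar (noise w) - 1 - 2 * delta * psi' (noise w)).
    have := psi01 (noise w).
    move: (Lbar (noise w)) (psi' (noise w)) (Lbar0 (noise w)) => L p L0 /andP[p0 p1] h.
    (* The difference is [delta - p * (L - 1) + (L - 1) ^+ 2 / (4 * delta)]; completing the square
       leaves a remainder that is nonnegative because [0 <= p <= 1]. *)
    rewrite -subr_ge0 (_ : _ - _ = ((L - 1 - 2 * delta * p) ^+ 2 +
      4 * delta ^+ 2 * (1 - p) * (1 + p)) / (4 * delta)); last first.
      by field; rewrite gt_eqF.
    apply: divr_ge0; last by rewrite mulr_ge0// ltW.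
    by rewrite addr_ge0// !mulr_ge0 ?exprn_ge0 ?subr_ge0 ?addr_ge0// ltW.
have c0 : 0 <= (4 * delta)^-1 by rewrite invr_ge0 mulr_ge0// ltW.
have m1psi : measurable_fun setT (fun w => 1 - psi' (noise w)).
  exact: measurable_funB.
have m2 : measurable_fun setT (fun w => (1 - psi' (noise w)) * Lbar (noise w)).
  exact: measurable_funM.
have m3 : measurable_fun setT (fun w => Lbar (noise w) ^+ 2).
  exact: measurable_funX.
move: main.
under eq_integral do rewrite EFinM.
rewrite ge0_integralZr//; last 3 first.
- exact/measurable_EFinP.
- by move=> w _; rewrite lee_fin.
- by rewrite lee_fin addr_ge0// invr_ge0 mulr_ge0// ltW.
rewrite E1 mul1e.
set k := (4 * delta)^-1 + delta.
have k0 : 0 <= k by rewrite addr_ge0// ltW.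
under [leRHS]eq_integral do rewrite !EFinD.
have p1L0 w : 0 <= (1 - psi' (noise w)) * Lbar (noise w) by rewrite mulr_ge0.
have L20 w : 0 <= Lbar (noise w) ^+ 2 / (4 * delta).
  by rewrite mulr_ge0// exprn_ge0.
rewrite ge0_integralD//=; last 2 first.
- by move=> w _; rewrite -!EFinD lee_fin !addr_ge0.
- apply: emeasurable_funD; last by apply/measurable_EFinP; exact: measurable_funM.
  by apply: emeasurable_funD; exact/measurable_EFinP.
rewrite ge0_integralD//=; last 4 first.
- by move=> w _; rewrite -!EFinD lee_fin !addr_ge0.
- by apply: emeasurable_funD; exact/measurable_EFinP.
- by move=> w _; rewrite lee_fin.
- by apply/measurable_EFinP; exact: measurable_funM.
rewrite ge0_integralD//=; last 4 first.
- by move=> w _; rewrite lee_fin.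
- exact/measurable_EFinP.
- by move=> w _; rewrite lee_fin.
- exact/measurable_EFinP.
under [X in (_ <= _ + X + _)%E]eq_integral do rewrite EFinM.
rewrite ge0_integralZr//; last 2 first.
- exact/measurable_EFinP.
- by move=> w _; rewrite lee_fin exprn_ge0.
rewrite integral_cst// [X in (_ + k%:E * X)%E]probability_setT mule1 E2 -E0 => main.
have {}main : ((1 + (2 * delta)^-1)%:E <= gamma_test xi eps Theta psi +
    ((1 + K / M ^+ 2) * (4 * delta)^-1 + k)%:E)%E.
  apply: (le_trans main); rewrite /gamma_test -/s [in leRHS]EFinD addeA.
  apply: leeD => //; apply: leeD; first by apply: leeD => //; exact: avg.
  by rewrite EFinM; apply: lee_wpmul2r.
rewrite -leeBlDr// -EFinB in main; apply: le_trans main.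
rewrite lee_fin le_eqVlt; apply/orP; left; apply/eqP; rewrite -/M /k.
by field; rewrite !gt_eqF.
Qed.

End SecondMoment.
End LikelihoodRatio.

(** * Gaussian tails and the threshold test *)

Section NormalTail.
Context {R : realType}.
Local Notation mu := (@lebesgue_measure R).
Local Notation N01 := (@normal_prob R 0 1).

Lemma integral_lebesgue_opp (f : R -> \bar R) :
  measurable_fun setT f -> (forall x, (0 <= f x)%E) ->
  (\int[mu]_x f (- x)%R = \int[mu]_x f x)%E.
Proof.
move=> mf f0.
transitivity
  (\int[pushforward mu (-%R : _ -> measurableTypeR R)]_(x in setT) f x)%E.
  by rewrite ge0_integral_pushforward.
by apply: eq_measure_integral => /= A mA _; exact: lebesgue_measureN.
Qed.

Lemma measurable_norm_gt (t : R) : measurable [set x : R | t < `|x|].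
Proof.
rewrite (_ : [set _ | _] = ([set: R] `&` Num.norm @^-1` `]t, +oo[%classic)).
  exact: (@normr_measurable R setT measurableT).
by apply/seteqP; split => x /=; rewrite in_itv/= andbT// => -[].
Qed.

(** The tangent of [x ^+ 2 / 2] at [t] lies below it, so beyond [t] the normal density is dominated
    by a multiple of the exponential density of rate [t] started at [t], whose mass is 1. *)
Lemma normal_tail_le (t : R) : 0 < t ->
  (N01 [set x | (t < `|x|)%R] <= (expR (- (t ^+ 2 / 2)) / t)%:E)%E.
Proof.
move=> t0.
pose h x := exponential_pdf t x.
have h0 x : 0 <= h x by apply: exponential_pdf_ge0; exact: ltW.
have mh : measurable_fun setT h by exact: measurable_exponential_pdf.
have mhE : measurable_fun setT (EFin \o h) by exact/measurable_EFinP.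
have mhs : measurable_fun setT (fun x : R => (h (x - t)%R)%:E).
  exact: (measurableT_comp mhE (measurable_shift (- t))).
have mhn : measurable_fun setT (fun x : R => (h (- x - t)%R)%:E).
  exact: (measurableT_comp mhs (@oppr_measurable R setT)).
have hs : (\int[mu]_x (h (x - t)%R)%:E = 1)%E.
  by rewrite (@integral_lebesgue_shift _ (- t) (EFin \o h))// integral_exponential_pdf.
have hn : (\int[mu]_x (h (- x - t)%R)%:E = 1)%E.
  rewrite (@integral_lebesgue_opp (fun x => (h (x - t))%:E))//.
  by move=> x; rewrite lee_fin.
pose c : R := normal_peak 1 * expR (- (t ^+ 2 / 2)) / t.
(* Since [pi >= 2], the peak is at most 1/2, which cancels the count of two tails. *)
have peak : @normal_peak R 1 <= 2^-1.
  rewrite /normal_peak expr1n mul1r.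
  have pi0 := @pi_gt0 R; have pi2 := @pi_ge2 R.
  rewrite lef_pV2 ?posrE// ?sqrtr_gt0; last by move: pi0; rewrite -mulr_natr; lra.
  rewrite -(ger0_norm (ler0n R 2)) -sqrtr_sqr ler_wsqrtr// -mulr_natr.
  by move: pi2; lra.
have c0 : 0 <= c.
  by rewrite !mulr_ge0 ?normal_peak_ge0 ?expR_ge0 ?invr_ge0 ?ltW.
have key x y : t <= y -> x ^+ 2 = y ^+ 2 -> normal_pdf 0 1 x <= c * h (y - t).
  move=> ty xy; rewrite normal_pdfE ?oner_eq0// /h exponential_pdfE ?subr_ge0//.
  rewrite (_ : c * _ = normal_peak 1 *
      (expR (- (t ^+ 2 / 2)) * expR (- t * (y - t)))); last first.
    by rewrite /c; field; rewrite gt_eqF.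
  rewrite ler_wpM2l ?normal_peak_ge0// -expRD ler_expR subr0 expr1n xy -subr_ge0.
  rewrite (_ : _ - _ = (y - t) ^+ 2 / 2); last by field.
  by rewrite divr_ge0// sqr_ge0.
have mA : measurable [set x : R | t < `|x|] := measurable_norm_gt t.
pose H x := (c%:E * ((h (x - t)%R)%:E + (h (- x - t)%R)%:E))%E.
apply: (@le_trans _ _ (\int[mu]_x H x)%E).
  rewrite /normal_prob integral_mkcond.
  apply: ge0_le_integral => //.
  - by move=> x _; apply: erestrict_ge0 => y _; rewrite lee_fin normal_pdf_ge0.
  - apply/(measurable_restrictT _ mA)/measurable_funTS/measurable_EFinP.
    exact: measurable_normal_pdf.
  - by apply: emeasurable_funM => //; exact: emeasurable_funD.
  move=> x _; rewrite patchE; case: ifPn => [|_]; last first.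
    by rewrite /H mule_ge0// -EFinD lee_fin addr_ge0.
  rewrite inE/= /H -EFinD -EFinM lee_fin mulrDr => tx.
  have [x0|x0] := leP 0 x.
    apply: (@le_trans _ _ (c * h (x - t))); last by rewrite lerDl mulr_ge0.
    by apply: key => //; rewrite ger0_norm// in tx; exact: ltW.
  apply: (@le_trans _ _ (c * h (- x - t))); last by rewrite lerDr mulr_ge0.
  by apply: key; rewrite ?sqrrN//; rewrite ltr0_norm// in tx; exact: ltW.
rewrite /H ge0_integralZl//; last 2 first.
- exact: emeasurable_funD.
- by move=> x _; rewrite -EFinD lee_fin addr_ge0.
rewrite ge0_integralD//; last 2 first.
- by move=> x _; rewrite lee_fin.
- by move=> x _; rewrite lee_fin.
rewrite hs hn -EFinD -EFinM lee_fin /c.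
rewrite [leLHS](_ : _ = (normal_peak 1 * 2) *
  (expR (- (t ^+ 2 / 2)) / t)); last first.
  by field; rewrite gt_eqF.
apply: ler_piMl; first by rewrite divr_ge0 ?expR_ge0 ?ltW.
by move: peak; lra.
Qed.
End NormalTail.

(** * A telescoping majorant of the exceedance probabilities *)

Section Series.
Context {R : realType}.
(** Minus an antiderivative of 1 / (x (ln x)^(3/2)), so that its differences dominate the terms of
    that series. *)
Local Notation g := (fun k : nat => 2 / Num.sqrt (ln (k%:R : R))).

Lemma ln_nat_ge1 (k : nat) : (4 <= k)%N -> 1 <= ln (k%:R : R).
Proof.
move=> k4.
have k0 : 0 < k%:R :> R by rewrite ltr0n (leq_trans _ k4).
rewrite -[leLHS](expRK 1) ler_ln ?posrE ?expR_gt0//.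
apply: (@le_trans _ _ 4); last by rewrite ler_nat.
(* The inequality [1 + x <= expR x] at [x = - 1/2] gives [expR (1/2) <= 2], hence [expR 1 <= 4]. *)
have h : 1 + - 2^-1 <= expR (- 2^-1) :> R by exact: expR_ge1Dx.
rewrite expRN in h; have e0 := @expR_gt0 R 2^-1.
have h2 : expR 2^-1 <= 2 :> R.
  have : 2^-1 <= (expR 2^-1)^-1 :> R by move: h; lra.
  by rewrite lef_pV2 ?posrE.
have -> : expR 1 = expR 2^-1 * expR 2^-1 :> R.
  by rewrite -expRD; congr expR; field.
rewrite (_ : 4 = 2 * 2 :> R); last by ring.
by apply: ler_pM => //; exact: ltW.
Qed.

(* The factor [Num.sqrt (ln k)] comes from the [1 / t] in the normal tail; without
   it the exceedance probabilities of the thresholds would not be summable. *)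
Lemma inv_k_ln_k_le (k : nat) : (4 <= k)%N ->
  (k%:R * ln k%:R * Num.sqrt (ln k%:R) : R)^-1 <= g k.-1 - g k.
Proof.
move=> k4 /=; set L := ln k%:R; set l := ln k.-1%:R.
have k0 : 0 < k%:R :> R by rewrite ltr0n (leq_trans _ k4).
have L1 : 1 <= L by exact: ln_nat_ge1.
have L0 : 0 < L by rewrite (lt_le_trans _ L1).
have l0 : 0 < l.
  by rewrite ln_gt0// ltr1n; case: k k4 {k0 L L1 L0 l} => [|[|[|[|]]]].
have k10 : 0 < k.-1%:R :> R.
  by rewrite ltr0n; case: k k4 {k0 L L1 L0 l l0} => [|[|[|[|]]]].
have kE : k%:R = k.-1%:R + 1 :> R.
  by rewrite natr1 prednK// (leq_trans _ k4).
have lL : k%:R^-1 <= L - l.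
  have : l - L <= - k%:R^-1.
    rewrite -ln_div ?posrE//.
    rewrite (_ : k.-1%:R / k%:R = 1 + - k%:R^-1); last first.
      by rewrite kE; field; rewrite -kE gt_eqF.
    by apply: le_ln1Dx; rewrite ltrN2 invf_lt1// kE; move: k10; lra.
  by lra.
set a := Num.sqrt l; set b := Num.sqrt L.
have a0 : 0 < a by rewrite sqrtr_gt0.
have b0 : 0 < b by rewrite sqrtr_gt0.
have lE : l = a ^+ 2 by rewrite sqr_sqrtr// ltW.
have LE : L = b ^+ 2 by rewrite sqr_sqrtr// ltW.
have kV0 : 0 < k%:R^-1 :> R by rewrite invr_gt0.
have ab : a <= b.
  have : a ^+ 2 <= b ^+ 2 by rewrite -lE -LE; move: kV0 lL; lra.
  by rewrite ler_pXn2r// nnegrE ltW.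
rewrite -/a -/b !invfM LE.
rewrite (_ : 2 / a - 2 / b = (b ^+ 2 - a ^+ 2) * (2 / (a * b * (a + b)))); last first.
  by field; rewrite !gt_eqF// addr_gt0.
rewrite -mulrA; apply: ler_pM => //.
- by rewrite divr_ge0 ?invr_ge0 ?exprn_ge0// ltW.
- by rewrite -lE -LE.
rewrite -invfM -(@ler_pM2r _ (b ^+ 2 * b)) ?mulr_gt0 ?exprn_gt0//.
rewrite mulVf ?gt_eqF ?mulr_gt0 ?exprn_gt0//.
rewrite mulrAC ler_pdivlMr ?mulr_gt0 ?addr_gt0// mul1r.
rewrite (_ : a * b * (a + b) = (a * b) * a + (a * b) * b); last by ring.
rewrite (_ : 2 * _ = b * b * b + b * b * b); last by ring.
by apply: lerD; rewrite !ler_pM ?mulr_ge0// ltW.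
Qed.

Definition log_threshold (k : nat) : R := Num.sqrt (2 * (ln (k%:R : R) + loglog (k%:R : R))).

(** At [log_threshold k] the exponential factor of the tail is 1 over [k * ln k], and its factor
    [1 / t] supplies the missing [1 / Num.sqrt (ln k)]. *)
Lemma normal_tail_series (k : nat) (t : R) : (4 <= k)%N -> log_threshold k <= t ->
  (normal_prob 0 1 [set x : R | (t < `|x|)%R] <= (g k.-1 - g k)%:E)%E.
Proof.
move=> k4 st; have L1 : 1 <= ln k%:R :> R by exact: ln_nat_ge1.
have L0 : 0 < ln k%:R :> R by rewrite (lt_le_trans _ L1).
have k0 : 0 < k%:R :> R by rewrite ltr0n (leq_trans _ k4).
have LL0 : 0 <= loglog (k%:R : R) by rewrite ln_ge0.
have s2 : log_threshold k ^+ 2 = 2 * (ln (k%:R : R) + loglog (k%:R : R)).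
  by rewrite sqr_sqrtr// mulr_ge0// addr_ge0// ltW.
have sL : Num.sqrt (ln k%:R) <= log_threshold k.
  by rewrite ler_wsqrtr//; move: LL0 L0; lra.
have sL0 : 0 < Num.sqrt (ln k%:R : R) by rewrite sqrtr_gt0.
have s0 : 0 < log_threshold k by rewrite (lt_le_trans _ sL).
have t0 : 0 < t by rewrite (lt_le_trans s0).
apply: (le_trans (normal_tail_le t0)); rewrite lee_fin.
apply: le_trans (inv_k_ln_k_le k4).
apply: (@le_trans _ _ (expR (- (log_threshold k ^+ 2 / 2)) / Num.sqrt (ln k%:R))).
  apply: ler_pM; [exact: expR_ge0|by rewrite invr_ge0 ltW| |].
    by rewrite ler_expR lerN2 ler_pM2r// ler_pXn2r// nnegrE ltW.
  by rewrite lef_pV2 ?posrE// (le_trans sL).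
rewrite s2 [2 * _]mulrC mulfK// expRN expRD lnK ?posrE// lnK ?posrE//.
by rewrite !invfM mulrC.
Qed.


End Series.

(** * Error probabilities of the threshold test *)

Section FalseAlarm.
Context {R : realType} {d : measure_display} {T : measurableType d}.
Variables (P : probability T R) (xi : nat -> {RV P >-> R}).
Hypothesis Hxi : iid_std_normal xi.

(** A union bound with two regimes: below [K] only the common level [T0] is used, from [K] on the
    telescoping majorant. Fixing [K] first and then letting [T0] grow makes both terms small. *)
Lemma false_alarm_bound (t : nat -> R) (T0 : R) (K : nat) :
  1 <= T0 -> (4 <= K)%N ->
  (forall k, (1 <= k)%N -> T0 <= t k) -> (forall k, (K <= k)%N -> log_threshold k <= t k) ->
  (P [set w | exists k, (1 <= k)%N /\ (t k < `|xi k w|)%R] <=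
   (K%:R / T0 + 2 / Num.sqrt (ln K.-1%:R))%:E)%E.
Proof.
move=> T1 K4 tT ts.
have T00 : 0 < T0 by rewrite (lt_le_trans _ T1).
pose N (t : R) := normal_prob 0 1 [set x : R | (t < `|x|)%R].
have mA (s : R) : measurable [set x : R | s < `|x|] := measurable_norm_gt s.
have mxi k (s : R) : measurable (xi k @^-1` [set x : R | s < `|x|]).
  by rewrite -[X in measurable X]setTI; exact: measurable_funP.
pose A k : set T := if k is 0 then set0 else xi k @^-1` [set x : R | t k < `|x|].
have mAk k : measurable (A k) by case: k => [|k]; [exact: measurable0|exact: mxi].
pose g k : R := 2 / Num.sqrt (ln k%:R).
pose b k := if (k < K)%N then T0^-1 else g k.-1 - g k.
have Ab k : (P (A k) <= (b k)%:E)%E.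
  case: k => [|k]; rewrite /b /A.
    by rewrite measure0 (leq_trans _ K4)// lee_fin invr_ge0 ltW.
  rewrite (noise_normal Hxi)//; case: ifPn => [_|]; last first.
    rewrite -leqNgt => Kk; apply: normal_tail_series; last exact: ts.
    exact: leq_trans Kk.
  have tk0 : 0 < t k.+1 by rewrite (lt_le_trans T00)// tT.
  apply: (le_trans (normal_tail_le tk0)); rewrite lee_fin -[leRHS]mul1r.
  apply: ler_pM; [exact: expR_ge0|by rewrite invr_ge0 ltW| |].
    by rewrite -expR0 ler_expR lerNl oppr0 divr_ge0// sqr_ge0.
  by rewrite lef_pV2 ?posrE// tT.
have g0 k : 0 <= g k by rewrite divr_ge0// sqrtr_ge0.
have sumb n : \sum_(0 <= k < n) b k <= K%:R / T0 + g K.-1.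
  suff -> : \sum_(0 <= k < n) b k =
      (minn n K)%:R / T0 + (if (n <= K)%N then 0 else g K.-1 - g n.-1).
    apply: lerD; first by rewrite ler_pM2r ?invr_gt0// ler_nat geq_minr.
    by case: ifP => _; rewrite ?g0// lerBlDr lerDl.
  elim: n => [|n IH]; first by rewrite big_geq// min0n mul0r add0r.
  rewrite big_nat_recr//= IH /b; case: (ltngtP n K) => nK.
  - by rewrite !addr0 (minn_idPl nK) -natr1; ring.
  - by rewrite (minn_idPr (leqW (ltnW nK))); ring.
  - by rewrite nK (minn_idPr (leqnSn K)); ring.
apply: (@le_trans _ _ (\sum_(0 <= k <oo) P (A k))%E).
  apply: measure_sigma_subadditive => //.
    rewrite (_ : [set w | _] = \bigcup_k A k); last first.
      apply/seteqP; split => w.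
        by move=> [[|k] [k1 tk]] //; exists k.+1.
      by move=> [[|k] k1 tk] //; exists k.+1.
    exact: bigcupT_measurable.
  by move=> w [[|k] [k1 tk]] //; exists k.+1.
apply: lime_le; first exact: is_cvg_ereal_nneg_natsum.
apply: nearW => n; apply: (@le_trans _ _ (\sum_(0 <= k < n) (b k)%:E)%E).
  exact: lee_sum.
by rewrite sumEFin lee_fin.
Qed.

Lemma is_test_psi_threshold (Teps : R -> R) (eps : R) :
  is_test (psi_threshold Teps eps).
Proof.
split=> [y|B mB].
  by rewrite /psi_threshold indicE; case: (_ \in _); rewrite ?lexx ler01.
have mA := measurable_detection (fun k => eps * threshold Teps eps k).
rewrite -[X in _ X]setTI.
exact: (@measurable_indic _ (g_sigma_algebraType (@coordinate_events R)) R setT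
  _ mA measurableT B mB).
Qed.

Lemma threshold_ge (Teps : R -> R) eps k : Teps eps <= threshold Teps eps k.
Proof. by rewrite /threshold; case: ifP => // _; rewrite le_max lexx. Qed.

(** Lets the threshold at the bracket index serve for all earlier coordinates when a large one is
    sought. *)
Lemma threshold_le (Teps : R -> R) eps k m : (1 <= k <= m)%N ->
  threshold Teps eps k <= threshold Teps eps m.
Proof.
move=> /andP[k1 km]; rewrite {1}/threshold; case: ifPn => [_|]; first exact: threshold_ge.
rewrite -ltnNge => k2; rewrite /threshold leqNgt (leq_trans k2 km)/=.
rewrite ge_max le_max lexx/= le_max; apply/orP; right.
have k0 : 0 < k%:R :> R by rewrite ltr0n.
have lk : 0 < ln k%:R :> R by rewrite ln_gt0// ltr1n.
have m0 : 0 < m%:R :> R by rewrite ltr0n (leq_trans k1).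
have lkm : ln k%:R <= ln m%:R :> R by rewrite ler_ln ?posrE// ler_nat.
rewrite ler_wsqrtr// ler_wpM2l// lerD// ler_ln ?posrE//.
exact: lt_le_trans lkm.
Qed.

Lemma threshold_sqr_le (Teps : R -> R) eps m B : (2 <= m)%N -> 0 <= Teps eps ->
  Teps eps ^+ 2 <= B -> 4 * ln (m%:R : R) <= B -> threshold Teps eps m ^+ 2 <= B.
Proof.
move=> m2 T0 TB lB; rewrite /threshold leqNgt m2/=.
have [_|_] := leP (Teps eps); last by [].
have lm : 0 < ln m%:R :> R by rewrite ln_gt0// ltr1n.
(* The sign of the radicand is left open, since [Num.sqrt] of a negative number is 0; otherwise
   [loglog m <= ln m] bounds it by [4 * ln m]. *)
have [x0|x0] := leP 0 (2 * (ln (m%:R : R) + loglog (m%:R : R))).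
  rewrite sqr_sqrtr//.
  by have := ln_sublinear lm; move: lB; rewrite /loglog; lra.
by rewrite ler0_sqrtr ?(ltW x0)// expr0n (le_trans _ TB)// sqr_ge0.
Qed.

Lemma measurable_test (psi : (nat -> R) -> R) eps eta : is_test psi ->
  measurable_fun setT (fun w => psi (observation xi eps eta w)).
Proof.
move=> [_ mpsi].
apply: (@measurableT_comp _ _ _ _ (g_sigma_algebraType (@coordinate_events R)) _ psi).
  by move=> _ B mB; rewrite setTI; exact: mpsi.
apply: measurable_fun_sequence => k k1.
by apply: measurable_funD => //; exact: measurable_funM.
Qed.

Lemma false_alarm_threshold (Teps : R -> R) eps (K : nat) : 0 < eps ->
  1 <= Teps eps -> (4 <= K)%N ->
  (expect xi eps (fun=> 0%R) (psi_threshold Teps eps) <=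
   (K%:R / Teps eps + 2 / Num.sqrt (ln K.-1%:R))%:E)%E.
Proof.
move=> eps0 T1 K4.
apply: le_trans (false_alarm_bound T1 K4 (fun k _ => threshold_ge Teps eps k) _);
    last first.
  move=> k Kk; rewrite /threshold leqNgt (leq_trans _ (leq_trans K4 Kk))//=.
  by rewrite le_max lexx orbT.
rewrite /expect unlock.
have mE : measurable [set w | exists k : nat, (1 <= k)%N /\
    threshold Teps eps k < `|xi k w|].
  rewrite -[X in measurable X]setTI.
  exact: (measurable_noise xi measurableT (measurable_detection _)).
rewrite (eq_integral (fun w => (\1_[set w | exists k : nat, (1 <= k)%N /\
    threshold Teps eps k < `|xi k w|] w)%:E)); last first.
  move=> w _; rewrite /psi_threshold !indicE; congr ((nat_of_bool _)%:R%:E).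
  apply/idP/idP; rewrite !inE => -[k [k1 tk]]; exists k; split=> //; move: tk;
    by rewrite /observation add0r normrM gtr0_norm// ltr_pM2l.
by rewrite integral_indic// setIT.
Qed.

(** A miss keeps [|y k|] within its threshold, so a signal coordinate of more than twice that size
    forces [|xi k|] itself beyond [threshold Teps eps k]; the normal tail does the rest. *)
Lemma missed_detection_threshold (Teps : R -> R) eps eta (k : nat) : 0 < eps ->
  0 < Teps eps -> (1 <= k)%N -> 2 * eps * threshold Teps eps k < `|eta k| ->
  (expect xi eps eta (fun y => 1 - psi_threshold Teps eps y)%R <=
   ((Teps eps)^-1)%:E)%E.
Proof.
move=> eps0 T0 k1 ek; set t := threshold Teps eps k in ek.
have Tt : Teps eps <= t by exact: threshold_ge.
have t0 : 0 < t by exact: lt_le_trans Tt.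
have [psi01 _] := is_test_psi_threshold Teps eps.
have mt := measurable_test eps eta (is_test_psi_threshold Teps eps).
have mA : measurable [set x : R | t < `|x|] := measurable_norm_gt t.
have mB : measurable (xi k @^-1` [set x : R | t < `|x|]).
  rewrite -[X in measurable X]setTI.
  exact: (measurable_funP (xi k) measurableT).
apply: (@le_trans _ _
    (\int[P]_w (\1_(xi k @^-1` [set x : R | (t < `|x|)%R]) w)%:E)%E).
  rewrite /expect unlock; apply: ge0_le_integral => //.
  - by move=> w _; rewrite lee_fin subr_ge0; case/andP: (psi01 (observation xi eps eta w)).
  - by apply/measurable_EFinP; exact: measurable_funB.
  - by apply/measurable_EFinP; exact: measurable_indic.
  move=> w _; rewrite lee_fin /psi_threshold !indicE.
  have [_|] := boolP (observation _ _ _ _ \in _); first by rewrite subrr.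
  rewrite notin_setE/= => miss; rewrite subr0 mem_set//=.
  have yk : `|eta k + eps * xi k w| <= eps * t.
    by rewrite leNgt; apply/negP => h; apply: miss; exists k.
  have : `|eta k| <= `|eta k + eps * xi k w| + eps * `|xi k w|.
    rewrite -{1}[eta k](addrK (eps * xi k w)); apply: le_trans (ler_normB _ _) _.
    by rewrite lerD2l normrM gtr0_norm.
  move=> h; have : eps * t < eps * `|xi k w| by move: ek yk h; lra.
  by rewrite ltr_pM2l.
rewrite integral_indic// setIT.
rewrite [leLHS](_ : _ = normal_prob 0 1 [set x : R | (t < `|x|)%R]); last first.
  exact: noise_normal.
apply: (le_trans (normal_tail_le t0)); rewrite lee_fin -[leRHS]mul1r.
apply: ler_pM; [exact: expR_ge0|by rewrite invr_ge0 ltW| |].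
  by rewrite -expR0 ler_expR lerNl oppr0 divr_ge0// sqr_ge0.
by rewrite lef_pV2 ?posrE.
Qed.

Lemma small_tail_exists (e : R) : 0 < e ->
  exists2 K : nat, (4 <= K)%N & 2 / Num.sqrt (ln (K.-1%:R : R)) <= e.
Proof.
move=> e0; pose X := expR ((2 / e) ^+ 2).
exists (Num.bound X + 4)%N; first by rewrite leq_addl.
have h : X <= (Num.bound X + 4).-1%:R.
  rewrite addnS/= (le_trans (ltW (archi_boundP (expR_ge0 _))))//.
  by rewrite ler_nat leq_addr.
have h2 : (2 / e) ^+ 2 <= ln (Num.bound X + 4).-1%:R.
  by rewrite -[leLHS]expRK ler_ln ?posrE ?expR_gt0// (lt_le_trans (expR_gt0 _) h).
have h3 : 2 / e <= Num.sqrt (ln (Num.bound X + 4).-1%:R).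
  rewrite -[leLHS]ger0_norm ?divr_ge0 ?(ltW e0)// -sqrtr_sqr.
  by rewrite ler_wsqrtr.
have s0 : 0 < Num.sqrt (ln (Num.bound X + 4).-1%:R : R).
  by apply: lt_le_trans h3; rewrite divr_gt0.
by rewrite ler_pdivrMr// mulrC -ler_pdivrMr.
Qed.

End FalseAlarm.

(** * The linear program for a single parameter *)

(** The reciprocals are the semi-axes of the ellipsoid in the coordinates [eta k]. *)
Definition product_seq {R : realType} (a s : nat -> R) (k : nat) : R := a k * s k.

Definition growing {R : realType} (a s tau : nat -> R) (c0 : R) : Prop :=
  [/\ 0 < a 1%N, 0 < s 1%N, 1 < c0, (forall k, (1 <= k)%N -> 1 < tau k) &
      forall k, (1 <= k)%N -> tau k <= s k.+1 / s k /\ c0 <= a k.+1 / a k].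

Section LinearProgram.
Context {R : realType}.
Variables (a s tau : nat -> R) (c0 : R).
Hypothesis G : growing a s tau c0.

Local Notation p := (product_seq a s).

Let a1 : 0 < a 1%N. Proof. by case: G. Qed.
Let s1 : 0 < s 1%N. Proof. by case: G. Qed.
Let c01 : 1 < c0. Proof. by case: G. Qed.
Let tau1 k : (1 <= k)%N -> 1 < tau k. Proof. by case: G => _ _ _ h _; exact: h. Qed.
Let s_ratio k : (1 <= k)%N -> tau k <= s k.+1 / s k.
Proof. by move=> k1; case: G => _ _ _ _ /(_ k k1)[]. Qed.
Let a_ratio k : (1 <= k)%N -> c0 <= a k.+1 / a k.
Proof. by move=> k1; case: G => _ _ _ _ /(_ k k1)[]. Qed.

(** Positivity is known at index 1 only; a ratio above 1 forces the sign of the next term. *)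
Lemma ratio_growth (x : nat -> R) (c : nat -> R) : 0 < x 1%N ->
  (forall k, (1 <= k)%N -> 1 < c k) ->
  (forall k, (1 <= k)%N -> c k <= x k.+1 / x k) ->
  forall k, (1 <= k)%N -> 0 < x k /\ c k * x k <= x k.+1.
Proof.
move=> x1 c1 xr; suff xpos k : (1 <= k)%N -> 0 < x k.
  by move=> k k1; split; rewrite ?xpos// -ler_pdivlMr ?xpos// xr.
elim: k => // k IH _; have [->//|k0] := posnP k.
have xk := IH k0.
have : 0 < x k.+1 / x k.
  by rewrite (lt_le_trans _ (xr k k0))// (lt_trans _ (c1 k k0)).
by rewrite pmulr_lgt0 ?invr_gt0.
Qed.

Lemma a_gt0 k : (1 <= k)%N -> 0 < a k.
Proof. by move=> k1; case: (ratio_growth a1 (fun _ _ => c01) a_ratio k1). Qed.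

Lemma a_growth k : (1 <= k)%N -> c0 * a k <= a k.+1.
Proof. by move=> k1; case: (ratio_growth a1 (fun _ _ => c01) a_ratio k1). Qed.

Lemma s_gt0 k : (1 <= k)%N -> 0 < s k.
Proof. by move=> k1; case: (ratio_growth s1 tau1 s_ratio k1). Qed.

Lemma s_growth k : (1 <= k)%N -> tau k * s k <= s k.+1.
Proof. by move=> k1; case: (ratio_growth s1 tau1 s_ratio k1). Qed.

Lemma p_gt0 k : (1 <= k)%N -> 0 < p k.
Proof. by move=> k1; rewrite mulr_gt0 ?a_gt0 ?s_gt0. Qed.

Lemma p_growth k : (1 <= k)%N -> c0 * tau k * p k <= p k.+1.
Proof.
move=> k1; rewrite /product_seq (_ : _ * _ = (c0 * a k) * (tau k * s k)); last by ring.
by apply: ler_pM; rewrite ?a_growth ?s_growth// mulr_ge0// ltW ?a_gt0 ?s_gt0//;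
  [rewrite (lt_trans _ c01)|rewrite (lt_trans _ (tau1 k1))].
Qed.

Lemma p_ltS k : (1 <= k)%N -> p k < p k.+1.
Proof.
move=> k1; apply: lt_le_trans (p_growth k1).
rewrite -{1}[p k]mul1r ltr_pM2r ?p_gt0// -[1]mul1r ltr_pM// ?tau1//.
Qed.

Lemma a_ltS k : (1 <= k)%N -> a k < a k.+1.
Proof.
move=> k1; apply: lt_le_trans (a_growth k1).
by rewrite -{1}[a k]mul1r ltr_pM2r ?a_gt0.
Qed.

Lemma lt_from1 (x : nat -> R) : (forall k, (1 <= k)%N -> x k < x k.+1) ->
  forall i j, (1 <= i)%N -> (i < j)%N -> x i < x j.
Proof.
move=> xS i j i1; elim: j => // j IH; rewrite ltnS leq_eqVlt => /orP[/eqP <-|ij].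
  exact: xS.
by apply: (lt_trans (IH ij)); apply: xS; exact: leq_trans ij.
Qed.

Lemma p_lt i j : (1 <= i)%N -> (i < j)%N -> p i < p j.
Proof. exact: lt_from1 p_ltS i j. Qed.

Lemma p_le i j : (1 <= i)%N -> (i <= j)%N -> p i <= p j.
Proof.
by move=> i1; rewrite leq_eqVlt => /orP[/eqP <-//|ij]; rewrite ltW// p_lt.
Qed.

Lemma a_lt i j : (1 <= i)%N -> (i < j)%N -> a i < a j.
Proof. exact: lt_from1 a_ltS i j. Qed.

Lemma a_le i j : (1 <= i)%N -> (i <= j)%N -> a i <= a j.
Proof.
by move=> i1; rewrite leq_eqVlt => /orP[/eqP <-//|ij]; rewrite ltW// a_lt.
Qed.

Lemma geometric_unbounded (x : nat -> R) (c : R) : 0 < x 1%N -> 1 < c ->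
  (forall k, (1 <= k)%N -> c * x k <= x k.+1) ->
  forall A, exists2 k, (1 <= k)%N & A < x k.
Proof.
move=> x1 c1 xr A.
have h k : x 1%N * (1 + k%:R * (c - 1)) <= x k.+1.
  elim: k => [|k IH]; first by rewrite mul0r addr0 mulr1.
  apply: le_trans (xr k.+1 isT); apply: (@le_trans _ _ (c * (x 1%N * (1 + k%:R * (c - 1))))).
    rewrite mulrCA ler_pM2l// -natr1 -subr_ge0.
    rewrite (_ : _ - _ = (c - 1) * ((c - 1) * k%:R)); last by ring.
    by rewrite !mulr_ge0// subr_ge0 ltW.
  by rewrite ler_pM2l// (lt_trans _ c1).
have [k Ak] : exists k : nat, A / x 1%N / (c - 1) < k%:R.
  have := archi_boundP (normr_ge0 (A / x 1%N / (c - 1))).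
  by move=> hh; exists (Num.bound (`|A / x 1%N / (c - 1)|)); rewrite (le_lt_trans (ler_norm _)).
exists k.+1 => //; apply: lt_le_trans (h k).
move: Ak; rewrite ltr_pdivrMr ?subr_gt0// ltr_pdivrMr// => Ak.
by rewrite mulrC (lt_le_trans Ak)// ler_pM2r// lerDr.
Qed.

Lemma a_unbounded A : exists2 k, (1 <= k)%N & A < a k.
Proof. exact: geometric_unbounded a1 c01 a_growth A. Qed.

Lemma p_bracket_exists A : p 1%N <= A ->
  exists m, (2 <= m)%N /\ p m.-1 <= A < p m.
Proof.
move=> pA.
have [k k1 Ak] : exists2 k, (1 <= k)%N & A < p k.
  apply: (@geometric_unbounded p c0 (p_gt0 _) c01) => // k k1.
  apply: le_trans (p_growth k1); rewrite ler_pM2r ?p_gt0//.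
  by rewrite ler_peMr ?ltW ?tau1// (lt_trans _ c01).
have ex : exists k, (1 <= k)%N && (A < p k) by exists k; rewrite k1.
case: (ex_minnP ex) => m /andP[m1 Am] mmin.
have m2 : (2 <= m)%N.
  by case: m m1 Am mmin => [//|[_|//]]; rewrite ltNge pA.
exists m; split=> //; rewrite Am andbT leNgt; apply/negP => Am1.
have := mmin m.-1; rewrite Am1 andbT.
case: m m1 m2 {Am mmin Am1} => [//|[//|m]] _ _ /=.
by move=> /(_ isT); rewrite ltnn.
Qed.

Definition bracket (n : nat) (r : R) :=
  (2 <= n)%N /\ (a n)^-1 <= r <= (a n.-1)^-1.

(** The energies [s k ^+ 2 * eta k ^+ 2] at [k = n.-1] ([mass_lo]) and [k = n] ([mass_hi]) that turn
    both constraints into equalities: total [r ^+ 2] and [a ^+ 2]-weighted total 1. *)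
Definition mass_lo n (r : R) :=
  (a n ^+ 2 * r ^+ 2 - 1) / (a n ^+ 2 - a n.-1 ^+ 2).
Definition mass_hi n (r : R) :=
  (1 - a n.-1 ^+ 2 * r ^+ 2) / (a n ^+ 2 - a n.-1 ^+ 2).
Definition lp_value (eps : R) n (r : R) :=
  (eps ^+ 2 * (a n ^+ 2 - a n.-1 ^+ 2))^-1 *
  ((a n ^+ 2 * r ^+ 2 - 1) / s n.-1 ^+ 2 + (1 - a n.-1 ^+ 2 * r ^+ 2) / s n ^+ 2).

Section Bracket.
Variables (n : nat) (r eps : R).
Hypotheses (eps0 : 0 < eps) (n2 : (2 <= n)%N).

Let n1 : (1 <= n)%N. Proof. exact: ltnW. Qed.
Let n11 : (1 <= n.-1)%N. Proof. by rewrite -ltnS prednK. Qed.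
Let an0 : 0 < a n. Proof. exact: a_gt0. Qed.
Let an10 : 0 < a n.-1. Proof. exact: a_gt0. Qed.
Let sn0 : 0 < s n. Proof. exact: s_gt0. Qed.
Let sn10 : 0 < s n.-1. Proof. exact: s_gt0. Qed.

Let gap : 0 < a n ^+ 2 - a n.-1 ^+ 2.
Proof.
rewrite subr_gt0 ltr_pXn2r ?nnegrE// ?(ltW an0) ?(ltW an10)//.
by apply: a_lt => //; rewrite prednK.
Qed.

Lemma mass_sum : mass_lo n r + mass_hi n r = r ^+ 2.
Proof. by rewrite /mass_lo /mass_hi; field; rewrite gt_eqF. Qed.

Lemma mass_weighted_sum :
  a n.-1 ^+ 2 * mass_lo n r + a n ^+ 2 * mass_hi n r = 1.
Proof. by rewrite /mass_lo /mass_hi; field; rewrite gt_eqF. Qed.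

Lemma lp_valueE :
  lp_value eps n r = (mass_lo n r / s n.-1 ^+ 2 + mass_hi n r / s n ^+ 2) / eps ^+ 2.
Proof.
by rewrite /lp_value /mass_lo /mass_hi; field; rewrite !gt_eqF.
Qed.

Hypothesis br : (a n)^-1 <= r <= (a n.-1)^-1.

Let r0 : 0 < r.
Proof. by case/andP: br => h _; rewrite (lt_le_trans _ h)// invr_gt0. Qed.

Lemma mass_lo_ge0 : 0 <= mass_lo n r.
Proof.
case/andP: br => h _; rewrite divr_ge0 ?(ltW gap)// subr_ge0 -exprMn.
by rewrite exprn_ege1// -(divff (lt0r_neq0 an0)) ler_pM2l.
Qed.

Lemma mass_hi_ge0 : 0 <= mass_hi n r.
Proof.
case/andP: br => _ h; rewrite divr_ge0 ?(ltW gap)// subr_ge0 -exprMn.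
rewrite exprn_ile1// ?mulr_ge0 ?(ltW r0) ?(ltW an10)//.
by rewrite -(divff (lt0r_neq0 an10)) ler_pM2l.
Qed.

(** [eps ^+ 2 * lp_value eps n r] is a convex combination of [p n.-1 ^- 2] and [p n ^- 2]: the
    weights are the masses times [a ^+ 2], and they sum to 1. *)
Lemma lp_value_bounds :
  1 <= eps ^+ 2 * lp_value eps n r * p n ^+ 2 /\
  eps ^+ 2 * lp_value eps n r * p n.-1 ^+ 2 <= 1.
Proof.
have eps20 : eps ^+ 2 != 0 by rewrite expf_neq0 ?gt_eqF.
rewrite lp_valueE [eps ^+ 2 * _]mulrC divfK//.
have pp : p n.-1 ^+ 2 <= p n ^+ 2.
  rewrite ler_pXn2r ?nnegrE ?(ltW (p_gt0 _))//.
  by apply: p_le => //; exact: leq_pred.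
have q0 : 0 < p n ^+ 2 by rewrite exprn_gt0// p_gt0.
have q10 : 0 < p n.-1 ^+ 2 by rewrite exprn_gt0// p_gt0.
have xsum := mass_weighted_sum.
have x0 : 0 <= a n ^+ 2 * mass_hi n r by rewrite mulr_ge0 ?exprn_ge0 ?mass_hi_ge0 ?ltW.
have x1 : 0 <= a n.-1 ^+ 2 * mass_lo n r by rewrite mulr_ge0 ?exprn_ge0 ?mass_lo_ge0 ?ltW.
have e1 : mass_lo n r / s n.-1 ^+ 2 = a n.-1 ^+ 2 * mass_lo n r / p n.-1 ^+ 2.
  by rewrite /product_seq; field; rewrite !gt_eqF.
have e0 : mass_hi n r / s n ^+ 2 = a n ^+ 2 * mass_hi n r / p n ^+ 2.
  by rewrite /product_seq; field; rewrite !gt_eqF.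
rewrite e1 e0; move: x0 x1 xsum.
move: (a n ^+ 2 * _) (a n.-1 ^+ 2 * _) => x0 x1 x00 x10 xsum; split.
  rewrite -xsum mulrDl mulfVK ?gt_eqF// lerD2r mulrAC ler_pdivlMr//.
  exact: ler_wpM2l.
rewrite -xsum mulrDl mulfVK ?gt_eqF// lerD2l mulrAC ler_pdivrMr//.
exact: ler_wpM2l.
Qed.

Lemma lp_value_gt0 : 0 < lp_value eps n r.
Proof.
have [h _] := lp_value_bounds.
have : 0 < eps ^+ 2 * lp_value eps n r * p n ^+ 2 by exact: lt_le_trans h.
by rewrite pmulr_lgt0 ?exprn_gt0 ?p_gt0// pmulr_rgt0 ?exprn_gt0.
Qed.

End Bracket.

(** * Every alternative has a large coordinate *)

Section Membership.
Variables (eta : nat -> R) (r : R).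
Hypothesis ellipsoid :
  (\sum_(1 <= k <oo) ((`|a k * s k * eta k| ^+ 2)%:E) <= 1)%E.
Hypothesis separated :
  ((r ^+ 2)%:E <= \sum_(1 <= k <oo) ((s k ^+ 2 * eta k ^+ 2)%:E))%E.

(** The energy beyond [m] enters the ellipsoid constraint with weights at least [a m.+1 ^+ 2]. *)
Lemma head_energy_ge (m : nat) :
  (r ^+ 2 - \sum_(1 <= k < m.+1) s k ^+ 2 * eta k ^+ 2) * a m.+1 ^+ 2 <= 1.
Proof.
have am0 : 0 < a m.+1 ^+ 2 by rewrite exprn_gt0// a_gt0.
rewrite -ler_pdivlMr// mul1r lerBlDr -lee_fin; apply: (le_trans separated).
have sq0 k : 0 <= s k ^+ 2 * eta k ^+ 2 by rewrite mulr_ge0// sqr_ge0.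
apply: lime_le; first by apply: is_cvg_ereal_nneg_natsum => k _; rewrite lee_fin.
apply: nearW => N; rewrite sumEFin lee_fin.
have [Nm|mN] := leqP N m.+1.
  apply: ler_wpDl; first by rewrite invr_ge0 ltW.
  case: N Nm => [|N] Nm; first by rewrite big_geq// sumr_ge0.
  by rewrite [leRHS](@big_cat_nat _ _ _ N.+1)//= lerDl sumr_ge0.
rewrite [leLHS](@big_cat_nat _ _ _ m.+1)//=; last exact: ltnW.
rewrite addrC.
rewrite lerD2r -[leRHS]mul1r ler_pdivlMr// mulr_suml -lee_fin.
apply: le_trans ellipsoid.
apply: le_trans (@nneseries_lim_ge _ _ predT 1%N N _); last first.
  by move=> k _ _; rewrite lee_fin exprn_ge0.
rewrite sumEFin lee_fin [leRHS](@big_cat_nat _ _ _ m.+1)//=; last exact: ltnW.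
apply: ler_wpDl; first by rewrite sumr_ge0// => k _; rewrite exprn_ge0.
rewrite big_nat [leRHS]big_nat; apply: ler_sum => k /andP[mk _].
rewrite real_normK ?num_real// !exprMn mulrC mulrA ler_wpM2r ?sqr_ge0//.
rewrite ler_wpM2r ?sqr_ge0// ler_pXn2r ?nnegrE ?a_le// ltW// a_gt0//.
exact: leq_trans mk.
Qed.

Hypothesis tau_ge : forall k, (1 <= k)%N -> tau 1%N <= tau k.

(** Read downwards, the squares decay at least by the factor [tau 1 ^- 2], so the last one
    dominates; the constant is the sum of that geometric series. *)
Lemma sum_s_sqr_le (m : nat) : (1 <= m)%N ->
  \sum_(1 <= k < m.+1) s k ^+ 2 <= (1 - (tau 1%N) ^- 2)^-1 * s m ^+ 2.
Proof.
have t1 := tau1 (leqnn 1).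
have t0 : 0 < tau 1%N by rewrite (lt_trans _ t1).
have ti : tau 1%N ^- 2 < 1 by rewrite invf_lt1 ?exprn_gt0// exprn_egt1.
have C1 : 1 <= (1 - tau 1%N ^- 2)^-1.
  by rewrite invf_ge1 ?subr_gt0// gerBl invr_ge0 exprn_ge0 ?ltW.
elim: m => // -[|m] IH _.
  by rewrite big_nat1 ler_peMl// sqr_ge0.
rewrite big_nat_recr//=; have {IH} := IH isT.
have sm : s m.+1 ^+ 2 <= tau 1%N ^- 2 * s m.+2 ^+ 2.
  rewrite mulrC ler_pdivlMr ?exprn_gt0// mulrC -exprMn ler_pXn2r//.
  - apply: le_trans (s_growth (ltn0Sn m)); rewrite ler_pM2r ?s_gt0//.
    exact: tau_ge.
  - by rewrite nnegrE mulr_ge0// ltW// s_gt0.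
  - by rewrite nnegrE ltW// s_gt0.
set C := (1 - _)^-1 => IH.
apply: (@le_trans _ _ (C * (tau 1%N ^- 2 * s m.+2 ^+ 2) + s m.+2 ^+ 2)).
  by rewrite lerD2r (le_trans IH)// ler_wpM2l// (le_trans _ C1).
rewrite le_eqVlt; apply/orP; left; apply/eqP.
rewrite /C; field.
by rewrite gt_eqF//= subr_eq0 gt_eqF// exprn_egt1.
Qed.

(** If all coordinates up to [n] were small, the energy up to [n] or [n.-1] would be at most a
    fraction [dl] of one of the two masses. With [dl = 1 - c0^-1], one of the two factors [c0]
    gained from [a ^+ 2] repays this loss and the other breaks the ellipsoid constraint. *)
Lemma large_coordinate (n : nat) (eps t : R) : 0 < eps -> 0 < t -> bracket n r ->
  2 * (1 - (tau 1%N) ^- 2)^-1 / (1 - c0^-1) * t ^+ 2 < lp_value eps n r ->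
  exists k, (1 <= k <= n)%N /\ eps * t < `|eta k|.
Proof.
move=> eps0 t0 [n2 br]; set C := (1 - _)^-1; set dl := 1 - c0^-1.
set u := lp_value _ _ _ => tu.
apply: contrapT => /forallNP small.
have c00 : 0 < c0 by rewrite (lt_trans _ c01).
have dl0 : 0 < dl by rewrite subr_gt0 invf_lt1.
have n11 : (1 <= n.-1)%N by rewrite -ltnS prednK// ltnW.
have n1 : (1 <= n)%N by rewrite ltnW.
have head m : (1 <= m <= n)%N -> \sum_(1 <= k < m.+1) s k ^+ 2 * eta k ^+ 2 <=
    (eps * t) ^+ 2 * (C * s m ^+ 2).
  move=> /andP[m1 mn].
  apply: (@le_trans _ _ ((eps * t) ^+ 2 * \sum_(1 <= k < m.+1) s k ^+ 2)).
    rewrite mulr_sumr big_nat [leRHS]big_nat; apply: ler_sum => k /andP[k1 km].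
    rewrite mulrC ler_wpM2r ?sqr_ge0// -(real_normK (num_real (eta k))).
    rewrite ler_pXn2r ?nnegrE ?mulr_ge0 ?(ltW eps0) ?(ltW t0)//.
    rewrite leNgt; apply/negP => hk; apply: (small k); split=> //.
    by rewrite k1 (leq_trans _ mn).
  by rewrite ler_wpM2l ?sqr_ge0// sum_s_sqr_le.
have w1 := mass_lo_ge0 n2 br; have w0 := mass_hi_ge0 n2 br.
have ws := mass_sum r n2; have wws := mass_weighted_sum r n2.
have uE := lp_valueE r eps0 n2; rewrite -/u in uE.
have an := a_gt0 n1; have an1 := a_gt0 n11.
have sn := s_gt0 n1; have sn1 := s_gt0 n11.
have aS := a_growth n11; rewrite prednK// in aS.
have aSn := a_growth n1.
have C0 : 0 < C.
  have t1 := tau1 (leqnn 1).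
  rewrite invr_gt0 subr_gt0 invf_lt1 ?exprn_gt0 ?(lt_trans _ t1)//.
  by rewrite exprn_egt1.
have u0 : 0 < u by exact: lp_value_gt0.
have et : (eps * t) ^+ 2 * C * 2 < dl * (eps ^+ 2 * u).
  have := tu; rewrite mulrAC ltr_pdivrMr// => {}tu.
  rewrite (_ : _ * 2 = eps ^+ 2 * (2 * C * t ^+ 2)); last by ring.
  by rewrite [ltRHS]mulrCA ltr_pM2l ?exprn_gt0// [dl * u]mulrC.
have ueps : eps ^+ 2 * u = mass_lo n r / s n.-1 ^+ 2 + mass_hi n r / s n ^+ 2.
  by rewrite uE mulrC divfK// expf_neq0// gt_eqF.
have dl1 : 0 <= 1 - dl.
  by have : 0 < c0^-1; [rewrite invr_gt0|rewrite /dl; lra].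
have dlc : (1 - dl) * c0 = 1 by rewrite /dl; field; rewrite gt_eqF.
(* One of the two terms of [eps ^+ 2 * u] is at least half of it, whence the factor 2 in the
   hypothesis; its index is where the head is cut. *)
have [hi|lo] := leP (mass_lo n r / s n.-1 ^+ 2) (mass_hi n r / s n ^+ 2).
  have hS : \sum_(1 <= k < n.+1) s k ^+ 2 * eta k ^+ 2 <= dl * mass_hi n r.
    apply: le_trans (head n _) _; first by rewrite n1 leqnn.
    have h : (eps * t) ^+ 2 * C <= dl * (mass_hi n r / s n ^+ 2).
      by move: et hi dl0; rewrite ueps; nra.
    rewrite mulrA (_ : dl * mass_hi n r = dl * (mass_hi n r / s n ^+ 2) * s n ^+ 2).
      by rewrite ler_wpM2r// sqr_ge0.
    by field; rewrite gt_eqF.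
  have := head_energy_ge n; set S := \sum_(_ <= _ < _) _ in hS *; apply/negP.
  have X : (1 - dl) * (mass_lo n r + mass_hi n r) <= r ^+ 2 - S.
    by rewrite -ws; have := mulr_ge0 (ltW dl0) w1; move: hS; lra.
  rewrite -ltNge; apply: (lt_le_trans c01).
  apply: (@le_trans _ _
    ((1 - dl) * (mass_lo n r + mass_hi n r) * (c0 * a n) ^+ 2)); last first.
    apply: ler_pM; [|exact: sqr_ge0|exact: X|].
      by apply: mulr_ge0 => //; exact: addr_ge0.
    rewrite ler_pXn2r// nnegrE ?mulr_ge0// ltW// a_gt0//.
  rewrite (_ : _ * _ * _ = (1 - dl) * c0 * (c0 * (a n ^+ 2 *
    (mass_lo n r + mass_hi n r)))); last by ring.
  rewrite dlc mul1r -[leLHS]mulr1 -[X in _ * X]wws ler_pM2l// mulrDr lerD2r.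
  by rewrite ler_wpM2r// ler_pXn2r ?nnegrE ?(ltW an) ?(ltW an1)// a_le// leq_pred.
have hS : \sum_(1 <= k < n.-1.+1) s k ^+ 2 * eta k ^+ 2 <= dl * mass_lo n r.
  apply: le_trans (head n.-1 _) _; first by rewrite n11 leq_pred.
  have h : (eps * t) ^+ 2 * C <= dl * (mass_lo n r / s n.-1 ^+ 2).
    by move: et lo dl0; rewrite ueps; nra.
  rewrite mulrA (_ : dl * mass_lo n r = dl * (mass_lo n r / s n.-1 ^+ 2) * s n.-1 ^+ 2).
    by rewrite ler_wpM2r// sqr_ge0.
  by field; rewrite gt_eqF.
(* Only the mass at [n.-1] gains a factor [c0] in this case, so it must be positive for the
   contradiction to be strict. *)
have w1p : 0 < mass_lo n r.
  have : 0 < mass_lo n r / s n.-1 ^+ 2.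
    by apply: le_lt_trans lo; rewrite divr_ge0// sqr_ge0.
  by rewrite pmulr_lgt0// invr_gt0 exprn_gt0.
have := head_energy_ge n.-1; rewrite prednK//.
rewrite prednK// in hS; set S := \sum_(_ <= _ < _) _ in hS *; apply/negP.
have X : (1 - dl) * mass_lo n r + mass_hi n r <= r ^+ 2 - S.
  by rewrite -ws; move: hS; lra.
rewrite -ltNge; apply: (@lt_le_trans _ _
  (((1 - dl) * mass_lo n r + mass_hi n r) * a n ^+ 2)); last first.
  by rewrite ler_wpM2r// sqr_ge0.
have an2 : (c0 * a n.-1) ^+ 2 <= a n ^+ 2.
  by rewrite ler_pXn2r// nnegrE ?mulr_ge0// ltW.
rewrite mulrDl; apply: (@lt_le_trans _ _
  ((1 - dl) * mass_lo n r * (c0 * a n.-1) ^+ 2 + mass_hi n r * a n ^+ 2)); last first.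
  by rewrite lerD2r ler_wpM2l// mulr_ge0.
rewrite (_ : (1 - dl) * _ * _ = (1 - dl) * c0 * (c0 * (a n.-1 ^+ 2 * mass_lo n r)));
  last by ring.
rewrite dlc mul1r -wws [mass_hi n r * _]mulrC ltrD2r.
by rewrite -[ltLHS]mul1r ltr_pM2r// mulr_gt0// exprn_gt0.
Qed.

End Membership.

(** * Extremal vectors, prescribed values and the position of the bracket *)

Definition extremal n (r : R) (k : nat) : R :=
  if k == n.-1 then Num.sqrt (mass_lo n r) / s n.-1
  else if k == n then Num.sqrt (mass_hi n r) / s n else 0.

Lemma two_point_sum (n N : nat) (F : nat -> R) : (2 <= n)%N -> (n < N)%N ->
  (forall k, k != n.-1 -> k != n -> F k = 0) ->
  \sum_(1 <= k < N) F k = F n.-1 + F n.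
Proof.
case: n => [//|[//|n]] _ nN F0 /=.
rewrite (@big_cat_nat _ _ _ n.+3)//= [X in _ + X]big1_seq; last first.
  move=> k /andP[_]; rewrite mem_index_iota => /andP[nk _].
  by apply: F0; rewrite gtn_eqF// ltnW.
rewrite addr0 big_nat_recr//= big_nat_recr//= big1_seq ?add0r// => k /andP[_].
rewrite mem_index_iota => /andP[_ kn].
by apply: F0; rewrite ltn_eqF// (leq_trans kn).
Qed.

Lemma two_point_series (n : nat) (F : nat -> R) : (2 <= n)%N ->
  (forall k, k != n.-1 -> k != n -> F k = 0) -> (forall k, 0 <= F k) ->
  (\sum_(1 <= k <oo) (F k)%:E = (F n.-1 + F n)%:E)%E.
Proof.
move=> n2 F00 F0; rewrite (nneseries_split 1 n); last by move=> k _; rewrite lee_fin.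
rewrite sumEFin (two_point_sum n2)// eseries0 ?adde0// => k nk _.
by rewrite F00// gtn_eqF// (leq_ltn_trans (leq_pred n)).
Qed.

(** The window from [m - 2] to [m] depends on [m] alone, so vectors whose indices [m] differ by more
    than 2 have disjoint supports. *)
Lemma extremal_support (n m N : nat) (r : R) (k : nat) : (2 <= n)%N ->
  (m.-1 <= n <= m)%N -> (m < N)%N -> extremal n r k != 0 ->
  [&& (1 <= k < N), m <= k + 2 & k <= m]%N.
Proof.
move=> n2 nm mN; rewrite /extremal.
have [->|k1] := eqVneq k n.-1; first by move=> _; apply/and3P; split; lia.
have [->|k2] := eqVneq k n; first by move=> _; apply/and3P; split; lia.
by rewrite eqxx.
Qed.

Section Extremal.
Variables (n : nat) (r : R).
Hypotheses (n2 : (2 <= n)%N) (br : (a n)^-1 <= r <= (a n.-1)^-1).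

Let n11 : (1 <= n.-1)%N. Proof. by rewrite -ltnS prednK// ltnW. Qed.
Let nn1 : (n == n.-1) = false.
Proof. by rewrite gtn_eqF// ltn_predL ltnW. Qed.
Let sn0 : 0 < s n. Proof. by apply: s_gt0; rewrite ltnW. Qed.
Let sn10 : 0 < s n.-1. Proof. exact: s_gt0. Qed.

Lemma extremal0 k : k != n.-1 -> k != n -> extremal n r k = 0.
Proof. by rewrite /extremal => /negbTE -> /negbTE ->. Qed.

Lemma extremal_sqr_lo : s n.-1 ^+ 2 * extremal n r n.-1 ^+ 2 = mass_lo n r.
Proof.
rewrite /extremal eqxx exprMn sqr_sqrtr; last exact: mass_lo_ge0.
by field; rewrite gt_eqF.
Qed.

Lemma extremal_sqr_hi : s n ^+ 2 * extremal n r n ^+ 2 = mass_hi n r.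
Proof.
rewrite /extremal nn1 eqxx exprMn sqr_sqrtr; last exact: mass_hi_ge0.
by field; rewrite gt_eqF.
Qed.

Lemma extremal_l2 : (\sum_(1 <= k <oo) ((extremal n r k ^+ 2)%:E) < +oo)%E.
Proof.
rewrite (two_point_series n2) ?ltry// => k; last by rewrite sqr_ge0.
by move=> k1 k2; rewrite extremal0// expr0n.
Qed.

Lemma extremal_ellipsoid :
  (\sum_(1 <= k <oo) ((`|a k * s k * extremal n r k| ^+ 2)%:E) <= 1)%E.
Proof.
rewrite (two_point_series n2); last 2 first.
- by move=> k k1 k2; rewrite extremal0// mulr0 normr0 expr0n.
- by move=> k; rewrite exprn_ge0.
have E k : `|a k * s k * extremal n r k| ^+ 2 =
    a k ^+ 2 * (s k ^+ 2 * extremal n r k ^+ 2).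
  by rewrite real_normK ?num_real//; ring.
by rewrite !E extremal_sqr_lo extremal_sqr_hi (mass_weighted_sum r n2).
Qed.

Lemma extremal_separated :
  ((r ^+ 2)%:E <= \sum_(1 <= k <oo) ((s k ^+ 2 * extremal n r k ^+ 2)%:E))%E.
Proof.
rewrite (two_point_series n2); last 2 first.
- by move=> k k1 k2; rewrite extremal0// expr0n mulr0.
- by move=> k; rewrite mulr_ge0// sqr_ge0.
by rewrite extremal_sqr_lo extremal_sqr_hi (mass_sum r n2).
Qed.

Lemma extremal_energy (eps : R) (N : nat) : 0 < eps -> (n < N)%N ->
  \sum_(1 <= k < N) (extremal n r k / eps) * (extremal n r k / eps) =
  lp_value eps n r.
Proof.
move=> eps0 nN; rewrite (two_point_sum n2 nN); last first.
  by move=> k k1 k2; rewrite extremal0// !mul0r.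
rewrite lp_valueE// -extremal_sqr_lo -extremal_sqr_hi.
by field; rewrite !gt_eqF.
Qed.

End Extremal.

(* A radius [(a n)^-1] has the two admissible brackets [n] and [n.+1]. *)
Lemma lp_value_bracket_lt (n m : nat) (r eps : R) : 0 < eps -> (n < m)%N ->
  bracket n r -> bracket m r -> lp_value eps n r = lp_value eps m r.
Proof.
move=> eps0 nm [n2 /andP[nr _]] [m2 /andP[_ rm]].
have n1 : (1 <= n)%N by exact: ltnW.
have n11 : (1 <= n.-1)%N by rewrite -ltnS prednK.
have an0 := a_gt0 n1.
have am0 : 0 < a m.-1 by rewrite a_gt0// -ltnS prednK// ltnW.
have mn : m = n.+1.
  apply/eqP; rewrite eqn_leq nm andbT leqNgt; apply/negP => nm2.
  have : a n < a m.-1 by apply: a_lt => //; rewrite -ltnS prednK// ltnW.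
  rewrite -ltf_pV2 ?posrE// => h.
  by have := le_lt_trans (le_trans nr rm) h; rewrite ltxx.
subst m; rewrite /= in rm.
have -> : r = (a n)^-1 by apply/le_anti; rewrite rm nr.
rewrite !lp_valueE// /mass_lo /mass_hi /=.
have g1 : 0 < a n ^+ 2 - a n.-1 ^+ 2.
  rewrite subr_gt0 ltr_pXn2r ?nnegrE ?(ltW (a_gt0 _))//.
  by apply: a_lt => //; rewrite ltn_predL.
have g2 : 0 < a n.+1 ^+ 2 - a n ^+ 2.
  by rewrite subr_gt0 ltr_pXn2r ?nnegrE ?(ltW (a_gt0 _))// a_ltS.
have sn := s_gt0 n1; have sn1 := s_gt0 n11; have sSn := s_gt0 (ltn0Sn n).
by field; rewrite !gt_eqF.
Qed.

Lemma lp_value_bracket (n m : nat) (r eps : R) : 0 < eps ->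
  bracket n r -> bracket m r -> lp_value eps n r = lp_value eps m r.
Proof.
move=> eps0 bn bm; have [nm|mn|->//] := ltngtP n m.
  exact: lp_value_bracket_lt.
by apply/esym; exact: lp_value_bracket_lt.
Qed.

(* In the variable [r ^+ 2] the value is affine on each bracket, so the radius is
   found as a convex combination of the end points. *)
Lemma lp_value_onto (eps v : R) : 0 < eps -> 0 < v ->
  eps ^+ 2 * v * p 1%N ^+ 2 < 1 ->
  exists m r, [/\ bracket m r, 0 < r < (a 1%N)^-1, lp_value eps m r = v &
    1 <= eps ^+ 2 * v * p m ^+ 2].
Proof.
move=> eps0 v0 vp.
pose A := (eps * Num.sqrt v)^-1.
have A0 : 0 < A by rewrite invr_gt0 mulr_gt0 ?sqrtr_gt0.
have A2 : A ^+ 2 = (eps ^+ 2 * v)^-1 by rewrite exprVn exprMn sqr_sqrtr// ltW.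
have y0 : 0 < eps ^+ 2 * v by rewrite mulr_gt0 ?exprn_gt0.
set y := eps ^+ 2 * v in vp A2 y0 *.
have pos x : 0 <= x -> (x <= A) = (x ^+ 2 * y <= 1).
  move=> x0; rewrite -[LHS](@ler_pXn2r _ 2)// ?nnegrE ?(ltW A0)// A2.
  by rewrite -[(y)^-1]mul1r ler_pdivlMr.
have p1A : p 1%N <= A by rewrite pos ?(ltW (p_gt0 _))// mulrC ltW.
have [m [m2 /andP[pm1 pm]]] := p_bracket_exists p1A.
have m1 : (1 <= m)%N by exact: ltnW.
have m11 : (1 <= m.-1)%N by rewrite -ltnS prednK.
have p0 := p_gt0 m1; have p10 := p_gt0 m11.
have pp : p m.-1 < p m by apply: p_lt => //; rewrite ltn_predL.
have a0 := a_gt0 m1; have a10 := a_gt0 m11.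
have aa : a m.-1 < a m by apply: a_lt => //; rewrite ltn_predL.
have s0 := s_gt0 m1; have s10 := s_gt0 m11.
rewrite pos ?(ltW p10)// in pm1.
have {}pm : 1 < p m ^+ 2 * y by rewrite ltNge -pos ?(ltW p0)// -ltNge.
pose q0 := p m ^+ 2; pose q1 := p m.-1 ^+ 2.
have q00 : 0 < q0 by rewrite exprn_gt0.
have q10 : 0 < q1 by rewrite exprn_gt0.
have qq : q1 < q0 by rewrite ltr_pXn2r// nnegrE ltW.
rewrite -/q0 -/q1 in pm pm1.
(* weights of the vertices [m.-1] and [m] in the value [y] *)
pose x1 := (q0 * y - 1) * q1 / (q0 - q1).
pose x0 := (1 - q1 * y) * q0 / (q0 - q1).
have qq0 : 0 < q0 - q1 by rewrite subr_gt0.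
have x10 : 0 < x1 by rewrite divr_gt0// mulr_gt0// subr_gt0.
have x00 : 0 <= x0 by rewrite divr_ge0 ?(ltW qq0)// mulr_ge0 ?(ltW q00)// subr_ge0.
have xs : x1 + x0 = 1 by rewrite /x1 /x0; field; rewrite gt_eqF.
have xy : x1 / q1 + x0 / q0 = y.
  by rewrite /x1 /x0; field; rewrite !gt_eqF.
(* Dividing the weights by [a ^+ 2] returns the two masses, whose sum is the squared radius. *)
pose r2 := x1 / a m.-1 ^+ 2 + x0 / a m ^+ 2.
have r20 : 0 < r2.
  have h1 : 0 < x1 / a m.-1 ^+ 2 by rewrite divr_gt0 ?exprn_gt0.
  have h2 : 0 <= x0 / a m ^+ 2 by rewrite divr_ge0 ?sqr_ge0.
  by rewrite /r2; move: h1 h2; lra.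
have aV : (a m ^+ 2)^-1 < (a m.-1 ^+ 2)^-1.
  by rewrite ltf_pV2 ?posrE ?exprn_gt0// ltr_pXn2r// nnegrE ltW.
have r2lo : (a m ^+ 2)^-1 <= r2.
  by rewrite -[leLHS]mul1r -xs mulrDl lerD2r ler_wpM2l ?(ltW x10) ?(ltW aV).
have r2hi : r2 <= (a m.-1 ^+ 2)^-1.
  by rewrite -[leRHS]mul1r -xs mulrDl lerD2l ler_wpM2l ?(ltW aV).
have r2E : Num.sqrt r2 ^+ 2 = r2 by rewrite sqr_sqrtr// ltW.
have br : bracket m (Num.sqrt r2).
  split => //; apply/andP; split.
    rewrite -(@ler_pXn2r _ 2)// ?nnegrE ?sqrtr_ge0 ?invr_ge0 ?(ltW a0)//.
    by rewrite r2E exprVn.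
  rewrite -(@ler_pXn2r _ 2)// ?nnegrE ?sqrtr_ge0 ?invr_ge0 ?(ltW a10)//.
  by rewrite r2E exprVn.
exists m, (Num.sqrt r2); split => //; last by rewrite mulrC ltW.
  rewrite sqrtr_gt0 r20/= -(@ltr_pXn2r _ 2)// ?nnegrE ?sqrtr_ge0 ?invr_ge0 ?(ltW a1)//.
  rewrite r2E exprVn.
  (* The strict upper bound on the radius is automatic for [m >= 3]; for [m = 2] the strict
     smallness hypothesis makes [x0] positive. *)
  have [m3|m3] := leqP 3 m.
    apply: (le_lt_trans r2hi); rewrite ltf_pV2 ?posrE ?exprn_gt0//.
    rewrite ltr_pXn2r ?nnegrE ?(ltW a1) ?(ltW a10)//.
    by apply: a_lt => //; rewrite -ltnS prednK.
  have m2E : m = 2%N by apply/eqP; rewrite eqn_leq -ltnS m3.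
  have x0p : 0 < x0.
    rewrite divr_gt0// mulr_gt0// subr_gt0 /q1 m2E/=.
    by rewrite mulrC.
  have -> : (a 1%N ^+ 2)^-1 = (a m.-1 ^+ 2)^-1 by rewrite m2E.
  by rewrite -[ltRHS]mul1r -xs mulrDl ltrD2l ltr_pM2l.
rewrite lp_valueE// /mass_lo /mass_hi r2E.
have -> : v = y / eps ^+ 2 by rewrite /y mulrC mulKf// gt_eqF// exprn_gt0.
congr (_ / _); rewrite -xy.
have g : 0 < a m ^+ 2 - a m.-1 ^+ 2.
  by rewrite subr_gt0 ltr_pXn2r// nnegrE ltW.
have x0E : x0 = 1 - x1 by rewrite -xs addrC addKr.
by rewrite /r2 x0E /q0 /q1 /product_seq; field; rewrite !gt_eqF.
Qed.

(** The bound [p n.-1 <= A] excludes [n > m]. If [n <= m - 2], then [p n] is at most [A / tau m.-2],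
    whereas [u <= C * U] keeps it at least [A] over sqrt C, against [C < tau m.-2 ^+ 2]. *)
Lemma bracket_index (n m : nat) (eps r U C A : R) : 0 < eps -> bracket n r ->
  0 < U -> U <= lp_value eps n r <= C * U -> 0 <= A ->
  A ^+ 2 = (eps ^+ 2 * U)^-1 -> (3 <= m)%N -> p m.-1 <= A < p m ->
  C < tau m.-2 ^+ 2 -> (m.-1 <= n <= m)%N.
Proof.
move=> eps0 [n2 br] U0 /andP[Uu uCU] A0 A2 m3 /andP[pA Ap] Ctau.
have n1 : (1 <= n)%N by exact: ltnW.
have n11 : (1 <= n.-1)%N by rewrite -ltnS prednK.
have [ulo uhi] := lp_value_bounds eps0 n2 br.
set u := lp_value _ _ _ in Uu uCU ulo uhi.
have u0 : 0 < u by exact: lt_le_trans Uu.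
have e0 : 0 < eps ^+ 2 by rewrite exprn_gt0.
have AU : A ^+ 2 * (eps ^+ 2 * U) = 1.
  by rewrite A2 mulVf// gt_eqF// mulr_gt0.
have pm0 : 0 < p m by apply: p_gt0; exact: leq_trans m3.
have m11 : (1 <= m.-1)%N by case: m m3 {pA Ap Ctau pm0} => [|[|]].
have m21 : (1 <= m.-2)%N by case: m m3 {pA Ap Ctau pm0 m11} => [|[|[|]]].
have mE : m.-2.+1 = m.-1 by case: m m3 {pA Ap Ctau pm0 m11 m21} => [|[|[|]]].
apply/andP; split; rewrite leqNgt; apply/negP => h.
  have pn : p n <= p m.-2 by apply: p_le => //; rewrite -ltnS mE.
  have pg := p_growth m21; rewrite mE in pg.
  have p20 := p_gt0 m21; have pn0 := p_gt0 n1.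
  have t0 : 0 < tau m.-2 by rewrite (lt_trans _ (tau1 m21)).
  have h1 : (tau m.-2 * p n) ^+ 2 <= A ^+ 2.
    have tp0 : 0 <= tau m.-2 * p n := mulr_ge0 (ltW t0) (ltW pn0).
    rewrite ler_pXn2r// ?nnegrE//.
    apply: le_trans pA; apply: le_trans pg; rewrite -mulrA.
    apply: (@le_trans _ _ (tau m.-2 * p m.-2)); first by rewrite ler_pM2l.
    by apply: ler_peMl; [exact: mulr_ge0 (ltW t0) (ltW p20)|exact: ltW].
  have h2 : (tau m.-2 * p n) ^+ 2 * (eps ^+ 2 * U) <= 1.
    by rewrite -AU ler_wpM2r// mulr_ge0 ?ltW.
  have h3 : 1 <= C * (p n ^+ 2 * (eps ^+ 2 * U)).
    apply: (le_trans ulo); rewrite (_ : C * _ = eps ^+ 2 * (C * U) * p n ^+ 2);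
      last by ring.
    by rewrite ler_wpM2r ?sqr_ge0// ler_wpM2l// ltW.
  have q0 : 0 < p n ^+ 2 * (eps ^+ 2 * U).
    by apply: mulr_gt0; [exact: exprn_gt0|exact: mulr_gt0].
  have := le_trans h2 h3; rewrite exprMn -mulrA ler_pM2r//.
  by rewrite leNgt Ctau.
have : p m <= p n.-1.
  have m1 : (1 <= m)%N by exact: leq_trans m3.
  by apply: (p_le m1); rewrite -ltnS prednK.
have h1 : p n.-1 ^+ 2 <= A ^+ 2.
  have h2 : eps ^+ 2 * U * p n.-1 ^+ 2 <= 1.
    by apply: le_trans uhi; rewrite ler_wpM2r ?sqr_ge0// ler_wpM2l// ltW.
  by rewrite A2 -[leRHS]mul1r ler_pdivlMr ?mulr_gt0// mulrC.
rewrite ler_pXn2r ?nnegrE ?(ltW (p_gt0 _))// in h1.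
by move=> h2; have := lt_le_trans Ap (le_trans h2 h1); rewrite ltxx.
Qed.

End LinearProgram.

(** * Limits at zero *)

Section Limits.
Context {R : realType}.

Lemma limf_esup_lt (F : set_system R) (f : R -> \bar R) (c : \bar R) :
  Filter F -> (limf_esup f F < c)%E -> \forall x \near F, (f x < c)%E.
Proof.
move=> FF; rewrite limf_esupE => /ereal_inf_lt[_ [V FV <-] Vc].
apply: filterS FV => x Vx; apply: le_lt_trans Vc.
by apply: ereal_sup_ubound; exists x.
Qed.

Lemma limf_einf_gt (F : set_system R) (f : R -> \bar R) (c : \bar R) :
  Filter F -> (c < limf_einf f F)%E -> \forall x \near F, (c < f x)%E.
Proof.
move=> FF; rewrite limf_einfE => /ereal_sup_gt[_ [V FV <-] Vc].
apply: filterS FV => x Vx; apply: lt_le_trans Vc _.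
by apply: ereal_inf_lbound; exists x.
Qed.

Lemma limf_esup_le (F : set_system R) (f : R -> \bar R) (c : \bar R) :
  Filter F -> (\forall x \near F, (f x <= c)%E) -> (limf_esup f F <= c)%E.
Proof.
move=> FF fc; rewrite limf_esupE.
apply: ge_ereal_inf; exists (ereal_sup (f @` [set x | (f x <= c)%E])).
  by exists [set x | (f x <= c)%E].
by apply: ge_ereal_sup => _ [x /= fx <-].
Qed.

Lemma limf_einf_ge (F : set_system R) (f : R -> \bar R) (c : \bar R) :
  Filter F -> (\forall x \near F, (c <= f x)%E) -> (c <= limf_einf f F)%E.
Proof.
move=> FF fc; rewrite limf_einfE.
apply: le_ereal_sup_tmp; exists (ereal_inf (f @` [set x | (c <= f x)%E])).
  by exists [set x | (c <= f x)%E].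
by apply: le_ereal_inf_tmp => _ [x /= fx <-].
Qed.

Lemma cvge_dist_le (f : R -> \bar R) (l : R) (F : set_system R) : Filter F ->
  (forall e, 0 < e -> \forall x \near F, ((l - e)%:E <= f x <= (l + e)%:E)%E) ->
  f x @[x --> F] --> l%:E.
Proof.
move=> FF fl.
have fin x e : ((l - e)%:E <= f x <= (l + e)%:E)%E -> f x \is a fin_num.
  move=> /andP[h1 h2]; rewrite fin_numE; apply/andP; split.
    by rewrite gt_eqF// (lt_le_trans _ h1)// ltNyr.
  by rewrite lt_eqF// (le_lt_trans h2)// ltry.
apply/fine_cvgP; split; first by apply: filterS (fl 1 ltr01) => x; exact: fin.
apply/cvgrPdist_le => e e0; apply: filterS (fl e e0) => x h.
have xf := fin _ _ h; move: h; rewrite -(fineK xf) !lee_fin /= => h.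
by rewrite distrC ler_distl.
Qed.

Local Notation w := (fun eps : R => loglog eps^-1).

Lemma near0_inv_ge (M : R) : \forall eps \near (0 : R)^'+, M <= eps^-1.
Proof.
near=> e.
have e0 : 0 < e by near: e; exact: nbhs_right_gt.
have eM : e < (`|M| + 1)^-1.
  by near: e; apply: nbhs_right_lt; rewrite invr_gt0 ltr_wpDl.
apply: (le_trans (ler_norm _)); apply: (@le_trans _ _ (`|M| + 1)).
  by rewrite lerDl.
have M0 : 0 < `|M| + 1 by rewrite ltr_wpDl.
by rewrite -[leLHS]invrK lef_pV2 ?posrE ?invr_gt0// ltW.
Unshelve. all: by end_near. Qed.

Lemma near0_ln_ge (M : R) : \forall eps \near (0 : R)^'+, M <= ln eps^-1.
Proof.
near=> e.
have h : expR M <= e^-1 by near: e; exact: near0_inv_ge.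
by rewrite -[M]expRK ler_ln ?posrE ?expR_gt0// (lt_le_trans (expR_gt0 M)).
Unshelve. all: by end_near. Qed.

Lemma near0_loglog_ge (M : R) : \forall eps \near (0 : R)^'+, M <= loglog eps^-1.
Proof.
near=> e.
have h : expR M <= ln e^-1 by near: e; exact: near0_ln_ge.
by rewrite -[M]expRK ler_ln ?posrE ?expR_gt0// (lt_le_trans (expR_gt0 M)).
Unshelve. all: by end_near. Qed.

Lemma cvg_loglog : loglog eps^-1 @[eps --> (0 : R)^'+] --> +oo%R.
Proof. by apply/cvgryPge => M; exact: near0_loglog_ge. Qed.

Lemma loglog_le_sqrt (x : R) : 1 < x -> loglog x <= 2 * Num.sqrt x.
Proof.
move=> x1; have x0 : 0 < x by rewrite (lt_trans _ x1).
have lx0 : 0 < ln x by rewrite ln_gt0.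
apply: (le_trans (ltW (ln_sublinear lx0))).
have s0 : 0 < Num.sqrt x by rewrite sqrtr_gt0.
rewrite -{1}[x](sqr_sqrtr (ltW x0)) lnXn// mulr2n.
by have := ln_sublinear s0; lra.
Qed.

Lemma near0_loglog_le (K : R) : 0 <= K ->
  \forall eps \near (0 : R)^'+, K * loglog eps^-1 <= eps^-1.
Proof.
move=> K0; near=> e.
have h2 : 2 <= e^-1 by near: e; exact: near0_inv_ge.
have hK : (2 * K) ^+ 2 <= e^-1 by near: e; exact: near0_inv_ge.
have x0 : 0 < e^-1 by rewrite (lt_le_trans _ h2).
have hs : 2 * K <= Num.sqrt e^-1.
  rewrite -(@ler_pXn2r _ 2)// ?nnegrE ?sqrtr_ge0 ?mulr_ge0//.
  by rewrite sqr_sqrtr// ltW.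
apply: (@le_trans _ _ (K * (2 * Num.sqrt e^-1))).
  by rewrite ler_wpM2l// loglog_le_sqrt// (lt_le_trans _ h2)// ltr1n.
rewrite mulrA [K * 2]mulrC -[leRHS](sqr_sqrtr (ltW x0)) expr2.
by rewrite ler_wpM2r ?sqrtr_ge0.
Unshelve. all: by end_near. Qed.

(** Passing from [A ^+ 2] to [A] costs at most 1 at the level of [loglog], and this is at most half
    of [loglog x] once that is at least 2. *)
Lemma loglog_sqrt_ge (x A : R) : 0 < A -> 1 < x -> x <= A ^+ 2 ->
  2 <= loglog x -> loglog x / 2 <= loglog A.
Proof.
move=> A0 x1 xA h2.
have x0 : 0 < x by rewrite (lt_trans _ x1).
have lx : 0 < ln x by rewrite ln_gt0.
have lA : ln x <= ln A *+ 2 by rewrite -lnXn// ler_ln ?posrE// exprn_gt0.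
have e1 : loglog x - 1 <= loglog A.
  have lA0 : 0 < ln A by move: lx lA; rewrite mulr2n; lra.
  have h : ln (ln x) <= ln (expR 1 * ln A).
    rewrite ler_ln ?posrE ?mulr_gt0 ?expR_gt0//.
    apply: (le_trans lA); rewrite -mulr_natl ler_wpM2r ?(ltW lA0)//.
    by have := @expR_ge1Dx R 1; lra.
  rewrite lnM ?posrE ?expR_gt0// expRK in h.
  by rewrite /loglog; move: h; lra.
by move: e1 h2; lra.
Qed.

End Limits.

(** * The second moment bound on the total error *)

Section Overlap.
Context {R : realType}.

Lemma count_near (S : seq nat) (i : nat) : uniq S ->
  (count (fun j => (i <= j + 2)%N && (j <= i + 2)%N) S <= 5)%N.
Proof.
move=> uS; rewrite -size_filter.
apply: (@leq_trans (size (iota (i - 2) 5))); last by rewrite size_iota.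
apply: uniq_leq_size; first exact: filter_uniq.
move=> j; rewrite mem_filter mem_iota => /andP[/andP[h1 h2] _].
by apply/andP; split; lia.
Qed.

(** Far pairs contribute exactly [expR 0 = 1], which gives the square; only the at most five
    neighbours in each row pay [expR u]. *)
Lemma overlap_sum_le (S : seq nat) (c : nat -> nat -> R) (u : R) : uniq S ->
  (forall i j, i \in S -> j \in S -> c i j <= u) ->
  (forall i j, ~~ ((i <= j + 2)%N && (j <= i + 2)%N) -> c i j = 0) ->
  \sum_(i <- S) \sum_(j <- S) expR (c i j) <=
  (size S)%:R ^+ 2 + 5 * expR u * (size S)%:R.
Proof.
move=> uS cu c0.
have row i : i \in S ->
    \sum_(j <- S) expR (c i j) <= (size S)%:R + 5 * expR u.
  move=> iS; apply: (@le_trans _ _ (\sum_(j <- S) (1 +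
      (if (i <= j + 2)%N && (j <= i + 2)%N then expR u else 0)))).
    rewrite big_seq [leRHS]big_seq; apply: ler_sum => j jS.
    case: ifPn => h; last by rewrite c0// expR0 addr0.
    by apply: ler_wpDl => //; rewrite ler_expR cu.
  rewrite big_split/= big_const_seq count_predT iter_addr_0 lerD2l.
  rewrite -big_mkcond/= big_const_seq iter_addr_0 -[leLHS]mulr_natl.
  by rewrite ler_wpM2r ?expR_ge0// ler_nat count_near.
apply: (@le_trans _ _ (\sum_(i <- S) ((size S)%:R + 5 * expR u))).
  by rewrite big_seq [leRHS]big_seq; apply: ler_sum => i /row.
by rewrite big_const_seq count_predT iter_addr_0 -[leLHS]mulr_natr mulrDl expr2.
Qed.

End Overlap.

Section LowerBound.
Context {R : realType} {d : measure_display} {T : measurableType d}.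
Variables (P : probability T R) (xi : nat -> {RV P >-> R}).
Hypothesis Hxi : iid_std_normal xi.

Lemma gamma_test_ge (eps : R) (psi : (nat -> R) -> R) (Theta : set (nat -> R))
    (S : seq nat) (eta : nat -> nat -> R) (N : nat) (u delta : R) :
  0 < eps -> 0 < delta -> is_test psi -> uniq S -> (0 < size S)%N ->
  (forall m, m \in S -> Theta (eta m)) ->
  (forall m k, m \in S -> eta m k != 0 -> [&& (1 <= k < N), m <= k + 2 & k <= m]%N) ->
  (forall m, m \in S -> \sum_(1 <= k < N) (eta m k / eps) * (eta m k / eps) <= u) ->
  ((1 - delta - 5 * expR u / (4 * delta * (size S)%:R))%:E <=
   gamma_test xi eps Theta psi)%E.
Proof.
move=> eps0 delta0 tpsi uS S0 ThS supp en.
have M0 : 0 < (size S)%:R :> R by rewrite ltr0n.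
(* Extension by zero makes the support property hold for all indices, as the overlap bound
   requires. *)
pose e m k := if m \in S then eta m k else 0.
have eE m : m \in S -> e m = eta m by move=> mS; rewrite /e mS.
have esupp m k : e m k != 0 -> [&& (1 <= k < N), m <= k + 2 & k <= m]%N.
  by rewrite /e; case: ifPn => [mS /supp|_]; [exact|rewrite eqxx].
pose c i j := \sum_(1 <= k < N) (e i k / eps) * (e j k / eps).
rewrite (_ : 1 - delta - _ = 1 - delta -
    5 * expR u * (size S)%:R / (4 * delta * (size S)%:R ^+ 2)); last first.
  by field; rewrite !gt_eqF.
apply: (second_moment_bound Hxi eps0 tpsi (S := S) (N := N) (eta := e)) => //.
- by move=> i k iS h; apply/eqP; apply: contraNT h => /esupp /and3P[].
- by move=> i iS; apply: ereal_sup_ubound; exists (e i) => //; rewrite eE//; exact: ThS.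
apply: overlap_sum_le => //.
- move=> i j iS jS.
  (* A product is at most half the sum of the two squares, and both energies are at most [u]. *)
  apply: (@le_trans _ _ (\sum_(1 <= k < N)
     ((e i k / eps) * (e i k / eps) / 2 + (e j k / eps) * (e j k / eps) / 2))).
    apply: ler_sum => k _; set x := _ / eps; set y := e j k / eps.
    have := sqr_ge0 (x - y); rewrite -subr_ge0 => h.
    by rewrite -subr_ge0 (_ : _ - _ = (x - y) ^+ 2 / 2);
      [rewrite divr_ge0// sqr_ge0|field].
  rewrite big_split/= -!mulr_suml !eE//.
  by have := en i iS; have := en j jS; lra.
- move=> i j; apply: contraNeq => cij.
  have [k _ /andP[]] : exists2 k, true & (e i k != 0) && (e j k != 0).
    apply: contrapT => h; move/eqP: cij; apply.
    rewrite big1// => k _.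
    have [->|ik] := eqVneq (e i k) 0; first by rewrite !mul0r.
    have [->|jk] := eqVneq (e j k) 0; first by rewrite mul0r mulr0.
    by exfalso; apply: h; exists k => //; rewrite ik.
  move=> /esupp /and3P[_ h1 h2] /esupp /and3P[_ h3 h4].
  by apply/andP; split; lia.
Qed.

(** Witnessed by the test that always rejects. *)
Lemma gamma_le1 (eps : R) (Theta : set (nat -> R)) :
  (gamma xi eps Theta <= 1)%E.
Proof.
apply: (@le_trans _ _ (gamma_test xi eps Theta (cst 1))).
  apply: ereal_inf_lbound; exists (cst 1) => //; split=> [y|B mB].
    by rewrite ler01 lexx.
  rewrite preimage_cst; case: ifPn => _.
    exact: (@measurableT _ (g_sigma_algebraType (@coordinate_events R))).
  exact: (@measurable0 _ (g_sigma_algebraType (@coordinate_events R))).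
rewrite /gamma_test (_ : expect _ _ _ _ = 1%E); last first.
  by rewrite /expect expectation_cst.
rewrite -[leRHS]adde0; apply: leeD => //.
apply: ge_ereal_sup => _ [eta _ <-].
by rewrite /expect/= subrr expectation_cst.
Qed.

End LowerBound.

(** * Uniformity over the parameter set *)

Section Family.
Context {R : realType} {d : measure_display} {Omega : measurableType d}.
Variables (P : probability Omega R) (xi : nat -> {RV P >-> R}).
Hypothesis Hxi : iid_std_normal xi.
Context {Sigma : Type}.
Variables (a sigma : Sigma -> nat -> R) (B0 c0 : R) (tau : nat -> R).
Hypothesis kappa0 : Sigma.
Hypothesis G : forall kappa, growing (a kappa) (sigma kappa) tau c0.
Hypothesis first_le : forall kappa, product_seq (a kappa) (sigma kappa) 1%N <= B0.
Hypothesis tau_incr : increasing1 tau.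
Hypothesis tau_infty : tau k @[k --> \oo] --> +oo%R.
Variable n : Sigma -> R -> nat.
Hypothesis Hn : bracketing a n.

Local Notation u eps kappa r := (u_lin a sigma n eps kappa r).
Local Notation p kappa := (product_seq (a kappa) (sigma kappa)).

(** From [B0] on the bracket exists for all parameters at once, so the default value of [xget] never
    occurs. *)
Lemma m_indexP (A : R) (kappa : Sigma) : B0 <= A ->
  (2 <= m_index a sigma A kappa)%N /\
  p kappa (m_index a sigma A kappa).-1 <= A < p kappa (m_index a sigma A kappa).
Proof.
move=> BA; have h := p_bracket_exists (G kappa) (le_trans (first_le kappa) BA).
exact: (xgetPex 0%N h).
Qed.

Lemma u_lin_gt0 (eps r : R) kappa : 0 < eps -> 0 < r < (a kappa 1%N)^-1 ->
  0 < u eps kappa r.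
Proof. by move=> eps0 /Hn[n2 br]; exact: (lp_value_gt0 (G kappa) eps0 n2 br). Qed.

Lemma Theta_ball_nonempty (r : R) kappa : 0 < r < (a kappa 1%N)^-1 ->
  Theta_ball a sigma kappa r (extremal (a kappa) (sigma kappa) (n kappa r) r).
Proof.
move=> /Hn[n2 br]; split.
- exact: extremal_l2.
- exact: (extremal_ellipsoid (G kappa) n2 br).
- exact: (extremal_separated (G kappa) n2 br).
Qed.

(** Over an empty alternative the supremum is [-oo], hence the nonemptiness condition. *)
Lemma gamma_test_ge0 (eps : R) (Theta : set (nat -> R)) psi :
  is_test psi -> Theta !=set0 -> (0 <= gamma_test xi eps Theta psi)%E.
Proof.
move=> [psi01 _] [eta Teta]; apply: adde_ge0.
  rewrite /expect unlock; apply: integral_ge0 => w _; rewrite lee_fin.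
  by case/andP: (psi01 (observation xi eps (fun=> 0) w)).
apply: (@le_trans _ _ (expect xi eps eta (fun y => 1 - psi y))).
  rewrite /expect unlock; apply: integral_ge0 => w _; rewrite lee_fin subr_ge0.
  by case/andP: (psi01 (observation xi eps eta w)).
by apply: ereal_sup_ubound; exists eta.
Qed.

Lemma u_inf_le eps (r : Sigma -> R) kappa :
  (u_inf a sigma n eps r <= (u eps kappa (r kappa))%:E)%E.
Proof. by apply: ereal_inf_lbound; exists kappa. Qed.

Lemma u_sup_ge eps (r : Sigma -> R) kappa :
  ((u eps kappa (r kappa))%:E <= u_sup a sigma n eps r)%E.
Proof. by apply: ereal_sup_ubound; exists kappa. Qed.

Lemma comparable_indices (eps C U A : R) (r : Sigma -> R) (K0 : nat) :
  0 < eps -> 0 < U -> (1 <= K0)%N -> (forall k, (K0 <= k)%N -> C < tau k ^+ 2) ->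
  0 <= A -> A ^+ 2 = (eps ^+ 2 * U)^-1 -> B0 <= A ->
  (forall kappa, 0 < r kappa < (a kappa 1%N)^-1) ->
  (forall kappa, U <= u eps kappa (r kappa) <= C * U) ->
  forall kappa, (K0 + 2 <= m_index a sigma A kappa)%N ->
    ((m_index a sigma A kappa).-1 <= n kappa (r kappa) <= m_index a sigma A kappa)%N.
Proof.
move=> eps0 U0 K1 Ktau A0 A2 BA rr uU kappa Km.
have [m2 pm] := m_indexP kappa BA.
apply: (bracket_index (G kappa) eps0 (Hn (rr kappa)) U0 (uU kappa) A0 A2) => //.
- by rewrite (leq_trans _ Km)// addn2 !ltnS.
- by apply: Ktau; move: Km; lia.
Qed.

(** Origin of [b / 8]: one factor 2 is given up in the liminf and one in passing from
    [loglog eps^-1] to [loglog A], so [ln M] exceeds [b / 4 * loglog eps^-1]; at half that exponent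
    [expR u / M] vanishes. *)
Lemma gamma_cvg1 (b : R) : 0 < b -> M_growth a sigma b ->
  forall r : R -> Sigma -> R, radii a r ->
    (exists2 C : R, 1 <= C & comparable_radii a sigma n C r) ->
    (\forall eps \near (0 : R)^'+,
      forall kappa, u eps kappa (r eps kappa) <= b / 8 * loglog eps^-1) ->
    gamma xi eps (Theta_union a sigma (r eps)) @[eps --> (0 : R)^'+] --> 1%E.
Proof.
move=> b0 Mb r [rrn _] [C C1 rCn] ubn.
apply: cvge_dist_le => e e0.
have [K0 K1 Ktau] : exists2 K0, (1 <= K0)%N & forall k, (K0 <= k)%N -> C < tau k ^+ 2.
  have := proj1 (cvgryPgt _) tau_infty C => -[K _ HK].
  exists K.+1 => // k Kk.
  have tk : C < tau k by apply: HK; exact: ltnW.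
  have t1 : 1 <= tau k by exact: le_trans C1 (ltW tk).
  by apply: (lt_le_trans tk); rewrite expr2 ler_peMl// (le_trans ler01).
have [A1 A1M] : exists A1, forall A, A1 < A ->
    b / 2 < ln ((M_card a sigma A)%:R : R) / loglog A.
  have : ((b / 2)%:E < limf_einf (fun A : R =>
      (ln ((M_card a sigma A)%:R : R) / loglog A)%:E) +oo%R)%E.
    by rewrite Mb lte_fin; lra.
  move=> /limf_einf_gt[A1 [_ HA]]; exists A1 => A /HA.
  by rewrite lte_fin.
pose delta := e / 2.
have d0 : 0 < delta by rewrite divr_gt0.
near=> eps.
have eps0 : 0 < eps by near: eps; exact: nbhs_right_gt.
have w2 : 2 <= loglog eps^-1 by near: eps; exact: near0_loglog_ge.
have w0 : 0 < loglog eps^-1 by rewrite (lt_le_trans _ w2).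
have bw : b / 8 * loglog eps^-1 <= eps^-1.
  by near: eps; apply: near0_loglog_le; rewrite divr_ge0// ltW.
have eA1 : (`|A1| + `|B0| + 2) ^+ 2 <= eps^-1 by near: eps; exact: near0_inv_ge.
have ub : forall kappa, u eps kappa (r eps kappa) <= b / 8 * loglog eps^-1.
  by near: eps; exact: ubn.
have rr : forall kappa, 0 < r eps kappa < (a kappa 1%N)^-1.
  by near: eps; exact: rrn.
have rC : (u_sup a sigma n eps (r eps) <= C%:E * u_inf a sigma n eps (r eps))%E.
  by near: eps; exact: rCn.
have big1 : 4 / b * ln (2 * (K0 + 2)%:R) <= loglog eps^-1.
  by near: eps; exact: near0_loglog_ge.
have big2 : 8 / b * ln (5 / delta ^+ 2 ) <= loglog eps^-1.
  by near: eps; exact: near0_loglog_ge.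
apply/andP; split; last first.
  by apply: (le_trans (gamma_le1 _ _ _)); rewrite lee_fin lerDl ltW.
set w := loglog eps^-1 in w2 w0 bw ub big1 big2 *.
have x0 : 0 < eps^-1 by rewrite invr_gt0.
have [U U0 uU] : exists2 U, 0 < U &
    forall kappa, U <= u eps kappa (r eps kappa) <= C * U.
  have inf0 : (0 <= u_inf a sigma n eps (r eps))%E.
    apply: le_ereal_inf_tmp => _ [kappa _ <-].
    by rewrite lee_fin ltW// u_lin_gt0.
  have inff : u_inf a sigma n eps (r eps) \is a fin_num.
    by rewrite ge0_fin_numE// (le_lt_trans (u_inf_le _ _ kappa0))// ltry.
  exists (fine (u_inf a sigma n eps (r eps))); last first.
    move=> kappa; apply/andP; split; first by rewrite -lee_fin fineK//; exact: u_inf_le.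
    by rewrite -lee_fin [leRHS]EFinM fineK// (le_trans (u_sup_ge _ _ kappa)).
  (* An infimum of positive values could be 0; comparison with the positive supremum excludes it. *)
  have : (0 < C%:E * u_inf a sigma n eps (r eps))%E.
    apply: lt_le_trans rC; apply: lt_le_trans (u_sup_ge _ _ kappa0).
    by rewrite lte_fin u_lin_gt0.
  by rewrite -(fineK inff) -EFinM lte_fin pmulr_rgt0// (lt_le_trans _ C1).
pose A := (eps * Num.sqrt U)^-1.
have A0 : 0 < A by rewrite invr_gt0 mulr_gt0// sqrtr_gt0.
have A2 : A ^+ 2 = (eps ^+ 2 * U)^-1 by rewrite exprVn exprMn sqr_sqrtr// ltW.
(* Because [U <= eps^-1], growth of [M_card] at the level [A] translates into growth in terms of
   [eps^-1]. *)
have xA : eps^-1 <= A ^+ 2.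
  rewrite A2 lef_pV2 ?posrE ?mulr_gt0 ?exprn_gt0// expr2 -mulrA ler_piMr ?(ltW eps0)//.
  rewrite -(divff (lt0r_neq0 eps0)) ler_pM2l//.
  have /andP[Uu _] := uU kappa0.
  by rewrite (le_trans Uu)// (le_trans (ub kappa0)).
have AA : `|A1| + `|B0| + 2 <= A.
  rewrite -(@ler_pXn2r _ 2)// ?nnegrE ?(ltW A0) ?addr_ge0//.
  exact: (le_trans eA1).
have AA1 : A1 < A.
  by apply: lt_le_trans AA; have := ler_norm A1; have := normr_ge0 B0; lra.
have AB : B0 <= A.
  by apply: le_trans AA; have := ler_norm B0; have := normr_ge0 A1; lra.
have x1 : 1 < eps^-1.
  apply: lt_le_trans eA1; rewrite expr2.
  by have := normr_ge0 B0; have := normr_ge0 A1; nra.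
have wA : w / 2 <= loglog A by exact: loglog_sqrt_ge x1 xA w2.
pose M : R := (M_card a sigma A)%:R.
have lnM : b / 4 * w < ln M.
  have := A1M A AA1; rewrite ltr_pdivlMr; last by apply: lt_le_trans wA; lra.
  by apply: le_lt_trans; have := wA; nra.
have Mexp : expR (b / 4 * w) <= M.
  (* [ln] is 0 at nonpositive arguments, so the lower bound on [ln M] forces [M > 0]. *)
  have M0 : 0 < M.
    rewrite ltNge; apply/negP => M0; move: lnM; rewrite (ln0 M0) ltNge.
    by rewrite mulr_ge0 ?divr_ge0// ltW.
  by rewrite -[leRHS]lnK ?posrE// ler_expR ltW.
pose I := fset_set (range (m_index a sigma A)).
(* An infinite index set would be counted as empty by [fset_set], giving [M = 0]. *)
have finI : finite_set (range (m_index a sigma A)).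
  apply: contrapT => infI; have : 0 < M.
    by rewrite (lt_le_trans _ Mexp)// expR_gt0.
  by rewrite /M /M_card /fset_set; case: pselect => // _; rewrite cardfs0 ltxx.
have IE m : (m \in I) = (m \in range (m_index a sigma A)) by rewrite in_fset_set.
(* At most [K0 + 2] indices are discarded; for the others [tau m.-2 ^+ 2] exceeds [C]. *)
pose S := [seq m <- enum_fset I | (K0 + 2 <= m)%N].
have uS : uniq S by rewrite filter_uniq// fset_uniq.
have sizeS : M - (K0 + 2)%:R <= (size S)%:R.
  rewrite lerBlDr /M /M_card -/I -natrD ler_nat.
  rewrite -(count_predC (fun m => K0 + 2 <= m)%N (enum_fset I)) -!size_filter.
  rewrite leq_add2l -[leqRHS](size_iota 0); apply: uniq_leq_size.
    by rewrite filter_uniq// fset_uniq.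
  by move=> m; rewrite mem_filter mem_iota /= -ltnNge => /andP[].
have [g gE] : exists g : nat -> Sigma, forall m, m \in S ->
    m_index a sigma A (g m) = m.
  have : forall m, exists kappa, m \in S -> m_index a sigma A kappa = m.
    move=> m; have [mS|_] := boolP (m \in S); last by exists kappa0.
    move: mS; rewrite mem_filter => /andP[_ mI].
    have : m \in I by [].
    by rewrite IE inE => -[kappa _ <-]; exists kappa.
  by move=> /choice[g gE]; exists g.
pose N := (\max_(m <- S) m).+1.
pose eta m := extremal (a (g m)) (sigma (g m)) (n (g m) (r eps (g m))) (r eps (g m)).
have SN m : m \in S -> (m < N)%N.
  by move=> mS; rewrite /N ltnS; exact: leq_bigmax_seq.
have nm m : m \in S -> (m.-1 <= n (g m) (r eps (g m)) <= m)%N.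
  move=> mS; have := comparable_indices eps0 U0 K1 Ktau (ltW A0) A2 AB rr uU.
  move=> /(_ (g m)); rewrite gE//; apply.
  by move: mS; rewrite mem_filter => /andP[].
have Shalf : expR (b / 4 * w) / 2 <= (size S)%:R.
  apply: le_trans sizeS; apply: (@le_trans _ _ (expR (b / 4 * w) - (K0 + 2)%:R)).
    have K20 : 0 < 2 * (K0 + 2)%:R :> R by rewrite mulr_gt0// ltr0n addn2.
    have : 2 * (K0 + 2)%:R <= expR (b / 4 * w).
      rewrite -[leLHS]lnK ?posrE// ler_expR.
      by move: big1; rewrite -invf_div ler_pdivrMl// divr_gt0.
    by lra.
  by rewrite lerB.
have S0 : (0 < size S)%N.
  by rewrite -(@ltr_nat R) (lt_le_trans _ Shalf)// divr_gt0// expR_gt0.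
(* With [E = expR (b / 8 * w)] the size of [S] is at least [E ^+ 2 / 2], so the last term is of
   order [1 / (delta * E)]. *)
apply: (@le_trans _ _ (1 - delta - 5 * expR (b / 8 * w) / (4 * delta * (size S)%:R))%:E).
  have E8 : expR (b / 4 * w) = expR (b / 8 * w) * expR (b / 8 * w).
    by rewrite -expRD; congr expR; field.
  have E0 := expR_gt0 (b / 8 * w); rewrite E8 in Shalf.
  have Ebig : 5 / delta ^+ 2 <= expR (b / 8 * w).
    rewrite -[leLHS]lnK ?posrE ?divr_gt0 ?exprn_gt0// ler_expR.
    by move: big2; rewrite -invf_div ler_pdivrMl// divr_gt0.
  rewrite lee_fin (_ : 1 - e = 1 - delta - delta); last by rewrite /delta; field.
  rewrite lerD2l lerN2 ler_pdivrMr ?mulr_gt0 ?ltr0n//.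
  move: Ebig Shalf E0; rewrite ler_pdivrMr ?exprn_gt0//.
  set E := expR _; set Z := (size S)%:R => Ebig Shalf E0.
  have h : 5 * E <= E * delta ^+ 2 * E by rewrite ler_pM2r.
  have h2 : delta ^+ 2 * (E * E / 2) <= delta ^+ 2 * Z by rewrite ler_wpM2l// sqr_ge0.
  have := sqr_ge0 delta; move: h h2; rewrite (_ : delta * _ = 4 * (delta ^+ 2 * Z)); last by ring.
  by nra.
apply: le_ereal_inf_tmp => _ [psi tpsi <-].
apply: (gamma_test_ge Hxi (eta := eta) (N := N) eps0 d0 tpsi uS S0).
- by move=> m mS; exists (g m) => //; exact: Theta_ball_nonempty.
- move=> m k mS; have [n2 _] := Hn (rr (g m)).
  rewrite /eta; apply: extremal_support => //; [exact: nm|exact: SN].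
- move=> m mS; have [n2 br] := Hn (rr (g m)).
  rewrite (extremal_energy (G (g m)) n2 br eps0); first exact: ub.
  by have /andP[_ nmS] := nm m mS; exact: leq_ltn_trans nmS (SN m mS).
Unshelve. all: by end_near. Qed.

(** Origin of 32: with [w = loglog eps^-1], the bound [2 * w] on the logarithm of the bracket index
    bounds the squared threshold by [8 * w], and detection at twice the threshold costs another
    factor 4. [D] is the constant of [large_coordinate]. *)
Lemma gamma_test_cvg0 : L_growth a sigma ->
  forall Teps : R -> R, Teps eps @[eps --> (0 : R)^'+] --> +oo%R ->
  Teps eps / Num.sqrt (loglog eps^-1) @[eps --> (0 : R)^'+] --> (0 : R) ->
  exists2 Du : R, 0 < Du &
    forall r : R -> Sigma -> R, radii a r ->
      (\forall eps \near (0 : R)^'+,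
         forall kappa, Du * loglog eps^-1 < u eps kappa (r eps kappa)) ->
      gamma_test xi eps (Theta_union a sigma (r eps))
        (psi_threshold Teps eps) @[eps --> (0 : R)^'+] --> 0%E.
Proof.
move=> LG Teps Tinf Tsmall.
pose D := 2 / (1 - tau 1%N ^- 2) / (1 - c0^-1).
have [a1 s1 c01 tau1 _] := G kappa0.
have D0 : 0 < D.
  have t1 := tau1 _ (leqnn 1).
  have tau0 : 0 < tau 1%N by exact: lt_trans ltr01 t1.
  have c00 : 0 < c0 by exact: lt_trans ltr01 c01.
  apply: divr_gt0; first apply: divr_gt0 => //.
    by rewrite subr_gt0 invf_lt1 ?exprn_gt0// exprn_egt1.
  by rewrite subr_gt0 invf_lt1.
have D32 : 0 < 32 * D by apply: mulr_gt0.
exists (32 * D) => //.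
move=> r [rrn _] un.
have Ln : \forall A \near +oo%R, (L_sup a sigma A * ((loglog A)^-1)%:E < 2%:E)%E.
  by apply: limf_esup_lt; apply: le_lt_trans LG _; rewrite lte_fin ltr1n.
have [A1 [_ A1L]] := Ln.
have Tn : \forall eps \near (0 : R)^'+, Teps eps / Num.sqrt (loglog eps^-1) < 1.
  have /cvgrPdist_lt/(_ 1 ltr01) := Tsmall; apply: filterS => eps.
  by rewrite sub0r normrN; apply: le_lt_trans; rewrite ler_norm.
apply: cvge_dist_le => e e0.
(* [K] is fixed before [eps], so that the contribution [K / Teps eps] of the early coordinates still
   vanishes. *)
have [K K4 Ke] : exists2 K : nat, (4 <= K)%N & 2 / Num.sqrt (ln (K.-1%:R : R)) <= e / 2.
  by apply: small_tail_exists; rewrite divr_gt0.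
near=> eps.
have eps0 : 0 < eps by near: eps; exact: nbhs_right_gt.
have w1 : 1 <= loglog eps^-1 by near: eps; exact: near0_loglog_ge.
have w0 : 0 < loglog eps^-1 by rewrite (lt_le_trans _ w1).
have wD : (32 * D)^-1 <= loglog eps^-1 by near: eps; exact: near0_loglog_ge.
have eA1 : `|A1| + `|B0| + 1 <= eps^-1 by near: eps; exact: near0_inv_ge.
have ub : forall kappa, 32 * D * loglog eps^-1 < u eps kappa (r eps kappa).
  by near: eps; exact: un.
have rr : forall kappa, 0 < r eps kappa < (a kappa 1%N)^-1.
  by near: eps; exact: rrn.
have T1 : 1 <= Teps eps by near: eps; apply: (proj1 (cvgryPge _) Tinf).
have Tbig : (K%:R + 1) / (e / 2) <= Teps eps.
  by near: eps; apply: (proj1 (cvgryPge _) Tinf).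
have Tw : Teps eps / Num.sqrt (loglog eps^-1) < 1 by near: eps; exact: Tn.
have T0 : 0 < Teps eps by rewrite (lt_le_trans _ T1).
set w := loglog eps^-1 in w1 w0 wD ub Tw.
have Tw2 : Teps eps ^+ 2 <= w.
  rewrite -[leRHS](sqr_sqrtr (ltW w0)) ler_pXn2r ?nnegrE ?sqrtr_ge0 ?(ltW T0)//.
  by rewrite -[leRHS]mul1r -ler_pdivrMr ?sqrtr_gt0// ltW.
have A1e : A1 < eps^-1.
  by apply: lt_le_trans eA1; have := ler_norm A1; have := normr_ge0 B0; lra.
have B0e : B0 <= eps^-1.
  by apply: le_trans eA1; have := ler_norm B0; have := normr_ge0 A1; lra.
have Lw kappa : ln ((m_index a sigma eps^-1 kappa)%:R : R) <= 2 * w.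
  have := A1L _ A1e; rewrite -/w lte_pdivrMr//.
  rewrite -lee_fin => h; apply: le_trans (ltW h).
  by apply: ereal_sup_ubound; exists kappa.
have tpsi := is_test_psi_threshold Teps eps.
have ne : Theta_union a sigma (r eps) !=set0.
  by eexists; exists kappa0 => //; exact: Theta_ball_nonempty.
apply/andP; split.
  apply: (@le_trans _ _ 0%E); first by rewrite lee_fin sub0r lerNl oppr0 ltW.
  exact: gamma_test_ge0.
have miss eta : Theta_union a sigma (r eps) eta ->
    (expect xi eps eta (fun y => 1 - psi_threshold Teps eps y)%R <=
      ((Teps eps)^-1)%:E)%E.
  move=> [kappa _ [_ h1 h2]].
  have br := Hn (rr kappa); set nn := n _ _ in br; have [n2 brr] := br.
  have u1 : 1 <= u eps kappa (r eps kappa).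
    apply: le_trans (ltW (ub kappa)).
    by move: wD; rewrite -[_^-1]mul1r ler_pdivrMr// mulrC.
  (* Otherwise [p kappa nn.-1] exceeds [eps^-1], which together with [u >= 1] violates the upper
     half of [lp_value_bounds]. *)
  have nm : (nn <= m_index a sigma eps^-1 kappa)%N.
    have [m2 /andP[_ em]] := m_indexP kappa B0e.
    rewrite leqNgt; apply/negP => mn.
    have [_ uhi] := lp_value_bounds (G kappa) eps0 n2 brr.
    have : p kappa (m_index a sigma eps^-1 kappa) <= p kappa nn.-1.
      by apply: (p_le (G kappa)); [exact: ltnW|rewrite -ltnS prednK// (leq_trans _ mn)].
    move=> /(lt_le_trans em) hlt.
    have hlt2 : 1 < eps ^+ 2 * p kappa nn.-1 ^+ 2.
      have : 1 < eps * p kappa nn.-1 by rewrite -ltr_pdivrMl// mulr1.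
      by rewrite -exprMn => h; rewrite exprn_egt1.
    move: uhi; apply/negP; rewrite -ltNge; apply: (lt_le_trans hlt2).
    rewrite [leRHS]mulrAC ler_peMr//.
    by apply: mulr_ge0; exact: sqr_ge0.
  have ths : threshold Teps eps nn ^+ 2 <= 8 * w.
    apply: threshold_sqr_le => //; first exact: ltW.
      by move: Tw2 w0; lra.
    have : ln (nn%:R : R) <= ln (m_index a sigma eps^-1 kappa)%:R.
      have nn0 : (0 < nn)%N by exact: ltnW.
      by rewrite ler_ln ?posrE ?ltr0n ?(leq_trans nn0)// ler_nat.
    by have := Lw kappa; lra.
  have th0 : 0 < threshold Teps eps nn by exact: lt_le_trans (threshold_ge _ _ _).
  have := large_coordinate (G kappa) h1 h2 _ eps0 (t := 2 * threshold Teps eps nn) _ br _.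
  case.
  - by move=> k k1; apply: tau_incr; rewrite k1.
  - by rewrite mulr_gt0.
  - apply: le_lt_trans (ub kappa); rewrite -/D exprMn.
    by have := ler_wpM2l (ltW D0) ths; lra.
  move=> k [kn ek]; apply: (missed_detection_threshold Hxi (k := k)) => //.
    by case/andP: kn.
  apply: le_lt_trans ek; rewrite mulrA [eps * 2]mulrC ler_wpM2l ?threshold_le// mulr_ge0 // ltW.
apply: (@le_trans _ _ ((K%:R / Teps eps + 2 / Num.sqrt (ln K.-1%:R))%:E + ((Teps eps)^-1)%:E)%E).
  apply: leeD; first exact: (false_alarm_threshold Hxi).
  by apply: ge_ereal_sup => _ [eta Te <-]; exact: miss.
rewrite -EFinD lee_fin add0r.
have : (K%:R + 1) / Teps eps <= e / 2.
  by rewrite ler_pdivrMr// mulrC -ler_pdivrMr ?divr_gt0.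
by rewrite mulrDl div1r; move: Ke; lra.
Unshelve. all: by end_near. Qed.

(** The last clause is what makes the radii tend to 0: as [eps ^+ 2 * v] shrinks, the bracket passes
    any given [K]. *)
Lemma u_lin_onto (eps v : R) kappa : 0 < eps -> 0 < v ->
  eps ^+ 2 * v * B0 ^+ 2 < 1 ->
  exists rho, [/\ 0 < rho < (a kappa 1%N)^-1, u eps kappa rho = v &
    forall K, (1 <= K)%N -> eps ^+ 2 * v * p kappa K.+1 ^+ 2 < 1 ->
      rho <= (a kappa K)^-1].
Proof.
move=> eps0 v0 small.
have y0 : 0 < eps ^+ 2 * v by rewrite mulr_gt0 ?exprn_gt0.
have [m [rho [bm rho1 rv pm]]] :
    exists m rho, [/\ bracket (a kappa) m rho, 0 < rho < (a kappa 1%N)^-1,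
      lp_value (a kappa) (sigma kappa) eps m rho = v &
      1 <= eps ^+ 2 * v * p kappa m ^+ 2].
  apply: (lp_value_onto (G kappa)) => //; apply: le_lt_trans small.
  rewrite ler_wpM2l ?(ltW y0)// ler_pXn2r// ?nnegrE ?first_le//.
    exact: (ltW (p_gt0 (G kappa) (leqnn 1))).
  exact: le_trans (ltW (p_gt0 (G kappa) (leqnn 1))) (first_le kappa).
exists rho; split=> //.
  rewrite -[RHS]rv; apply: (lp_value_bracket (G kappa) eps0) => //.
  exact: Hn.
move=> K K1 pK; have [m2 /andP[_ rm]] := bm.
apply: (le_trans rm).
have pKm : p kappa K.+1 < p kappa m.
  have := lt_le_trans pK pm; rewrite ltr_pM2l// ltr_pXn2r// nnegrE ltW// (p_gt0 (G kappa))//.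
  exact: ltnW.
have Km : (K.+1 < m)%N.
  rewrite ltnNge; apply/negP => mK; move: pKm; apply/negP; rewrite -leNgt.
  by apply: (p_le (G kappa)) => //; exact: ltnW.
rewrite lef_pV2 ?posrE ?(a_gt0 (G kappa))//; last by rewrite -ltnS prednK// ltnW.
by apply: (a_le (G kappa)) => //; rewrite -ltnS prednK// ltnW.
Qed.

(** [rs] is chosen before [v]: the radii at [eps] depend only on the number [v eps], so two value
    functions that agree at some [eps] produce the same alternative there. The cap [eps^-1] forces
    [eps ^+ 2 * v eps] to 0. *)
Lemma radii_solution : exists rs : R -> R -> Sigma -> R,
  forall v : R -> R, (\forall eps \near (0 : R)^'+, 0 < v eps <= eps^-1) ->
    radii a (fun eps => rs eps (v eps)) /\
    \forall eps \near (0 : R)^'+, forall kappa,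
      u eps kappa (rs eps (v eps) kappa) = v eps.
Proof.
have : forall x : R * R * Sigma, exists rho, let: (eps, v, kappa) := x in
    0 < eps -> 0 < v -> eps ^+ 2 * v * B0 ^+ 2 < 1 ->
    [/\ 0 < rho < (a kappa 1%N)^-1, u eps kappa rho = v &
    forall K, (1 <= K)%N -> eps ^+ 2 * v * p kappa K.+1 ^+ 2 < 1 ->
      rho <= (a kappa K)^-1].
  move=> [[eps v] kappa].
  have [[eps0 v0 sm]|h] := pselect [/\ 0 < eps, 0 < v & eps ^+ 2 * v * B0 ^+ 2 < 1].
    by have [rho ?] := u_lin_onto kappa eps0 v0 sm; exists rho.
  by exists 0 => eps0 v0 sm; exfalso; apply: h.
move=> /choice[f fP]; exists (fun eps v kappa => f (eps, v, kappa)) => v vn.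
have small C : \forall eps \near (0 : R)^'+, eps ^+ 2 * v eps * C ^+ 2 < 1.
  near=> eps.
  have eps0 : 0 < eps by near: eps; exact: nbhs_right_gt.
  have /andP[v0 ve] : 0 < v eps <= eps^-1 by near: eps; exact: vn.
  have Ce : C ^+ 2 + 1 <= eps^-1 by near: eps; exact: near0_inv_ge.
  apply: (@le_lt_trans _ _ (eps * C ^+ 2)).
    rewrite ler_wpM2r ?sqr_ge0// expr2 -mulrA ler_piMr ?(ltW eps0)//.
    by rewrite -(divff (lt0r_neq0 eps0)) ler_pM2l.
  rewrite -(divff (lt0r_neq0 eps0)) ltr_pM2l//.
  by apply: lt_le_trans Ce; rewrite ltrDl.
have main : \forall eps \near (0 : R)^'+, forall kappa,
    [/\ 0 < f (eps, v eps, kappa) < (a kappa 1%N)^-1,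
      u eps kappa (f (eps, v eps, kappa)) = v eps &
    forall K, (1 <= K)%N -> eps ^+ 2 * v eps * p kappa K.+1 ^+ 2 < 1 ->
      f (eps, v eps, kappa) <= (a kappa K)^-1].
  near=> eps => kappa; apply: (fP (eps, v eps, kappa)).
  - by near: eps; exact: nbhs_right_gt.
  - by have /andP[] : 0 < v eps <= eps^-1 by near: eps; exact: vn.
  - by near: eps; exact: small.
split; last by apply: filterS main => eps h kappa; have [] := h kappa.
split; first by apply: filterS main => eps h kappa; have [] := h kappa.
move=> kappa; apply/cvgrPdist_lt => e e0.
have [K K1 aK] := a_unbounded (G kappa) e^-1.
near=> eps.
have h : forall kappa, [/\ 0 < f (eps, v eps, kappa) < (a kappa 1%N)^-1,
      u eps kappa (f (eps, v eps, kappa)) = v eps &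
    forall K, (1 <= K)%N -> eps ^+ 2 * v eps * p kappa K.+1 ^+ 2 < 1 ->
      f (eps, v eps, kappa) <= (a kappa K)^-1] by near: eps; exact: main.
have sK : eps ^+ 2 * v eps * p kappa K.+1 ^+ 2 < 1 by near: eps; exact: small.
have [/andP[f0 _] _ /(_ K K1 sK) fK] := h kappa.
rewrite sub0r normrN gtr0_norm//; apply: (le_lt_trans fK).
by rewrite -[ltRHS]invrK ltf_pV2 ?posrE ?invr_gt0// (a_gt0 (G kappa)).
Unshelve. all: by end_near. Qed.

Lemma constant_comparable (v : R -> R) (r : R -> Sigma -> R) :
  (\forall eps \near (0 : R)^'+, forall kappa, u eps kappa (r eps kappa) = v eps) ->
  comparable_radii a sigma n 1 r.
Proof.
apply: filterS => eps h; rewrite mul1e.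
apply: (@le_trans _ _ (v eps)%:E).
  by apply: ge_ereal_sup => _ [kappa _ <-]; rewrite h.
by apply: le_ereal_inf_tmp => _ [kappa _ <-]; rewrite h.
Qed.

Lemma cvg_ereal_near_gt (f : R -> \bar R) (l c : \bar R) (F : set_system R) :
  Filter F -> f x @[x --> F] --> l -> (c < l)%E -> \forall x \near F, (c < f x)%E.
Proof. by move=> FF fl cl; exact: (fl _ (open_ereal_gt' cl)). Qed.

Lemma cvg_ereal_near_lt (f : R -> \bar R) (l c : \bar R) (F : set_system R) :
  Filter F -> f x @[x --> F] --> l -> (l < c)%E -> \forall x \near F, (f x < c)%E.
Proof. by move=> FF fl cl; exact: (fl _ (open_ereal_lt' cl)). Qed.

Lemma gamma_ge0 eps (Theta : set (nat -> R)) : Theta !=set0 ->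
  (0 <= gamma xi eps Theta)%E.
Proof.
by move=> ne; apply: le_ereal_inf_tmp => _ [psi tpsi <-]; exact: gamma_test_ge0.
Qed.

Lemma characterizes_loglog (b : R) : 0 < b -> M_growth a sigma b ->
  L_growth a sigma -> characterizes a sigma xi n (fun eps => loglog eps^-1).
Proof.
move=> b0 Mb LG; split; first exact: cvg_loglog.
(* The fourth root of [loglog eps^-1] tends to infinity and is negligible against the square
   root. *)
pose Teps (eps : R) : R := Num.sqrt (Num.sqrt (loglog eps^-1)).
have Tinf : Teps eps @[eps --> (0 : R)^'+] --> +oo%R.
  apply/cvgryPge => M; near=> eps.
  have h : (M ^+ 2) ^+ 2 <= loglog eps^-1 by near: eps; exact: near0_loglog_ge.
  apply: (le_trans (ler_norm M)); rewrite -sqrtr_sqr ler_wsqrtr//.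
  by rewrite -[leLHS]ger0_norm ?sqr_ge0// -sqrtr_sqr ler_wsqrtr.
have Tsmall : Teps eps / Num.sqrt (loglog eps^-1) @[eps --> (0 : R)^'+] --> (0 : R).
  apply/cvgrPdist_le => e e0; near=> eps.
  have h : e^-1 <= Teps eps by near: eps; apply: (proj1 (cvgryPge _) Tinf).
  have T0 : 0 < Teps eps by apply: lt_le_trans h; rewrite invr_gt0.
  have -> : Num.sqrt (loglog eps^-1) = Teps eps ^+ 2.
    by rewrite sqr_sqrtr// sqrtr_ge0.
  rewrite sub0r normrN ger0_norm ?divr_ge0 ?sqr_ge0 ?(ltW T0)//.
  rewrite expr2 invfM mulrA divff ?gt_eqF// mul1r.
  by rewrite -[leRHS]invrK lef_pV2 ?posrE ?invr_gt0.
have [Du Du0 HDu] := gamma_test_cvg0 LG Tinf Tsmall.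
exists (b / 8), (Num.max (b / 8) Du); split.
- by rewrite divr_gt0.
- by rewrite le_max lexx.
- move=> r rr rC ls.
  apply: (gamma_cvg1 b0 Mb rr rC).
  have lsn := limf_esup_lt _ ls; near=> eps => kappa.
  have w0 : 1 <= loglog eps^-1 by near: eps; exact: near0_loglog_ge.
  rewrite -ler_pdivrMr ?(lt_le_trans ltr01)// -lee_fin.
  have h : (ereal_sup (range (fun kappa =>
      (u eps kappa (r eps kappa) / loglog eps^-1)%:E)) < (b / 8)%:E)%E.
    by near: eps; exact: lsn.
  apply: le_trans (ltW h).
  by apply: ereal_sup_ubound; exists kappa.
- move=> r [rrn r0] li.
  have lin := limf_einf_gt _ li.
  have un : \forall eps \near (0 : R)^'+, forall kappa,
      Du * loglog eps^-1 < u eps kappa (r eps kappa).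
    near=> eps => kappa.
    have w1 : 1 <= loglog eps^-1 by near: eps; exact: near0_loglog_ge.
    have w0 : 0 < loglog eps^-1 by rewrite (lt_le_trans ltr01).
    rewrite -ltr_pdivlMr//; apply: (@le_lt_trans _ _ (Num.max (b / 8) Du)).
      by rewrite le_max lexx orbT.
    have h : ((Num.max (b / 8) Du)%:E < ereal_inf (range (fun kappa =>
        (u eps kappa (r eps kappa) / loglog eps^-1)%:E)))%E.
      by near: eps; exact: lin.
    rewrite -lte_fin; apply: (lt_le_trans h).
    by apply: ereal_inf_lbound; exists kappa.
  have := HDu r (conj rrn r0) un => gt0.
  have z0 : (fun=> 0%E : \bar R) eps @[eps --> (0 : R)^'+] --> 0%E.
    exact: cvg_cst.
  apply: (squeeze_cvge _ z0 gt0).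
  near=> eps; apply/andP; split.
    apply: gamma_ge0; eexists; exists kappa0 => //; apply: Theta_ball_nonempty.
    by move: kappa0; near: eps; exact: rrn.
  apply: ereal_inf_lbound; exists (psi_threshold Teps eps) => //.
  exact: is_test_psi_threshold.
Unshelve. all: by end_near. Qed.

(** If one rate were too large against the other along some [eps] tending to 0, a level undetectable
    for the larger and a level detectable for the smaller could be made to coincide there, and the
    same alternative would have total error near 1 and near 0. *)
Lemma characterizes_asymp_loglog (uad : R -> R) :
  characterizes a sigma xi n uad ->
  characterizes a sigma xi n (fun eps => loglog eps^-1) ->
  exists k1 k2 : R, 0 < k1 /\ 0 < k2 /\ \forall eps \near (0 : R)^'+,
    k1 * loglog eps^-1 <= uad eps <= k2 * loglog eps^-1.
Proof.
move=> [uinf [dl [Du [dl0 dlDu lowu upu]]]] [_ [dw [Dw [dw0 dwDw loww upw]]]].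
have [rs rsP] := radii_solution.
have ratio_sup (v g : R -> R) (c : R) (r : R -> Sigma -> R) :
    (\forall eps \near (0 : R)^'+, forall kappa, u eps kappa (r eps kappa) = v eps) ->
    (\forall eps \near (0 : R)^'+, 0 < g eps /\ v eps <= c * g eps) ->
    (limf_esup (fun eps => ereal_sup (range (fun kappa =>
         (u eps kappa (r eps kappa) / g eps)%:E))) (0 : R)^'+ <= c%:E)%E.
  move=> uv vg; apply: limf_esup_le; near=> eps.
  have h : forall kappa, u eps kappa (r eps kappa) = v eps by near: eps; exact: uv.
  have [g0 vc] : 0 < g eps /\ v eps <= c * g eps by near: eps; exact: vg.
  by apply: ge_ereal_sup => _ [kappa _ <-]; rewrite h lee_fin ler_pdivrMr.
have ratio_inf (v g : R -> R) (c : R) (r : R -> Sigma -> R) :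
    (\forall eps \near (0 : R)^'+, forall kappa, u eps kappa (r eps kappa) = v eps) ->
    (\forall eps \near (0 : R)^'+, 0 < g eps /\ c * g eps <= v eps) ->
    (c%:E <= limf_einf (fun eps => ereal_inf (range (fun kappa =>
         (u eps kappa (r eps kappa) / g eps)%:E))) (0 : R)^'+)%E.
  move=> uv vg; apply: limf_einf_ge; near=> eps.
  have h : forall kappa, u eps kappa (r eps kappa) = v eps by near: eps; exact: uv.
  have [g0 vc] : 0 < g eps /\ c * g eps <= v eps by near: eps; exact: vg.
  by apply: le_ereal_inf_tmp => _ [kappa _ <-]; rewrite h lee_fin ler_pdivlMr.
have Dw0 : 0 < Dw by exact: lt_le_trans dwDw.
have Du0 : 0 < Du by exact: lt_le_trans dlDu.
have incompatible (v v' : R -> R) :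
    gamma xi eps (Theta_union a sigma (rs eps (v eps))) @[eps --> (0 : R)^'+] --> 1%E ->
    gamma xi eps (Theta_union a sigma (rs eps (v' eps))) @[eps --> (0 : R)^'+] --> 0%E ->
    \forall eps \near (0 : R)^'+, v eps != v' eps.
  move=> g1 g0; near=> eps.
  have h1 : ((2^-1)%:E < gamma xi eps (Theta_union a sigma (rs eps (v eps))))%E.
    near: eps; apply: (cvg_ereal_near_gt _ g1).
    by rewrite lte_fin invf_lt1// ltr1n.
  have h0 : (gamma xi eps (Theta_union a sigma (rs eps (v' eps))) < (2^-1)%:E)%E.
    near: eps; apply: (cvg_ereal_near_lt _ g0).
    by rewrite lte_fin invr_gt0.
  by apply/eqP => vv; move: h1; rewrite vv => /lt_trans/(_ h0); rewrite ltxx.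
have w_gt0 : \forall eps \near (0 : R)^'+, 0 < loglog eps^-1.
  near=> eps; have h : 1 <= loglog eps^-1 by near: eps; exact: near0_loglog_ge.
  by rewrite (lt_le_trans ltr01).
have u_gt0 : \forall eps \near (0 : R)^'+, 0 < uad eps.
  near=> eps; have h : 1 <= uad eps by near: eps; apply: (proj1 (cvgryPge _) uinf).
  by rewrite (lt_le_trans ltr01).
have upper : \forall eps \near (0 : R)^'+,
    uad eps <= (Dw + 1) / (dl / 2) * loglog eps^-1.
  pose v' eps := (Dw + 1) * loglog eps^-1.
  (* The minimum keeps [v] below [eps^-1] and makes it equal to [v'] wherever the claimed bound
     fails. *)
  pose v eps := Num.min (dl / 2 * uad eps) (v' eps).
  have v'P : \forall eps \near (0 : R)^'+, 0 < v' eps <= eps^-1.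
    near=> eps; apply/andP; split.
      rewrite mulr_gt0 ?addr_gt0//; near: eps; exact: w_gt0.
    by near: eps; apply: near0_loglog_le; rewrite addr_ge0// ltW.
  have vP : \forall eps \near (0 : R)^'+, 0 < v eps <= eps^-1.
    near=> eps.
    have /andP[h1 h2] : 0 < v' eps <= eps^-1 by near: eps; exact: v'P.
    have h3 : 0 < uad eps by near: eps; exact: u_gt0.
    by rewrite /v lt_min h1 mulr_gt0 ?divr_gt0//= ge_min h2 orbT.
  have [rr uv] := rsP v vP; have [rr' uv'] := rsP v' v'P.
  have g1 : gamma xi eps (Theta_union a sigma (rs eps (v eps)))
      @[eps --> (0 : R)^'+] --> 1%E.
    apply: (lowu (fun eps => rs eps (v eps)) rr).
      by exists 1 => //; exact: constant_comparable uv.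
    apply: (@le_lt_trans _ _ (dl / 2)%:E); last first.
      by rewrite lte_fin ltr_pdivrMr// ltr_pMr// ltr1n.
    apply: ratio_sup uv _; near=> eps; split; first by near: eps; exact: u_gt0.
    by rewrite ge_min lexx.
  have g0 : gamma xi eps (Theta_union a sigma (rs eps (v' eps)))
      @[eps --> (0 : R)^'+] --> 0%E.
    apply: (upw (fun eps => rs eps (v' eps)) rr').
    apply: (@lt_le_trans _ _ (Dw + 1)%:E); first by rewrite lte_fin ltrDl.
    by apply: ratio_inf uv' _; near=> eps; split => //; near: eps; exact: w_gt0.
  have vv := incompatible v v' g1 g0; near=> eps.
  have vve : v eps != v' eps by near: eps; exact: vv.
  rewrite mulrAC ler_pdivlMr ?divr_gt0// mulrC leNgt; apply/negP => h.
  by move: vve; rewrite /v min_r ?eqxx// ltW.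
have lower : \forall eps \near (0 : R)^'+,
    dw / 2 / (Du + 1) * loglog eps^-1 <= uad eps.
  pose v eps := dw / 2 * loglog eps^-1.
  (* The mirror image; here the cap [eps^-1] on [v'] follows from [upper]. *)
  pose v' eps := Num.max ((Du + 1) * uad eps) (v eps).
  have vP : \forall eps \near (0 : R)^'+, 0 < v eps <= eps^-1.
    near=> eps; apply/andP; split.
      rewrite mulr_gt0 ?divr_gt0//; near: eps; exact: w_gt0.
    by near: eps; apply: near0_loglog_le; rewrite divr_ge0// ltW.
  have v'P : \forall eps \near (0 : R)^'+, 0 < v' eps <= eps^-1.
    near=> eps.
    have /andP[h1 h2] : 0 < v eps <= eps^-1 by near: eps; exact: vP.
    rewrite /v' lt_max h1 orbT/= ge_max h2 andbT.
    have h3 : uad eps <= (Dw + 1) / (dl / 2) * loglog eps^-1 by near: eps; exact: upper.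
    apply: (@le_trans _ _ ((Du + 1) * ((Dw + 1) / (dl / 2) * loglog eps^-1))).
      by rewrite ler_pM2l// addr_gt0.
    rewrite mulrA; near: eps; apply: near0_loglog_le.
    by rewrite mulr_ge0 ?divr_ge0 ?addr_ge0// ltW.
  have [rr uv] := rsP v vP; have [rr' uv'] := rsP v' v'P.
  have g1 : gamma xi eps (Theta_union a sigma (rs eps (v eps)))
      @[eps --> (0 : R)^'+] --> 1%E.
    apply: (loww (fun eps => rs eps (v eps)) rr).
      by exists 1 => //; exact: constant_comparable uv.
    apply: (@le_lt_trans _ _ (dw / 2)%:E); last first.
      by rewrite lte_fin ltr_pdivrMr// ltr_pMr// ltr1n.
    by apply: ratio_sup uv _; near=> eps; split => //; near: eps; exact: w_gt0.
  have g0 : gamma xi eps (Theta_union a sigma (rs eps (v' eps)))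
      @[eps --> (0 : R)^'+] --> 0%E.
    apply: (upu (fun eps => rs eps (v' eps)) rr').
    apply: (@lt_le_trans _ _ (Du + 1)%:E); first by rewrite lte_fin ltrDl.
    apply: ratio_inf uv' _; near=> eps; split; first by near: eps; exact: u_gt0.
    by rewrite le_max lexx.
  have vv := incompatible v v' g1 g0; near=> eps.
  have vve : v eps != v' eps by near: eps; exact: vv.
  rewrite mulrAC ler_pdivrMr ?addr_gt0// [_ * (Du + 1)]mulrC leNgt; apply/negP => h.
  by move: vve; rewrite /v' max_r ?eqxx// ltW.
exists (dw / 2 / (Du + 1)), ((Dw + 1) / (dl / 2)); split.
  by rewrite !divr_gt0// addr_gt0.
split; first by rewrite !divr_gt0// addr_gt0.
by near=> eps; apply/andP; split; near: eps.
Unshelve. all: by end_near. Qed.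

Lemma u_asymp_loglog (uad : R -> R) (r : R -> Sigma -> R) (k1 k2 : R) :
  0 < k1 -> 0 < k2 ->
  (\forall eps \near (0 : R)^'+,
    k1 * loglog eps^-1 <= uad eps <= k2 * loglog eps^-1) ->
  u_asymp a sigma n r uad -> u_asymp a sigma n r (fun eps => loglog eps^-1).
Proof.
move=> k10 k20 kn [c1 [c2 [c10 cn]]].
(* [u_asymp] says nothing about the sign of [c2], hence the absolute value. *)
exists (c1 * k1), (`|c2| * k2); split; first by rewrite mulr_gt0.
near=> eps => kappa.
have w1 : 1 <= loglog eps^-1 by near: eps; exact: near0_loglog_ge.
have w0 : 0 < loglog eps^-1 by rewrite (lt_le_trans ltr01).
have /andP[h1 h2] : k1 * loglog eps^-1 <= uad eps <= k2 * loglog eps^-1.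
  by near: eps; exact: kn.
have h3 : forall kappa, c1 <= u eps kappa (r eps kappa) / uad eps <= c2.
  by near: eps; exact: cn.
have ua0 : 0 < uad eps by rewrite (lt_le_trans _ h1)// mulr_gt0.
have := h3 kappa; rewrite ler_pdivlMr// ler_pdivrMr// => /andP[h4 h5].
rewrite ler_pdivlMr// ler_pdivrMr//; apply/andP; split.
  by apply: le_trans h4; rewrite -mulrA ler_pM2l.
apply: (le_trans h5); rewrite -mulrA.
apply: (@le_trans _ _ (`|c2| * uad eps)); first by rewrite ler_pM2r// ler_norm.
by rewrite ler_wpM2l.
Unshelve. all: by end_near. Qed.

End Family.

(** * Assembly of the lower bound, the upper bound and the rates *)

Unset Implicit Arguments.

Theorem theorem5p4 (R : realType)
  (d : measure_display) (Omega : measurableType d) (P : probability Omega R)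
  (xi : nat -> {RV P >-> R}) (Hxi : iid_std_normal xi)
  (Sigma : Type) (HSigma : inhabited Sigma)
  (a sigma : Sigma -> nat -> R) (b0 B0 c0 : R) (tau : nat -> R)
  (Hb0 : 0 < b0) (HbB : b0 < B0) (Hc0 : 1 < c0)
  (Htau1 : forall k, (1 <= k)%N -> 1 < tau k)
  (Htau_incr : increasing1 tau)
  (Htau_infty : tau k @[k --> \oo] --> +oo%R)
  (Ha_incr : forall kappa, increasing1 (a kappa))
  (Hsigma_incr : forall kappa, increasing1 (sigma kappa))
  (Ha1 : forall kappa, b0 <= a kappa 1%N <= B0)
  (Hsigma1 : forall kappa, b0 <= sigma kappa 1%N <= B0)
  (Hsigma_ratio : forall kappa k, (1 <= k)%N ->
     tau k <= sigma kappa k.+1 / sigma kappa k)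
  (Ha_ratio : forall kappa k, (1 <= k)%N -> c0 <= a kappa k.+1 / a kappa k)
  (n : Sigma -> R -> nat) (Hn : bracketing a n) :
  (* (a) *)
  (forall b C : R, 0 < b -> 1 <= C -> M_growth a sigma b ->
     exists2 dl : R, 0 < dl &
       forall r : R -> Sigma -> R,
         radii a r -> comparable_radii a sigma n C r ->
         (limf_esup (fun eps : R =>
            u_inf a sigma n eps (r eps) * ((loglog eps^-1)^-1)%:E)
            (0 : R)^'+ <= dl%:E)%E ->
         gamma xi eps (Theta_union a sigma (r eps)) @[eps --> (0 : R)^'+]
           --> 1%E) /\
  (* (b) *)
  (L_growth a sigma ->
     forall Teps : R -> R,
       Teps eps @[eps --> (0 : R)^'+] --> +oo%R ->
       Teps eps / Num.sqrt (loglog eps^-1) @[eps --> (0 : R)^'+] --> (0 : R) ->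
       exists2 Du : R, 0 < Du &
         forall r : R -> Sigma -> R, radii a r ->
           (\forall eps \near (0 : R)^'+,
              ((Du * loglog eps^-1)%:E < u_inf a sigma n eps (r eps))%E) ->
           gamma_test xi eps (Theta_union a sigma (r eps))
             (psi_threshold Teps eps) @[eps --> (0 : R)^'+] --> 0%E) /\
  (* (c) *)
  (forall b : R, 0 < b -> M_growth a sigma b -> L_growth a sigma ->
     characterizes a sigma xi n (fun eps => loglog eps^-1) /\
     forall r : R -> Sigma -> R, radii a r ->
       (adaptive_separation_rates a sigma xi n r <->
        u_asymp a sigma n r (fun eps => loglog eps^-1))).
Proof.
have [kappa0] := HSigma.
have b1 kappa : 0 < a kappa 1%N.
  by have /andP[h _] := Ha1 kappa; exact: lt_le_trans h.
have s1 kappa : 0 < sigma kappa 1%N.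
  by have /andP[h _] := Hsigma1 kappa; exact: lt_le_trans h.
have G kappa : growing (a kappa) (sigma kappa) tau c0.
  split=> // k k1; split; [exact: Hsigma_ratio|exact: Ha_ratio].
(* The uniform estimates ask for a bound on the product of the two first terms, hence the square of
   [B0]. *)
have first_le kappa : product_seq (a kappa) (sigma kappa) 1%N <= B0 * B0.
  have /andP[_ h1] := Ha1 kappa; have /andP[_ h2] := Hsigma1 kappa.
  by apply: ler_pM => //; exact: ltW.
have lower := gamma_cvg1 Hxi kappa0 G first_le Htau_infty Hn.
have upper := gamma_test_cvg0 Hxi kappa0 G first_le Htau_incr Hn.
split; [|split].
- move=> b C bp C1 Mb.
  have C0 : 0 < C by exact: lt_le_trans C1.
  (* Passing from the infimum to every parameter costs [C]; 16 instead of 8 turns the weak limsup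
     inequality into a strict one. *)
  exists (b / (16 * C)); first by rewrite divr_gt0// mulr_gt0.
  move=> r rr rC uinf; apply: (lower b bp Mb r rr); first by exists C.
  have ulim : (limf_esup (fun eps : R =>
      u_inf a sigma n eps (r eps) * ((loglog eps^-1)^-1)%:E) (0 : R)^'+
      < (b / (8 * C))%:E)%E.
    apply: le_lt_trans uinf _; rewrite lte_fin ltr_pM2l// ltf_pV2 ?posrE ?mulr_gt0//.
    by rewrite ltr_pM2r// ltr_nat.
  have un := limf_esup_lt _ ulim.
  near=> eps => kappa.
  have w1 : 1 <= loglog eps^-1 by near: eps; exact: near0_loglog_ge.
  have w0 : 0 < loglog eps^-1 by exact: lt_le_trans w1.
  have h : (u_inf a sigma n eps (r eps) * ((loglog eps^-1)^-1)%:E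
    < (b / (8 * C))%:E)%E by near: eps; exact: un.
  have hC : (u_sup a sigma n eps (r eps) <= C%:E * u_inf a sigma n eps (r eps))%E.
    by near: eps; exact: rC.
  rewrite lte_pdivrMr// -EFinM in h.
  rewrite -lee_fin; apply: (le_trans (u_sup_ge _ _ _ _ _ kappa)).
  apply: (le_trans hC); apply: (@le_trans _ _ (C%:E * (b / (8 * C) * loglog eps^-1)%:E)%E).
    by rewrite lee_pmul2l// ltW.
  rewrite -EFinM lee_fin le_eqVlt; apply/orP; left; apply/eqP.
  by field; rewrite gt_eqF.
- move=> LG Teps Tinf Tsmall; have [Du Du0 h] := upper LG Teps Tinf Tsmall.
  exists Du => // r rr un; apply: h => //; near=> eps => kappa.
  have hu : ((Du * loglog eps^-1)%:E < u_inf a sigma n eps (r eps))%E.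
    by near: eps; exact: un.
  by rewrite -lte_fin; apply: lt_le_trans hu (u_inf_le _ _ _ _ _ kappa).
- move=> b bp Mb LG.
  have ch := characterizes_loglog Hxi kappa0 G first_le Htau_incr Htau_infty Hn bp Mb LG.
  (* Separation rates may come with another characterising family [uad]; it is first shown to be
     equivalent to [loglog eps^-1]. *)
  split=> // r rr; split=> [[uad chu ua]|ua]; last by exists (fun eps => loglog eps^-1).
  have [k1 [k2 [k10 [k20 kn]]]] := characterizes_asymp_loglog G first_le Hn chu ch.
  exact: u_asymp_loglog k10 k20 kn ua.
Unshelve. all: by end_near. Qed.
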